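(* Suppose $S\subseteq\kappa$ is $\Pi^1_\xi$-indescribable in $\kappa$ where $\xi<\kappa^+$ and let $\zeta<\xi$. Then the set \[C=\{\alpha<\kappa:\ S\cap\alpha\text{ is }\Pi^1_{f^\kappa_\zeta(\alpha)}\text{-indescribable in }\alpha\}\] is in the filter $\Pi^1_\xi(\kappa)^*$.
   Context: Canonical functions. For every regular cardinal $\kappa$ and every ordinal $\xi$ with $\kappa\le\xi<\kappa^+$ fix a bijection $b_{\kappa,\xi}:\kappa\to\xi$, with $b_{\kappa,\kappa}=\mathrm{id}_\kappa$. For $\xi<\kappa^+$ and $\alpha<\kappa$ let $F^\kappa_\xi(\alpha)=\xi$ if $\xi<\kappa$, and $F^\kappa_\xi(\alpha)=b_{\kappa,\xi}[\alpha]$ if $\kappa\le\xi<\kappa^+$. Let $f^\kappa_\xi(\alpha)=\mathrm{ot}(F^\kappa_\xi(\alpha))$ and let $\pi^\kappa_{\xi,\alpha}:F^\kappa_\xi(\alpha)\to f^\kappa_\xi(\alpha)$ be the transitive collapse. Formulas. A formula is $\Pi^1_0$ (equivalently $\Sigma^1_0$) over $V_\kappa$ if it is a first-order formula of set theory (only first-order quantifiers) in which free variables and parameters of two types may occur: first-order ones (ranging over, resp. being, elements of $V_\kappa$) and second-order ones (ranging over, resp. being, subsets of $V_\kappa$). It is $\Pi^1_{\xi+1}$ over $V_\kappa$ if it has the form $\forall X_{k_1}\cdots\forall X_{k_m}\psi$ with $\psi$ a $\Sigma^1_\xi$ formula over $V_\kappa$, and $\Sigma^1_{\xi+1}$ if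 it has the form $\exists X_{k_1}\cdots\exists X_{k_m}\psi$ with $\psi$ a $\Pi^1_\xi$ formula over $V_\kappa$ ($m\in\omega$; second-order quantifiers). For $\xi$ a limit, a formula with finitely many second-order free variables and finitely many second-order parameters is $\Pi^1_\xi$ over $V_\kappa$ if it has the form $\bigwedge_{\zeta<\xi}\varphi_\zeta$ with each $\varphi_\zeta$ being $\Pi^1_\zeta$ over $V_\kappa$, and $\Sigma^1_\xi$ if it has the form $\bigvee_{\zeta<\xi}\varphi_\zeta$ with each $\varphi_\zeta$ being $\Sigma^1_\zeta$ over $V_\kappa$. Restriction. For $\varphi$ a $\Pi^1_\xi$ or $\Sigma^1_\xi$ formula over $V_\kappa$, $\xi<\kappa^+$, and $\alpha<\kappa$ regular, $\varphi|^\kappa_\alpha$ is defined by recursion on $\xi$. If $\xi<\kappa$, replace each second-order parameter $A_i$ by $A_i\cap V_\alpha$. If $\xi=\zeta+1\geq\kappa$, the restriction of $\forall\vec X\psi$ is $\forall\vec X(\psi|^\kappa_\alpha)$ and that of $\exists\vec X\psi$ is $\exists\vec X(\psi|^\kappa_\alpha)$. If $\xi\ge\kappa$ is a limit and $\varphi=\bigwedge_{\zeta<\xi}\psi_\zeta$, then $\varphi|^\kappa_\alpha=\bigwedge_{\zeta<f^\kappa_\xi(\alpha)}\psi_{(\pi^\kappa_{\xi,\alpha})^{-1}(\zeta)}|^\kappa_\alpha$, provided $\psi_{(\pi^\kappa_{\xi,\alpha})^{-1}(\zeta)}|^\kappa_\alpha$ is a $\Pi^1_\zeta$ formula over $V_\alpha$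 for every $\zeta<f^\kappa_\xi(\alpha)$; otherwise undefined. Similarly for $\Sigma^1_\xi$ with $\bigvee$. Indescribability. For a cardinal $\kappa$ and $\xi<\kappa^+$, a set $S\subseteq\kappa$ is $\Pi^1_\xi$-indescribable (in $\kappa$) if for every $\Pi^1_\xi$ sentence $\varphi$ over $V_\kappa$ (parameters allowed), if $V_\kappa\models\varphi$ then there is some $\alpha\in S$ with $V_\alpha\models\varphi|^\kappa_\alpha$ (which includes that $\varphi|^\kappa_\alpha$ is defined and is a formula over $V_\alpha$). If $\alpha$ is not a cardinal or $\eta\ge\alpha^+$, no subset of $\alpha$ counts as $\Pi^1_\eta$-indescribable in $\alpha$. $\Pi^1_\xi(\kappa)=\{X\subseteq\kappa: X\text{ is not }\Pi^1_\xi\text{-indescribable in }\kappa\}$, and $\Pi^1_\xi(\kappa)^*=\{X\subseteq\kappa:\kappa\setminus X\in\Pi^1_\xi(\kappa)\}$ is the dual filter. *)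

(* Defs.v *)
From Stdlib Require Import List Classical ClassicalEpsilon FunctionalExtensionality
  PropExtensionality.

(** * The universe of sets

    [V] is the cumulative hierarchy over [Type]: Aczel's trees modulo
    bisimulation.  Classes are predicates [V -> Prop], class functions are Rocq
    functions [V -> V], and replacement holds for all of them. *)

Inductive Tree : Type := tree (A : Type) (f : A -> Tree).

Fixpoint bisim (x y : Tree) : Prop :=
  match x, y with
  | tree A f, tree B g =>
      (forall i, exists j, bisim (f i) (g j)) /\
      (forall j, exists i, bisim (f i) (g j))
  end.

Lemma bisim_refl x : bisim x x.
Proof.
induction x as [A f IH]; simpl; split; intros i; exists i; apply IH.
Qed.

Lemma bisim_sym x : forall y, bisim x y -> bisim y x.
Proof.
induction x as [A f IH]; intros [B g] [H1 H2]; simpl; split.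
- intros j. destruct (H2 j) as [i Hi]. exists i. now apply IH.
- intros i. destruct (H1 i) as [j Hj]. exists j. now apply IH.
Qed.

Lemma bisim_trans x : forall y z, bisim x y -> bisim y z -> bisim x z.
Proof.
induction x as [A f IH]; intros [B g] [C h] [H1 H2] [K1 K2]; simpl; split.
- intros i. destruct (H1 i) as [j Hj]. destruct (K1 j) as [k Hk].
  exists k. now apply IH with (g j).
- intros k. destruct (K2 k) as [j Hj]. destruct (H2 j) as [i Hi].
  exists i. now apply IH with (g j).
Qed.

Definition leaf : Tree := tree False (fun i => match i with end).

(* A chosen representative of the bisimulation class. *)
Definition canon (x : Tree) : Tree := epsilon (inhabits leaf) (bisim x).

Lemma canon_bisim x : bisim x (canon x).
Proof. unfold canon. apply epsilon_spec. exists x. apply bisim_refl. Qed.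

Lemma canon_eq x y : bisim x y -> canon x = canon y.
Proof.
intros H. unfold canon. f_equal. apply functional_extensionality. intros z.
apply propositional_extensionality. split; intros K.
- apply bisim_trans with x; auto using bisim_sym.
- apply bisim_trans with y; auto.
Qed.

Record V : Type := mkV { rep : Tree; rep_canon : canon rep = rep }.

Lemma rep_inj x y : rep x = rep y -> x = y.
Proof.
destruct x as [x Hx], y as [y Hy]; simpl. intros E. subst y.
f_equal. apply proof_irrelevance.
Qed.

Definition class (x : Tree) : V :=
  mkV (canon x) (eq_sym (canon_eq _ _ (canon_bisim x))).

Lemma class_eq x y : class x = class y <-> bisim x y.
Proof.
split.
- intros E. apply (f_equal rep) in E; simpl in E.
  apply bisim_trans with (canon x); [apply canon_bisim|].
  rewrite E. apply bisim_sym, canon_bisim.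
- intros H. apply rep_inj. now apply canon_eq.
Qed.

Lemma class_rep x : class (rep x) = x.
Proof. apply rep_inj. apply rep_canon. Qed.

Definition idx (a : V) : Type := match rep a with tree A _ => A end.

Definition elem (a : V) : idx a -> V :=
  match rep a as t return match t with tree A _ => A end -> V with
  | tree A f => fun i => class (f i)
  end.

Definition mem (x a : V) : Prop := exists i : idx a, x = elem a i.

Notation "x ∈ a" := (mem x a) (at level 70).

Lemma mem_elem a (i : idx a) : elem a i ∈ a.
Proof. now exists i. Qed.

(* The set of all [f i]; all set constructions below go through it. *)
Definition set_of (A : Type) (f : A -> V) : V :=
  class (tree A (fun i => rep (f i))).

Lemma mem_class x A (f : A -> Tree) :
  x ∈ class (tree A f) <-> exists i, x = class (f i).
Proof.
assert (H := canon_bisim (tree A f)).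
unfold mem, elem, idx; simpl.
destruct (canon (tree A f)) as [B g]. destruct H as [H1 H2].
split; intros [i ->].
- destruct (H2 i) as [j Hj]. exists j. apply class_eq. now apply bisim_sym.
- destruct (H1 i) as [j Hj]. exists j. now apply class_eq.
Qed.

Lemma in_set_of x A (f : A -> V) : x ∈ set_of A f <-> exists i, x = f i.
Proof.
unfold set_of. rewrite mem_class.
split; intros [i Hi]; exists i; rewrite class_rep in *; exact Hi.
Qed.

Lemma extensionality a b : (forall x, x ∈ a <-> x ∈ b) -> a = b.
Proof.
intros H. rewrite <- (class_rep a), <- (class_rep b) in *.
destruct (rep a) as [A f], (rep b) as [B g]. apply class_eq; simpl. split.
- intros i.
  assert (K : class (f i) ∈ class (tree A f)) by (apply mem_class; now exists i).
  apply H, mem_class in K. destruct K as [j Hj]. exists j. now apply class_eq.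
- intros j.
  assert (K : class (g j) ∈ class (tree B g)) by (apply mem_class; now exists j).
  apply H, mem_class in K. destruct K as [i Hi]. exists i.
  now apply class_eq.
Qed.

Lemma mem_wf : well_founded mem.
Proof.
intros a. rewrite <- (class_rep a). induction (rep a) as [A f IH].
constructor. intros x Hx. apply mem_class in Hx. destruct Hx as [i ->]. apply IH.
Qed.

Definition subset (a b : V) : Prop := forall x, x ∈ a -> x ∈ b.

Notation "a ⊆ b" := (subset a b) (at level 70).

Definition empty : V := set_of False (fun i => match i with end).

Definition sep (a : V) (P : V -> Prop) : V :=
  set_of {i : idx a | P (elem a i)} (fun i => elem a (proj1_sig i)).

Definition img (a : V) (f : V -> V) : V := set_of (idx a) (fun i => f (elem a i)).

Definition power (a : V) : V :=
  set_of (idx a -> Prop) (fun Q => set_of {i | Q i} (fun i => elem a (proj1_sig i))).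

Definition bigcup (a : V) : V :=
  set_of {i : idx a & idx (elem a i)} (fun p => elem (elem a (projT1 p)) (projT2 p)).

Definition inter (a b : V) : V := sep a (fun x => x ∈ b).

Definition setminus (a b : V) : V := sep a (fun x => ~ x ∈ b).

(* The successor ordinal [a ∪ {a}]. *)
Definition succ (a : V) : V :=
  set_of (option (idx a)) (fun o => match o with Some i => elem a i | None => a end).

Lemma in_empty x : ~ x ∈ empty.
Proof. unfold empty. rewrite in_set_of. now intros [[] _]. Qed.

Lemma in_sep x a P : x ∈ sep a P <-> x ∈ a /\ P x.
Proof.
unfold sep. rewrite in_set_of. split.
- intros [[i Hi] ->]. split; [apply mem_elem | exact Hi].
- intros [[i ->] H]. now exists (exist _ i H).
Qed.

Lemma in_img y a f : y ∈ img a f <-> exists x, x ∈ a /\ y = f x.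
Proof.
unfold img. rewrite in_set_of. split.
- intros [i ->]. exists (elem a i). split; [apply mem_elem | reflexivity].
- intros [x [[i ->] ->]]. now exists i.
Qed.

Lemma in_power x a : x ∈ power a <-> x ⊆ a.
Proof.
unfold power. rewrite in_set_of. split.
- intros [Q ->] y Hy. rewrite in_set_of in Hy. destruct Hy as [i ->]. apply mem_elem.
- intros H. exists (fun i => elem a i ∈ x). apply extensionality. intros y.
  rewrite in_set_of. split.
  + intros Hy. destruct (H y Hy) as [i ->]. now exists (exist _ i Hy).
  + now intros [[i Hi] ->].
Qed.

Lemma in_bigcup x a : x ∈ bigcup a <-> exists y, y ∈ a /\ x ∈ y.
Proof.
unfold bigcup. rewrite in_set_of. split.
- intros [[i j] ->]. exists (elem a i). split; apply mem_elem.
- intros [y [[i ->] [j ->]]]. now exists (existT _ i j).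
Qed.

Lemma in_succ x a : x ∈ succ a <-> x ∈ a \/ x = a.
Proof.
unfold succ. rewrite in_set_of. split.
- intros [[i|] ->]; [left; apply mem_elem | now right].
- intros [[i ->] | ->]; [now exists (Some i) | now exists None].
Qed.

(** * Ordinals and cardinals *)

Definition transitive (a : V) : Prop := forall x, x ∈ a -> x ⊆ a.

Definition ordinal (a : V) : Prop := transitive a /\ forall x, x ∈ a -> transitive x.

Definition limit (a : V) : Prop :=
  ordinal a /\ a <> empty /\ forall x, x ∈ a -> succ x ∈ a.

Definition maps (a c : V) (f : V -> V) : Prop := forall x, x ∈ a -> f x ∈ c.

Definition bijection (a c : V) (f : V -> V) : Prop :=
  maps a c f /\
  (forall x y, x ∈ a -> y ∈ a -> f x = f y -> x = y) /\
  (forall y, y ∈ c -> exists x, x ∈ a /\ f x = y).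

Definition cardinal (κ : V) : Prop :=
  ordinal κ /\ forall β, β ∈ κ -> ~ exists f, bijection β κ f.

(* An infinite cardinal (a cardinal is infinite iff it is a limit ordinal) with
   no unbounded function from a smaller ordinal. *)
Definition regular (κ : V) : Prop :=
  cardinal κ /\ limit κ /\
  forall β f, β ∈ κ -> maps β κ f -> exists γ, γ ∈ κ /\ maps β γ f.

Definition is_card_succ (κ μ : V) : Prop :=
  cardinal μ /\ κ ∈ μ /\ forall ν, cardinal ν -> κ ∈ ν -> μ ⊆ ν.

(* [ξ < κ⁺] *)
Definition lt_card_succ (ξ κ : V) : Prop := exists μ, is_card_succ κ μ /\ ξ ∈ μ.

(* [V_ α] is the union of the power sets of the [V_ β], [β < α]. *)
Definition V_ : V -> V :=
  Fix mem_wf (fun _ => V)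
    (fun α rec => bigcup (set_of (idx α) (fun i => power (rec (elem α i) (mem_elem α i))))).

Lemma V_eq α : V_ α = bigcup (img α (fun β => power (V_ β))).
Proof.
unfold V_ at 1. rewrite Fix_eq; [reflexivity|].
intros x f g H. do 2 f_equal. apply functional_extensionality. intros i.
f_equal. apply H.
Qed.

(* The transitive collapse of a set [X] of ordinals:
   [collapse X β = {collapse X γ | γ ∈ X, γ < β}]. *)
Definition collapse (X : V) : V -> V :=
  Fix mem_wf (fun _ => V)
    (fun β rec => set_of {i : idx β | elem β i ∈ X}
       (fun i => rec (elem β (proj1_sig i)) (mem_elem β (proj1_sig i)))).

Lemma collapse_eq X β : collapse X β = img (inter β X) (collapse X).
Proof.
unfold collapse at 1. rewrite Fix_eq.
- fold (collapse X). apply extensionality. intros y.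
  rewrite in_set_of, in_img. split.
  + intros [[i Hi] ->]. exists (elem β i). split; [|reflexivity].
    apply in_sep. split; [apply mem_elem | exact Hi].
  + intros [x [Hx ->]]. apply in_sep in Hx. destruct Hx as [[i ->] Hi].
    now exists (exist _ i Hi).
- intros x f g H. f_equal. apply functional_extensionality. intros i. apply H.
Qed.

(* Order type of a set of ordinals. *)
Definition ot (X : V) : V := img X (collapse X).

(* Inverse of [collapse X : X -> ot X]. *)
Definition collapse_inv (X ζ : V) : V :=
  epsilon (inhabits empty) (fun β => β ∈ X /\ collapse X β = ζ).

(** * Canonical functions

    [b κ ξ] is the chosen bijection from [κ] to [ξ]. *)

Definition canonical_bijections (b : V -> V -> V -> V) : Prop :=
  forall κ, regular κ ->
    (forall ξ, ordinal ξ -> κ ⊆ ξ -> lt_card_succ ξ κ -> bijection κ ξ (b κ ξ)) /\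
    (forall α, α ∈ κ -> b κ κ α = α).

Definition canF (b : V -> V -> V -> V) (κ ξ α : V) : V :=
  if excluded_middle_informative (ξ ∈ κ) then ξ else img α (b κ ξ).

Definition canf (b : V -> V -> V -> V) (κ ξ α : V) : V := ot (canF b κ ξ α).

(** * Formulas

    Variables of both types are named by natural numbers; parameters are part of
    the formula. *)

Inductive term : Type :=
| var (n : nat)
| par (a : V).

(* First-order formulas; the other connectives and [∃] are abbreviations.
   The second argument of [FIn] is a second-order variable or parameter. *)
Inductive fo : Type :=
| FMem (s t : term)
| FEq (s t : term)
| FIn (s X : term)
| FNot (p : fo)
| FAnd (p q : fo)
| FAll (n : nat) (p : fo).

(* In [BigAnd ξ φ] and [BigOr ξ φ] only the values [φ ζ] with [ζ ∈ ξ] matter. *)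
Inductive form : Type :=
| FO (p : fo)
| SAll (k : nat) (φ : form)
| SEx (k : nat) (φ : form)
| BigAnd (ξ : V) (φ : V -> form)
| BigOr (ξ : V) (φ : V -> form).

Definition salls (ks : list nat) (φ : form) : form := fold_right SAll φ ks.
Definition sexs (ks : list nat) (φ : form) : form := fold_right SEx φ ks.

(** Free variables and second-order parameters *)

Fixpoint fo_free1 (p : fo) (n : nat) : Prop :=
  match p with
  | FMem s t | FEq s t => s = var n \/ t = var n
  | FIn s _ => s = var n
  | FNot p => fo_free1 p n
  | FAnd p q => fo_free1 p n \/ fo_free1 q n
  | FAll m p => n <> m /\ fo_free1 p n
  end.

Fixpoint fo_free2 (p : fo) (k : nat) : Prop :=
  match p with
  | FMem _ _ | FEq _ _ => False
  | FIn _ X => X = var k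
  | FNot p => fo_free2 p k
  | FAnd p q => fo_free2 p k \/ fo_free2 q k
  | FAll _ p => fo_free2 p k
  end.

Fixpoint fo_par2 (p : fo) (A : V) : Prop :=
  match p with
  | FMem _ _ | FEq _ _ => False
  | FIn _ X => X = par A
  | FNot p => fo_par2 p A
  | FAnd p q => fo_par2 p A \/ fo_par2 q A
  | FAll _ p => fo_par2 p A
  end.

Fixpoint free1 (φ : form) (n : nat) : Prop :=
  match φ with
  | FO p => fo_free1 p n
  | SAll _ ψ | SEx _ ψ => free1 ψ n
  | BigAnd ξ ψ | BigOr ξ ψ => exists ζ, ζ ∈ ξ /\ free1 (ψ ζ) n
  end.

Fixpoint free2 (φ : form) (k : nat) : Prop :=
  match φ with
  | FO p => fo_free2 p k
  | SAll m ψ | SEx m ψ => k <> m /\ free2 ψ k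
  | BigAnd ξ ψ | BigOr ξ ψ => exists ζ, ζ ∈ ξ /\ free2 (ψ ζ) k
  end.

Fixpoint par2 (φ : form) (A : V) : Prop :=
  match φ with
  | FO p => fo_par2 p A
  | SAll _ ψ | SEx _ ψ => par2 ψ A
  | BigAnd ξ ψ | BigOr ξ ψ => exists ζ, ζ ∈ ξ /\ par2 (ψ ζ) A
  end.

Definition sentence (φ : form) : Prop :=
  (forall n, ~ free1 φ n) /\ (forall k, ~ free2 φ k).

Definition finitely_many {A : Type} (P : A -> Prop) : Prop :=
  exists l : list A, forall x, P x -> In x l.

(** The classes [Π^1_ξ] and [Σ^1_ξ] over [V_ κ] *)

Definition par1_over (κ : V) (t : term) : Prop :=
  match t with var _ => True | par a => a ∈ V_ κ end.

Definition par2_over (κ : V) (t : term) : Prop :=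
  match t with var _ => True | par A => A ⊆ V_ κ end.

Fixpoint fo_over (κ : V) (p : fo) : Prop :=
  match p with
  | FMem s t | FEq s t => par1_over κ s /\ par1_over κ t
  | FIn s X => par1_over κ s /\ par2_over κ X
  | FNot p => fo_over κ p
  | FAnd p q => fo_over κ p /\ fo_over κ q
  | FAll _ p => fo_over κ p
  end.

Inductive is_Pi (κ : V) : V -> form -> Prop :=
| Pi_zero p : fo_over κ p -> is_Pi κ empty (FO p)
| Pi_succ ξ ks ψ : is_Sigma κ ξ ψ -> is_Pi κ (succ ξ) (salls ks ψ)
| Pi_limit ξ φ : limit ξ -> (forall ζ, ζ ∈ ξ -> is_Pi κ ζ (φ ζ)) ->
    finitely_many (free2 (BigAnd ξ φ)) -> finitely_many (par2 (BigAnd ξ φ)) ->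
    is_Pi κ ξ (BigAnd ξ φ)
with is_Sigma (κ : V) : V -> form -> Prop :=
| Sigma_zero p : fo_over κ p -> is_Sigma κ empty (FO p)
| Sigma_succ ξ ks ψ : is_Pi κ ξ ψ -> is_Sigma κ (succ ξ) (sexs ks ψ)
| Sigma_limit ξ φ : limit ξ -> (forall ζ, ζ ∈ ξ -> is_Sigma κ ζ (φ ζ)) ->
    finitely_many (free2 (BigOr ξ φ)) -> finitely_many (par2 (BigOr ξ φ)) ->
    is_Sigma κ ξ (BigOr ξ φ).

Definition formula_over (κ : V) (φ : form) : Prop :=
  exists ξ, is_Pi κ ξ φ \/ is_Sigma κ ξ φ.

(** Satisfaction in [V_ κ], second-order quantifiers ranging over subsets of
    [V_ κ] *)

Definition upd (s : nat -> V) (n : nat) (x : V) : nat -> V :=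
  fun m => if PeanoNat.Nat.eq_dec m n then x else s m.

Definition value (s : nat -> V) (t : term) : V :=
  match t with var n => s n | par a => a end.

Fixpoint fo_sat (κ : V) (p : fo) (s S : nat -> V) : Prop :=
  match p with
  | FMem t u => value s t ∈ value s u
  | FEq t u => value s t = value s u
  | FIn t X => value s t ∈ value S X
  | FNot p => ~ fo_sat κ p s S
  | FAnd p q => fo_sat κ p s S /\ fo_sat κ q s S
  | FAll n p => forall x, x ∈ V_ κ -> fo_sat κ p (upd s n x) S
  end.

Fixpoint sat (κ : V) (φ : form) (s S : nat -> V) : Prop :=
  match φ with
  | FO p => fo_sat κ p s S
  | SAll k ψ => forall X, X ⊆ V_ κ -> sat κ ψ s (upd S k X)
  | SEx k ψ => exists X, X ⊆ V_ κ /\ sat κ ψ s (upd S k X)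
  | BigAnd ξ ψ => forall ζ, ζ ∈ ξ -> sat κ (ψ ζ) s S
  | BigOr ξ ψ => exists ζ, ζ ∈ ξ /\ sat κ (ψ ζ) s S
  end.

(* For sentences; the assignment is then irrelevant. *)
Definition models (κ : V) (φ : form) : Prop :=
  sat κ φ (fun _ => empty) (fun _ => empty).

(** * Restriction of formulas *)

Definition cut_term (α : V) (X : term) : term :=
  match X with var k => var k | par A => par (inter A (V_ α)) end.

Fixpoint fo_cut (α : V) (p : fo) : fo :=
  match p with
  | FMem s t => FMem s t
  | FEq s t => FEq s t
  | FIn s X => FIn s (cut_term α X)
  | FNot p => FNot (fo_cut α p)
  | FAnd p q => FAnd (fo_cut α p) (fo_cut α q)
  | FAll n p => FAll n (fo_cut α p)
  end.

(* Replace each second-order parameter [A] by [A ∩ V_ α]. *)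
Fixpoint cut (α : V) (φ : form) : form :=
  match φ with
  | FO p => FO (fo_cut α p)
  | SAll k ψ => SAll k (cut α ψ)
  | SEx k ψ => SEx k (cut α ψ)
  | BigAnd ξ ψ => BigAnd ξ (fun ζ => cut α (ψ ζ))
  | BigOr ξ ψ => BigOr ξ (fun ζ => cut α (ψ ζ))
  end.

(* [restr b κ α φ] is [φ|^κ_α], provided [restr_defined b κ α φ].  The recursion
   on the level of [φ] is a recursion on [φ] itself, because the level of an
   infinitary connective is its index; [restr_small] is the clause for levels
   below [κ], [restr_salls] and [restr_sexs] are those for successor levels. *)
Fixpoint restr (b : V -> V -> V -> V) (κ α : V) (φ : form) : form :=
  match φ with
  | FO p => FO (fo_cut α p)
  | SAll k ψ => SAll k (restr b κ α ψ)
  | SEx k ψ => SEx k (restr b κ α ψ)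
  | BigAnd ξ ψ =>
      if excluded_middle_informative (ξ ∈ κ) then cut α φ
      else BigAnd (canf b κ ξ α)
             (fun ζ => restr b κ α (ψ (collapse_inv (canF b κ ξ α) ζ)))
  | BigOr ξ ψ =>
      if excluded_middle_informative (ξ ∈ κ) then cut α φ
      else BigOr (canf b κ ξ α)
             (fun ζ => restr b κ α (ψ (collapse_inv (canF b κ ξ α) ζ)))
  end.

(* At limit levels [ξ ≥ κ] the restriction uses [canF b κ ξ], which is only
   available for regular [κ]. *)
Fixpoint restr_defined (b : V -> V -> V -> V) (κ α : V) (φ : form) : Prop :=
  match φ with
  | FO _ => True
  | SAll _ ψ | SEx _ ψ => restr_defined b κ α ψ
  | BigAnd ξ ψ =>
      ξ ∈ κ \/
      regular κ /\
      forall ζ, ζ ∈ canf b κ ξ α ->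
        restr_defined b κ α (ψ (collapse_inv (canF b κ ξ α) ζ)) /\
        is_Pi α ζ (restr b κ α (ψ (collapse_inv (canF b κ ξ α) ζ)))
  | BigOr ξ ψ =>
      ξ ∈ κ \/
      regular κ /\
      forall ζ, ζ ∈ canf b κ ξ α ->
        restr_defined b κ α (ψ (collapse_inv (canF b κ ξ α) ζ)) /\
        is_Sigma α ζ (restr b κ α (ψ (collapse_inv (canF b κ ξ α) ζ)))
  end.

Lemma restr_salls b κ α ks ψ :
  restr b κ α (salls ks ψ) = salls ks (restr b κ α ψ) /\
  (restr_defined b κ α (salls ks ψ) <-> restr_defined b κ α ψ).
Proof.
induction ks as [|k ks [IH1 IH2]]; simpl; [tauto|]. split; [now rewrite IH1 | exact IH2].
Qed.

Lemma restr_sexs b κ α ks ψ :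
  restr b κ α (sexs ks ψ) = sexs ks (restr b κ α ψ) /\
  (restr_defined b κ α (sexs ks ψ) <-> restr_defined b κ α ψ).
Proof.
induction ks as [|k ks [IH1 IH2]]; simpl; [tauto|]. split; [now rewrite IH1 | exact IH2].
Qed.

Lemma cut_salls α ks ψ : cut α (salls ks ψ) = salls ks (cut α ψ).
Proof. induction ks as [|k ks IH]; simpl; [reflexivity | now rewrite IH]. Qed.

Lemma cut_sexs α ks ψ : cut α (sexs ks ψ) = sexs ks (cut α ψ).
Proof. induction ks as [|k ks IH]; simpl; [reflexivity | now rewrite IH]. Qed.

Scheme is_Pi_mut := Induction for is_Pi Sort Prop
with is_Sigma_mut := Induction for is_Sigma Sort Prop.
Combined Scheme is_Pi_Sigma_ind from is_Pi_mut, is_Sigma_mut.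

Lemma restr_small b κ' α κ :
  ordinal κ ->
  (forall ξ φ, is_Pi κ' ξ φ -> ξ ∈ κ ->
     restr b κ α φ = cut α φ /\ restr_defined b κ α φ) /\
  (forall ξ φ, is_Sigma κ' ξ φ -> ξ ∈ κ ->
     restr b κ α φ = cut α φ /\ restr_defined b κ α φ).
Proof.
intros [Htr _].
assert (Hs : forall ξ, succ ξ ∈ κ -> ξ ∈ κ).
{ intros ξ H. apply (Htr _ H). apply in_succ. now right. }
apply (is_Pi_Sigma_ind κ'
  (fun ξ φ _ => ξ ∈ κ -> restr b κ α φ = cut α φ /\ restr_defined b κ α φ)
  (fun ξ φ _ => ξ ∈ κ -> restr b κ α φ = cut α φ /\ restr_defined b κ α φ)).
- simpl. auto.
- intros ξ ks ψ _ IH H. destruct (IH (Hs _ H)) as [E D].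
  destruct (restr_salls b κ α ks ψ) as [E' D'].
  rewrite E', cut_salls, E. tauto.
- intros ξ φ _ _ _ _ _ H. simpl.
  destruct (excluded_middle_informative (ξ ∈ κ)); tauto.
- simpl. auto.
- intros ξ ks ψ _ IH H. destruct (IH (Hs _ H)) as [E D].
  destruct (restr_sexs b κ α ks ψ) as [E' D'].
  rewrite E', cut_sexs, E. tauto.
- intros ξ φ _ _ _ _ _ H. simpl.
  destruct (excluded_middle_informative (ξ ∈ κ)); tauto.
Qed.

(** * Indescribability *)

(* [S] is [Π^1_ξ]-indescribable in [κ]. *)
Definition indescribable (b : V -> V -> V -> V) (ξ κ S : V) : Prop :=
  cardinal κ /\ lt_card_succ ξ κ /\ S ⊆ κ /\
  forall φ, is_Pi κ ξ φ -> sentence φ -> models κ φ ->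
    exists α, α ∈ S /\ regular α /\
      restr_defined b κ α φ /\ formula_over α (restr b κ α φ) /\
      models α (restr b κ α φ).

(* [Π^1_ξ(κ)] *)
Definition Pi_ideal (b : V -> V -> V -> V) (ξ κ : V) : V :=
  sep (power κ) (fun X => ~ indescribable b ξ κ X).

(* [Π^1_ξ(κ)^*] *)
Definition Pi_filter (b : V -> V -> V -> V) (ξ κ : V) : V :=
  sep (power κ) (fun X => setminus κ X ∈ Pi_ideal b ξ κ).

(* Main.v *)
(** Write [F(α) = F^κ_ξ(α)].  On a club of [α] the canonical functions are coherent, i.e.
    [F^κ_η(α) = F(α) ∩ η] for [η ∈ F(α)], and then satisfaction of [φ|^κ_α] in [V_α] is
    satisfaction of [φ] with all infinitary connectives cut down to the indices in [F(α)].

    There is a universal [Π^1_ζ] formula [U(X)], built by recursion on [ζ].  Its leaves need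
    no coding of first-order syntax: a first-order statement holds in [V_δ] iff it holds in
    [V_γ] for club many [γ < δ], so it can be replaced by the set of these [γ].  Let [R] be the
    set of all [(β, y)] with [β ∈ S] and [V_β ⊨ U|^κ_β(y)].  Then [V_κ] satisfies the
    [Π^1_(ζ+1)] sentence [Φ] saying that for all [X], [¬ U(X)] or [(β, X ∩ V_β) ∈ R] for some
    [β]; this is the indescribability of [S] applied to [U(X)].

    If the complement [T] of the set [C] were [Π^1_ξ]-indescribable, then [Φ] would reflect to
    some [α ∈ T].  A true [Π^1_(f_ζ(α))] sentence [ψ] over [V_α] has a code [X] with
    [V_α ⊨ U|^κ_α(X)], which may also contain any prescribed club of [α].  So [Φ|^κ_α] gives
    [β ∈ S ∩ α] in this club with [V_β ⊨ U|^κ_β(X ∩ V_β)], and for club many [β] this implies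
    [V_β ⊨ ψ|^α_β].  Hence [α ∈ C], a contradiction. *)

Require Import Defs.
From Stdlib Require Import List Classical ClassicalEpsilon FunctionalExtensionality
  PropExtensionality Lia PeanoNat.

(** Limit connectives are collapsed along f^κ_ξ(α), so a formula over V_κ and its restriction to V_α
    have different index sets. The arguments therefore use uncollapsed indices, and the collapse
    enters only where a level has to be computed. Two things stand in the way of a direct use of U.
    First, levels are exact, so U and Φ must be rewritten as Π^1_ξ sentences; from a limit λ to λ+1
    this changes the shape of a formula, because the block of a Π^1_(λ+1) formula is followed by a
    disjunction. Second, the club on which a leaf of ψ is decided correctly depends on the sets
    quantified above it. Each quantified set therefore brings its own club, given by the stages V_β
    among its members. A node of U then implies, or is implied by, its part of ψ unconditionally,
    and the converse holds if the last set brings a small enough club. At β only the unconditional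
    direction is used, since X ∩ V_β cannot be chosen there. Finally, U is restricted to β by the
    canonical functions of κ but ψ by those of α, so the surviving indices have to be matched on a
    club of α. *)

Definition pick (P : V -> Prop) : V := epsilon (inhabits empty) P.

Lemma pick_spec P : (exists x, P x) -> P (pick P).
Proof. apply epsilon_spec. Qed.

Lemma family_choice (A B : Type) (b0 : B) (P : A -> Prop) (Q : A -> B -> Prop) :
  (forall x, P x -> exists y, Q x y) -> exists f, forall x, P x -> Q x (f x).
Proof.
intros H. exists (fun x => epsilon (inhabits b0) (Q x)). intros x Hx.
apply epsilon_spec. auto.
Qed.

(** * Ordinals *)

Lemma mem_irrefl x : ~ x ∈ x.
Proof. induction (mem_wf x) as [x _ IH]. intros H. exact (IH x H H). Qed.

Lemma mem_asym x y : x ∈ y -> ~ y ∈ x.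
Proof.
revert y. induction (mem_wf x) as [x _ IH]. intros y H K. exact (IH y K x K H).
Qed.

Lemma ord_mem a x : ordinal a -> x ∈ a -> ordinal x.
Proof.
intros [T H] Hx. split; [now apply H|]. intros y Hy. apply H. now apply (T x).
Qed.

Lemma ord_trans a x y : ordinal a -> x ∈ a -> y ∈ x -> y ∈ a.
Proof. intros [T _] Hx Hy. now apply (T x). Qed.

Lemma ord_tri a : ordinal a -> forall c, ordinal c -> a ∈ c \/ a = c \/ c ∈ a.
Proof.
induction (mem_wf a) as [a _ IHa]. intros Ha c.
induction (mem_wf c) as [c _ IHc]. intros Hc.
destruct (classic (exists x, x ∈ a /\ ~ x ∈ c)) as [[x [Hx Hn]]|N].
- destruct (IHa x Hx (ord_mem _ _ Ha Hx) c Hc) as [K|[K|K]]; [tauto| |].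
  + subst. auto.
  + right. right. now apply (ord_trans a x).
- destruct (classic (exists y, y ∈ c /\ ~ y ∈ a)) as [[y [Hy Hn]]|N'].
  + destruct (IHc y Hy (ord_mem _ _ Hc Hy)) as [K|[K|K]]; [| |tauto].
    * left. now apply (ord_trans c y).
    * subst. auto.
  + right. left. apply extensionality. intros z. split; intros Hz; apply NNPP; eauto.
Qed.

Lemma ord_sub a c : ordinal a -> ordinal c -> a ⊆ c -> a ∈ c \/ a = c.
Proof.
intros Ha Hc H. destruct (ord_tri a Ha c Hc) as [K|[K|K]]; auto.
destruct (mem_irrefl c). auto.
Qed.

Lemma ord_notin a c : ordinal a -> ordinal c -> ~ a ∈ c -> c ⊆ a.
Proof.
intros Ha Hc H. destruct (ord_tri a Ha c Hc) as [K|[K|K]]; [tauto| |].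
- subst. now intros x.
- intros x Hx. now apply (ord_trans a c).
Qed.

Lemma ord_sub_mem a c d : ordinal a -> ordinal d -> a ⊆ c -> c ∈ d -> a ∈ d.
Proof.
intros Ha Hd H K. destruct (ord_sub a c Ha (ord_mem _ _ Hd K) H) as [L|L].
- now apply (ord_trans d c).
- now subst.
Qed.

Lemma ord_empty : ordinal empty.
Proof. split; intros x Hx; destruct (in_empty x Hx). Qed.

Lemma ord_succ a : ordinal a -> ordinal (succ a).
Proof.
intros Ha. split.
- intros x Hx y Hy. apply in_succ. left. apply in_succ in Hx.
  destruct Hx as [Hx| ->]; [now apply (ord_trans a x) | exact Hy].
- intros x Hx. apply in_succ in Hx. destruct Hx as [Hx| ->]; [|exact (proj1 Ha)].
  now apply (ord_mem a).
Qed.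

Lemma mem_succ a : a ∈ succ a.
Proof. apply in_succ. auto. Qed.

Lemma succ_not_empty a : succ a <> empty.
Proof. intros E. apply (in_empty a). rewrite <- E. apply mem_succ. Qed.

Lemma succ_inj a c : succ a = succ c -> a = c.
Proof.
intros E. assert (H := mem_succ a). assert (K := mem_succ c).
rewrite E in H. rewrite <- E in K. apply in_succ in H, K.
destruct H as [H|H]; [|exact H]. destruct K as [K|K]; [|auto].
destruct (mem_asym _ _ H K).
Qed.

Lemma limit_not_succ a : ~ limit (succ a).
Proof. intros [_ [_ H]]. apply (mem_irrefl (succ a)). apply H, mem_succ. Qed.

Lemma empty_mem a : ordinal a -> a <> empty -> empty ∈ a.
Proof.
intros Ha H. destruct (ord_tri empty ord_empty a Ha) as [K|[K|K]]; auto.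
- congruence.
- destruct (in_empty _ K).
Qed.

Lemma limit_empty a : limit a -> empty ∈ a.
Proof. intros [H [K _]]. now apply empty_mem. Qed.

Lemma succ_sub a x : ordinal a -> x ∈ a -> succ x ⊆ a.
Proof.
intros Ha H y Hy. apply in_succ in Hy. destruct Hy as [Hy| ->]; [|exact H].
now apply (ord_trans a x).
Qed.

Lemma ord_cases a : ordinal a ->
  a = empty \/ (exists j, ordinal j /\ a = succ j) \/ limit a.
Proof.
intros Ha. destruct (classic (a = empty)) as [|N]; auto. right.
destruct (classic (exists x, x ∈ a /\ ~ succ x ∈ a)) as [[x [Hx Hn]]|K].
- left. exists x. assert (Ox := ord_mem _ _ Ha Hx). split; auto.
  destruct (ord_sub (succ x) a (ord_succ _ Ox) Ha (succ_sub a x Ha Hx)); [tauto|auto].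
- right. split; [exact Ha|]. split; [exact N|]. intros x Hx. apply NNPP. eauto.
Qed.

Lemma ord_in_succ a x : ordinal a -> x ∈ a -> ordinal x /\ succ x ∈ succ a.
Proof.
intros Ha Hx. assert (Ox := ord_mem _ _ Ha Hx). split; auto. apply in_succ.
apply ord_sub; auto using ord_succ, succ_sub.
Qed.

Lemma ord_max a c d : ordinal d -> a ∈ d -> c ∈ d ->
  exists e, e ∈ d /\ a ⊆ e /\ c ⊆ e.
Proof.
intros Hd Ha Hc. assert (Oa := ord_mem _ _ Hd Ha). assert (Oc := ord_mem _ _ Hd Hc).
destruct (classic (a ∈ c)) as [K|K].
- exists c. split; auto. split; [exact (proj1 Oc a K) | now intros x].
- exists a. split; auto. split; [now intros x | now apply ord_notin].
Qed.

Lemma ord_bigcup a : (forall x, x ∈ a -> ordinal x) -> ordinal (bigcup a).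
Proof.
intros H. split; intros x Hx; apply in_bigcup in Hx; destruct Hx as [y [Hy Hx]].
- intros z Hz. apply in_bigcup. exists y. split; auto.
  now apply (ord_trans y x); [apply H| |].
- exact (proj1 (ord_mem y x (H y Hy) Hx)).
Qed.

Lemma ord_ind_least (P : V -> Prop) a : ordinal a -> P a ->
  exists c, ordinal c /\ P c /\ forall x, x ∈ c -> ~ P x.
Proof.
induction (mem_wf a) as [a _ IH]. intros Ha Pa.
destruct (classic (exists x, x ∈ a /\ P x)) as [[x [Hx Px]]|N].
- apply (IH x); auto. now apply (ord_mem a).
- exists a. split; auto. split; auto. intros x Hx Px. eauto.
Qed.

(** * The cumulative hierarchy *)

Lemma in_V x α : x ∈ V_ α <-> exists β, β ∈ α /\ x ⊆ V_ β.
Proof.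
rewrite V_eq, in_bigcup. split.
- intros [y [Hy Hx]]. apply in_img in Hy. destruct Hy as [β [Hβ ->]].
  exists β. split; auto. now apply in_power.
- intros [β [Hβ Hx]]. exists (power (V_ β)). split; [|now apply in_power].
  apply in_img. eauto.
Qed.

Lemma V_mono α β : α ⊆ β -> V_ α ⊆ V_ β.
Proof. intros H x Hx. apply in_V in Hx. destruct Hx as [γ [Hγ Hx]]. apply in_V. eauto. Qed.

Lemma V_trans α x y : ordinal α -> x ∈ V_ α -> y ∈ x -> y ∈ V_ α.
Proof.
intros Ha Hx Hy. apply in_V in Hx. destruct Hx as [β [Hβ Hx]].
apply (V_mono β); [exact (proj1 Ha β Hβ)|auto].
Qed.

Lemma V_sub α x : ordinal α -> x ∈ V_ α -> x ⊆ V_ α.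
Proof. intros Ha Hx y Hy. now apply (V_trans α x). Qed.

Lemma V_in α β : β ∈ α -> V_ β ∈ V_ α.
Proof. intros H. apply in_V. exists β. split; auto. now intros x. Qed.

Lemma V_le α β : ordinal α -> β ∈ α -> V_ β ⊆ V_ α.
Proof. intros Ha H. apply V_mono. exact (proj1 Ha β H). Qed.

Lemma ord_in_V α : ordinal α -> forall x, ordinal x -> (x ∈ V_ α <-> x ∈ α).
Proof.
intros Ha x. revert α Ha. induction (mem_wf x) as [x _ IH]. intros α Ha Hx.
split; intros H.
- apply in_V in H. destruct H as [β [Hβ H]].
  apply (ord_sub_mem x β); auto. intros y Hy.
  assert (Ob := ord_mem _ _ Ha Hβ).
  apply (IH y Hy β Ob); eauto using ord_mem.
- apply in_V. exists x. split; auto. intros y Hy. apply IH; eauto using ord_mem.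
Qed.

Lemma V_inj α β : ordinal α -> ordinal β -> V_ α = V_ β -> α = β.
Proof.
intros Ha Hb E. destruct (ord_tri α Ha β Hb) as [H|[H|H]]; auto; exfalso.
- apply (mem_irrefl α). apply (ord_in_V α Ha α Ha). rewrite E. now apply ord_in_V.
- apply (mem_irrefl β). apply (ord_in_V β Hb β Hb). rewrite <- E. now apply ord_in_V.
Qed.

Lemma V_mem_ord α β : ordinal α -> ordinal β -> V_ β ∈ V_ α -> β ∈ α.
Proof.
intros Ha Hb H. destruct (ord_tri β Hb α Ha) as [K|[K|K]]; auto; exfalso.
- subst. exact (mem_irrefl _ H).
- apply (mem_irrefl (V_ β)). now apply (V_le β α Hb K).
Qed.

Lemma V_empty_mem α : ordinal α -> α <> empty -> empty ∈ V_ α.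
Proof. intros Ha H. apply ord_in_V; auto using ord_empty. now apply empty_mem. Qed.

Lemma V_limit δ x : limit δ -> x ∈ V_ δ <-> exists β, β ∈ δ /\ x ∈ V_ β.
Proof.
intros [Hd [_ L]]. rewrite in_V. split; intros [β [Hβ H]].
- exists (succ β). split; auto. apply in_V. exists β. split; auto using mem_succ.
- exists β. split; auto. apply V_sub; auto. now apply (ord_mem δ).
Qed.

Lemma V_sub_mem δ β x : limit δ -> β ∈ δ -> x ⊆ V_ β -> x ∈ V_ δ.
Proof. intros L H K. apply in_V. eauto. Qed.

Lemma in_inter x a c : x ∈ inter a c <-> x ∈ a /\ x ∈ c.
Proof. apply (in_sep x a (fun x => x ∈ c)). Qed.

Lemma inter_sub_r a c : inter a c ⊆ c.
Proof. intros x Hx. now apply in_inter in Hx. Qed.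

Lemma inter_id a c : a ⊆ c -> inter a c = a.
Proof.
intros H. apply extensionality. intros x. rewrite in_inter. split; [tauto|auto].
Qed.

(** * Pairs and finite sequences *)

Definition upair (x y : V) : V := set_of bool (fun i => if i then x else y).
Definition opair (x y : V) : V := upair (upair x x) (upair x y).

Lemma in_upair z x y : z ∈ upair x y <-> z = x \/ z = y.
Proof.
unfold upair. rewrite in_set_of. split.
- intros [[|] ->]; auto.
- intros [->| ->]; [now exists true | now exists false].
Qed.

Lemma upair_eq x y a c : upair x y = upair a c -> (x = a \/ x = c) /\ (y = a \/ y = c)
  /\ (a = x \/ a = y) /\ (c = x \/ c = y).
Proof.
intros E. assert (H : forall z, (z = x \/ z = y) <-> (z = a \/ z = c)).
{ intros z. now rewrite <- !in_upair, E. }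
split; [apply H; auto|]. split; [apply H; auto|]. split; apply H; auto.
Qed.

Lemma opair_inj x y a c : opair x y = opair a c -> x = a /\ y = c.
Proof.
unfold opair. intros E. apply upair_eq in E. destruct E as [E1 [E2 [E3 E4]]].
assert (x = a).
{ destruct E1 as [E|E]; apply upair_eq in E; intuition congruence. }
subst a. split; auto.
destruct E2 as [E|E], E4 as [F|F]; apply upair_eq in E; apply upair_eq in F;
  intuition congruence.
Qed.

Lemma upair_V δ x y : limit δ -> (upair x y ∈ V_ δ <-> x ∈ V_ δ /\ y ∈ V_ δ).
Proof.
intros L. assert (Od := proj1 L). split.
- intros H. split; apply (V_trans δ (upair x y)); auto; apply in_upair; auto.
- intros [Hx Hy]. apply V_limit in Hx, Hy; auto.
  destruct Hx as [a [Ha Hx]], Hy as [c [Hc Hy]].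
  destruct (ord_max a c δ Od Ha Hc) as [e [He [Ka Kc]]].
  apply (V_sub_mem δ e); auto. intros z Hz. apply in_upair in Hz.
  destruct Hz as [->| ->]; [exact (V_mono a e Ka x Hx) | exact (V_mono c e Kc y Hy)].
Qed.

Lemma opair_V δ x y : limit δ -> (opair x y ∈ V_ δ <-> x ∈ V_ δ /\ y ∈ V_ δ).
Proof. intros L. unfold opair. rewrite !upair_V; tauto. Qed.

Fixpoint enc (l : list V) : V :=
  match l with nil => empty | x :: l => opair x (enc l) end.

Lemma opair_not_empty x y : opair x y <> empty.
Proof.
intros E. apply (in_empty (upair x x)). rewrite <- E. apply in_upair. auto.
Qed.

Lemma opair_no_empty x y : ~ empty ∈ opair x y.
Proof.
intros H. apply in_upair in H.
destruct H as [H|H]; apply (in_empty x); rewrite H; apply in_upair; auto.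
Qed.

(** One set can thus hold both pairs and stages without confusion: a pair is nonempty and does not
    contain the empty set, while a nonempty stage does. *)
Lemma opair_not_V x y α : ordinal α -> opair x y <> V_ α.
Proof.
intros Ha E. destruct (classic (α = empty)) as [->|N].
- apply (in_empty (upair x x)). assert (H : upair x x ∈ V_ empty).
  { rewrite <- E. apply in_upair. auto. }
  apply in_V in H. destruct H as [β [Hβ _]]. destruct (in_empty β Hβ).
- apply (opair_no_empty x y). rewrite E. now apply V_empty_mem.
Qed.

Lemma enc_inj l : forall m, enc l = enc m -> l = m.
Proof.
induction l as [|x l IH]; intros [|y m] E; simpl in E; auto.
- symmetry in E. now apply opair_not_empty in E.
- now apply opair_not_empty in E.
- apply opair_inj in E. destruct E as [-> E]. f_equal. auto.
Qed.

Lemma enc_V δ l : limit δ -> (enc l ∈ V_ δ <-> Forall (fun x => x ∈ V_ δ) l).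
Proof.
intros L. induction l as [|x l IH]; simpl.
- split; auto. intros _. apply V_empty_mem; apply L.
- rewrite opair_V, IH, Forall_cons_iff; tauto.
Qed.

(** * Natural numbers *)

Fixpoint num (n : nat) : V := match n with 0 => empty | S n => succ (num n) end.

Definition omega : V := set_of nat num.

Lemma num_limit δ n : limit δ -> num n ∈ δ.
Proof. intros L. induction n; simpl; [now apply limit_empty | now apply L]. Qed.

Lemma num_V δ n : limit δ -> num n ∈ V_ δ.
Proof.
intros L. apply ord_in_V; auto using num_limit; [apply L|].
apply (ord_mem δ); auto using num_limit. apply L.
Qed.

Lemma num_lt m n : m < n -> num m ∈ num n.
Proof. intros H. induction H; simpl; apply in_succ; auto. Qed.

Lemma num_inj m n : num m = num n -> m = n.
Proof.
intros E. destruct (Nat.lt_trichotomy m n) as [H|[H|H]]; auto;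
  apply num_lt in H; rewrite E in H; destruct (mem_irrefl _ H).
Qed.

Lemma in_num x n : x ∈ num n -> exists m, x = num m.
Proof.
induction n; simpl; intros H; [destruct (in_empty _ H)|].
apply in_succ in H. destruct H as [H|H]; eauto.
Qed.

Lemma ord_num n : ordinal (num n).
Proof. induction n; simpl; auto using ord_empty, ord_succ. Qed.

Lemma in_omega x : x ∈ omega <-> exists n, x = num n.
Proof. apply in_set_of. Qed.

Lemma ord_omega : ordinal omega.
Proof.
split; intros x Hx; apply in_omega in Hx; destruct Hx as [n ->].
- intros y Hy. destruct (in_num y n Hy) as [m ->]. apply in_omega. eauto.
- apply ord_num.
Qed.

Lemma omega_sub δ : limit δ -> omega ⊆ δ.
Proof. intros L x Hx. apply in_omega in Hx. destruct Hx as [n ->]. now apply num_limit. Qed.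

(** * Closure points *)

Definition inacc (δ : V) : Prop :=
  limit δ /\ omega ∈ δ /\
  forall x f, x ∈ V_ δ -> maps x δ f -> exists γ, γ ∈ δ /\ maps x γ f.

Definition closed_at (h : V -> V) (γ : V) : Prop :=
  limit γ /\ maps (V_ γ) (V_ γ) h.

(* [P] holds on a club of [δ]: for inaccessible [δ] the closure points of functions
   on [V_ δ] generate the club filter. *)
Definition club (δ : V) (P : V -> Prop) : Prop :=
  exists h, maps (V_ δ) (V_ δ) h /\ forall γ, γ ∈ δ -> closed_at h γ -> P γ.

Lemma closed_at_unbounded δ h x : inacc δ -> maps (V_ δ) (V_ δ) h -> x ∈ V_ δ ->
  exists γ, γ ∈ δ /\ closed_at h γ /\ x ∈ V_ γ.
Proof.
intros [L [Hω Hb]] Hh Hx. assert (Od := proj1 L).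
assert (Hrk : exists rk, forall z, z ∈ V_ δ -> rk z ∈ δ /\ z ∈ V_ (rk z)).
{ apply (family_choice V V empty (fun z => z ∈ V_ δ)
    (fun z r => r ∈ δ /\ z ∈ V_ r)).
  intros z Hz. now apply V_limit. }
destruct Hrk as [rk Hrk].
assert (HN : exists N, forall ρ, ρ ∈ δ ->
  N ρ ∈ δ /\ ρ ∈ N ρ /\ forall z, z ∈ V_ ρ -> h z ∈ V_ (N ρ)).
{ apply (family_choice V V empty (fun ρ => ρ ∈ δ)
    (fun ρ ν => ν ∈ δ /\ ρ ∈ ν /\ forall z, z ∈ V_ ρ -> h z ∈ V_ ν)).
  intros ρ Hρ. destruct (Hb (V_ ρ) (fun z => rk (h z))) as [γ [Hγ K]].
  - now apply V_in.
  - intros z Hz. apply Hrk, Hh. now apply (V_le δ ρ).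
  - destruct (ord_max γ (succ ρ) δ Od Hγ) as [e [He [K1 K2]]]; [now apply L|].
    exists e. split; auto. split; [apply K2, mem_succ|].
    intros z Hz. specialize (K z Hz).
    apply (V_le e (rk (h z))); auto. { now apply (ord_mem δ). }
    apply Hrk, Hh. now apply (V_le δ ρ). }
destruct HN as [N HN].
(* [N ρ] bounds the values of [h] on [V_ ρ], so the supremum of its ω iterates, started at the rank
   of [x], is closed under [h]. *)
set (g := fix g n := match n with 0 => rk x | S n => N (g n) end).
assert (Hg : forall n, g n ∈ δ).
{ intros n. induction n; simpl; [now apply Hrk | now apply HN]. }
set (γ := bigcup (set_of nat g)).
assert (Inγ : forall y, y ∈ γ <-> exists n, y ∈ g n).
{ intros y. unfold γ. rewrite in_bigcup. split.
  - intros [z [Hz Hy]]. rewrite in_set_of in Hz. destruct Hz as [n ->].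
    now exists n.
  - intros [n Hn]. exists (g n). split; auto. apply in_set_of. now exists n. }
assert (Oγ : ordinal γ).
{ apply ord_bigcup. intros z Hz. rewrite in_set_of in Hz. destruct Hz as [n ->].
  now apply (ord_mem δ). }
assert (Gγ : forall n, g n ∈ γ).
{ intros n. apply Inγ. exists (S n). simpl. now apply HN. }
exists γ.
assert (Hγ : γ ∈ δ).
(* The sequence stays bounded because it is a map on the set [omega], which lies in [V_ δ]; [d]
   inverts [num]. *)
{ destruct (family_choice V nat 0 (fun y => y ∈ omega) (fun y n => y = num n)) as [d Hd].
  { intros y Hy. now apply in_omega. }
  destruct (Hb omega (fun y => g (d y))) as [γ0 [Hγ0 K]].
  - apply ord_in_V; auto using ord_omega.
  - intros y _. apply Hg.
  - apply (ord_sub_mem γ γ0); auto. intros y Hy. apply Inγ in Hy. destruct Hy as [n Hn].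
    apply (ord_trans γ0 (g n)); [now apply (ord_mem δ)| |exact Hn].
    assert (Hn' : num n ∈ omega) by (apply in_omega; eauto).
    specialize (K _ Hn'). assert (E := Hd _ Hn'). apply num_inj in E.
    rewrite E. exact K. }
assert (Lγ : limit γ).
{ split; auto. split.
  - intros E. apply (in_empty (g 0)). rewrite <- E. auto.
  - intros y Hy. apply Inγ in Hy. destruct Hy as [n Hn]. apply Inγ. exists (S n). simpl.
    destruct (HN (g n) (Hg n)) as [M1 [M2 _]].
    assert (On := ord_mem _ _ Od (Hg n)).
    apply (ord_sub_mem (succ y) (g n)); auto.
    + apply ord_succ. now apply (ord_mem (g n)).
    + now apply (ord_mem δ).
    + now apply succ_sub. }
split; auto. split.
- split; auto. intros z Hz. apply V_limit in Hz; auto. destruct Hz as [β [Hβ Hz]].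
  apply Inγ in Hβ. destruct Hβ as [n Hn].
  apply (V_le γ (g (S n))); auto. simpl. apply HN; auto.
  apply (V_le (g n) β); auto. now apply (ord_mem δ).
- apply (V_le γ (g 0)); auto. simpl. now apply Hrk.
Qed.

Lemma club_mono δ (P Q : V -> Prop) :
  club δ P -> (forall γ, γ ∈ δ -> limit γ -> P γ -> Q γ) -> club δ Q.
Proof.
intros [h [Hh K]] H. exists h. split; auto. intros γ Hγ C. apply H; auto. apply C.
Qed.

Lemma club_closed δ h : maps (V_ δ) (V_ δ) h -> club δ (closed_at h).
Proof. intros H. exists h. split; auto. Qed.

Lemma club_and δ P Q : limit δ -> club δ P -> club δ Q -> club δ (fun γ => P γ /\ Q γ).
Proof.
intros L [h [Hh KP]] [g [Hg KQ]]. exists (fun x => upair (h x) (g x)). split.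
- intros x Hx. apply upair_V; auto.
- intros γ Hγ [Lγ C]. split; [apply KP | apply KQ]; auto; split; auto;
    intros x Hx; now apply C, upair_V in Hx.
Qed.

Lemma club_const δ x : limit δ -> x ∈ V_ δ -> club δ (fun γ => x ∈ V_ γ).
Proof.
intros L Hx. exists (fun _ => x). split; [now intros ? _|].
intros γ Hγ [Lγ C]. apply (C empty). apply V_empty_mem; apply Lγ.
Qed.

Lemma club_all δ (P : V -> Prop) : (forall γ, γ ∈ δ -> limit γ -> P γ) -> club δ P.
Proof.
intros H. exists (fun x => x). split; [now intros x Hx|]. intros γ Hγ C. apply H; auto.
apply C.
Qed.

Lemma club_imp δ (A : Prop) (P : V -> Prop) : (A -> club δ P) -> club δ (fun γ => A -> P γ).
Proof.
intros H. destruct (classic A) as [a|n].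
- apply (club_mono δ P); auto.
- apply club_all. tauto.
Qed.

(** The diagonal intersection. The functions of the single clubs are merged into one function
    sending the pair of [label i] and [x] to [h i x], which is well defined because labels are
    injective. A limit γ closed under it is closed under [h i] as soon as [V_ γ] contains the label
    of [i]. *)
Lemma club_diag (A : Type) δ (P : A -> Prop) (label : A -> V) (Q : A -> V -> Prop) :
  limit δ ->
  (forall i j, P i -> P j -> label i = label j -> i = j) ->
  (forall i, P i -> club δ (Q i)) ->
  club δ (fun γ => forall i, P i -> label i ∈ V_ γ -> Q i γ).
Proof.
intros L Inj H.
destruct (family_choice A (V -> V) (fun _ => empty) P (fun i h => maps (V_ δ) (V_ δ) h /\
  forall γ, γ ∈ δ -> closed_at h γ -> Q i γ) H) as [h Hh].
set (R := fun z y => forall i x, P i -> z = opair (label i) x -> y = h i x).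
set (g := fun z => if excluded_middle_informative (exists y, y ∈ V_ δ /\ R z y)
  then epsilon (inhabits empty) (fun y => y ∈ V_ δ /\ R z y) else empty).
exists g. split.
- intros z Hz. unfold g. destruct excluded_middle_informative as [e|n].
  + exact (proj1 (epsilon_spec (inhabits empty) _ e)).
  + apply V_empty_mem; apply L.
- intros γ Hγ [Lγ C] i Hi Li. destruct (Hh i Hi) as [_ K]. apply K; auto. split; auto.
  intros x Hx. assert (Hz : opair (label i) x ∈ V_ γ) by (apply opair_V; auto).
  apply C in Hz. revert Hz. unfold g.
  destruct excluded_middle_informative as [e|n].
  + destruct (epsilon_spec (inhabits empty) _ e) as [_ E].
    rewrite (E i x Hi eq_refl). auto.
  + intros _. destruct n. exists (h i x). split.
    * apply Hh; auto. apply (V_le δ γ); auto. apply L.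
    * intros j y Hj E. apply opair_inj in E. destruct E as [E ->].
      now rewrite (Inj i j Hi Hj E).
Qed.

(** In this way any set codes a closed set of ordinals, the limits of the β with [V_ β ∈ X]. The
    condition is vacuous for γ = 0, which has to be excluded separately. *)
Definition limpt (X γ : V) : Prop :=
  forall x, x ∈ V_ γ -> exists β, β ∈ γ /\ V_ β ∈ X /\ x ∈ V_ β.

Lemma club_limpt δ X : limit δ -> limpt X δ -> club δ (limpt X).
Proof.
intros L H.
destruct (family_choice V V empty (fun x => x ∈ V_ δ)
  (fun x y => exists β, y = V_ β /\ β ∈ δ /\ V_ β ∈ X /\ x ∈ V_ β)) as [h Hh].
{ intros x Hx. destruct (H x Hx) as [β K]. exists (V_ β), β. tauto. }
exists h. split.
- intros x Hx. destruct (Hh x Hx) as [β [-> [Hβ _]]]. now apply V_in.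
- intros γ Hγ [Lγ C] x Hx.
  assert (Hx' : x ∈ V_ δ) by (apply (V_le δ γ); auto; apply L).
  destruct (Hh x Hx') as [β [E [Hβ [K1 K2]]]]. exists β. split; auto.
  specialize (C x Hx). rewrite E in C. apply V_mem_ord; auto; [apply Lγ|].
  apply (ord_mem δ); auto. apply L.
Qed.

Lemma closed_at_limpt h X γ : ordinal γ -> γ <> empty ->
  (forall β, ordinal β -> V_ β ∈ X -> closed_at h β) ->
  limpt X γ -> closed_at h γ.
Proof.
intros Oγ N HX Hl. split.
- split; auto. split; auto. intros x Hx. assert (Ox := ord_mem _ _ Oγ Hx).
  destruct (Hl x) as [β [Hβ [K1 K2]]]; [now apply ord_in_V|].
  assert (Oβ := ord_mem _ _ Oγ Hβ). destruct (HX β Oβ K1) as [Lβ _].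
  apply (ord_trans γ β); auto. apply Lβ. now apply ord_in_V.
- intros x Hx. destruct (Hl x Hx) as [β [Hβ [K1 K2]]].
  destruct (HX β (ord_mem _ _ Oγ Hβ) K1) as [Lβ C].
  apply (V_le γ β); auto.
Qed.

(** * Formulas of either polarity: [true] is for [Π] and [false] for [Σ] *)

Definition Qs (b : bool) (ks : list nat) (φ : form) : form :=
  if b then salls ks φ else sexs ks φ.

Definition Big (b : bool) (ξ : V) (φ : V -> form) : form :=
  if b then BigAnd ξ φ else BigOr ξ φ.

Definition isC (b : bool) (κ ξ : V) (φ : form) : Prop :=
  if b then is_Pi κ ξ φ else is_Sigma κ ξ φ.

Lemma isC_zero b κ p : fo_over κ p -> isC b κ empty (FO p).
Proof. destruct b; constructor; auto. Qed.

Lemma isC_succ b κ ξ ks ψ : isC (negb b) κ ξ ψ -> isC b κ (succ ξ) (Qs b ks ψ).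
Proof. destruct b; simpl; intros; constructor; auto. Qed.

Lemma isC_limit b κ ξ φ : limit ξ -> (forall ζ, ζ ∈ ξ -> isC b κ ζ (φ ζ)) ->
  finitely_many (free2 (Big b ξ φ)) -> finitely_many (par2 (Big b ξ φ)) ->
  isC b κ ξ (Big b ξ φ).
Proof. destruct b; simpl; intros; constructor; auto. Qed.

Lemma isC_ind_all κ (P : bool -> V -> form -> Prop) :
  (forall b p, fo_over κ p -> P b empty (FO p)) ->
  (forall b ξ ks ψ, isC (negb b) κ ξ ψ -> P (negb b) ξ ψ -> P b (succ ξ) (Qs b ks ψ)) ->
  (forall b ξ φ, limit ξ -> (forall ζ, ζ ∈ ξ -> isC b κ ζ (φ ζ)) ->
    (forall ζ, ζ ∈ ξ -> P b ζ (φ ζ)) ->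
    finitely_many (free2 (Big b ξ φ)) -> finitely_many (par2 (Big b ξ φ)) ->
    P b ξ (Big b ξ φ)) ->
  forall b ξ φ, isC b κ ξ φ -> P b ξ φ.
Proof.
intros H0 HS HL.
assert (H : (forall ξ φ, is_Pi κ ξ φ -> P true ξ φ) /\
            (forall ξ φ, is_Sigma κ ξ φ -> P false ξ φ)).
{ apply (is_Pi_Sigma_ind κ (fun ξ φ _ => P true ξ φ) (fun ξ φ _ => P false ξ φ)).
  - intros. now apply H0.
  - intros ξ ks ψ D K. now apply (HS true).
  - intros ξ φ L D K F1 F2. now apply (HL true).
  - intros. now apply H0.
  - intros ξ ks ψ D K. now apply (HS false).
  - intros ξ φ L D K F1 F2. now apply (HL false). }
intros [|] ξ φ; apply H.
Qed.

Lemma isC_inv b κ ξ φ : isC b κ ξ φ ->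
  (ξ = empty /\ exists p, φ = FO p /\ fo_over κ p) \/
  (exists ζ ks ψ, ξ = succ ζ /\ φ = Qs b ks ψ /\ isC (negb b) κ ζ ψ) \/
  (limit ξ /\ exists f, φ = Big b ξ f /\ (forall ζ, ζ ∈ ξ -> isC b κ ζ (f ζ)) /\
     finitely_many (free2 φ) /\ finitely_many (par2 φ)).
Proof.
destruct b; intros H; inversion H; subst; eauto 10.
Qed.

Lemma free1_Qs b ks φ n : free1 (Qs b ks φ) n <-> free1 φ n.
Proof. destruct b; induction ks; simpl in *; tauto. Qed.

Lemma free2_Qs b ks φ n : free2 (Qs b ks φ) n <-> ~ In n ks /\ free2 φ n.
Proof.
destruct b; induction ks as [|k ks IH]; simpl in *; try tauto;
  rewrite IH; split; intuition congruence.
Qed.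

Lemma par2_Qs b ks φ A : par2 (Qs b ks φ) A <-> par2 φ A.
Proof. destruct b; induction ks; simpl in *; tauto. Qed.

Lemma free1_Big b ξ f n : free1 (Big b ξ f) n <-> exists ζ, ζ ∈ ξ /\ free1 (f ζ) n.
Proof. destruct b; simpl; tauto. Qed.

Lemma free2_Big b ξ f n : free2 (Big b ξ f) n <-> exists ζ, ζ ∈ ξ /\ free2 (f ζ) n.
Proof. destruct b; simpl; tauto. Qed.

Lemma par2_Big b ξ f A : par2 (Big b ξ f) A <-> exists ζ, ζ ∈ ξ /\ par2 (f ζ) A.
Proof. destruct b; simpl; tauto. Qed.

Lemma finite_sub (A : Type) (P Q : A -> Prop) :
  finitely_many Q -> (forall x, P x -> Q x) -> finitely_many P.
Proof. intros [l Hl] H. exists l. auto. Qed.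

Lemma finite_or (A : Type) (P Q : A -> Prop) :
  finitely_many P -> finitely_many Q -> finitely_many (fun x => P x \/ Q x).
Proof.
intros [l Hl] [m Hm]. exists (l ++ m). intros x [H|H]; apply in_app_iff; auto.
Qed.

Lemma finite_list (A : Type) (l : list A) : finitely_many (fun x => In x l).
Proof. now exists l. Qed.

Lemma finite_img (A B : Type) (P : A -> Prop) (Q : B -> Prop) (f : A -> B) :
  finitely_many P -> (forall y, Q y -> exists x, P x /\ y = f x) -> finitely_many Q.
Proof.
intros [l Hl] H. exists (map f l). intros y Hy. destruct (H y Hy) as [x [Hx ->]].
apply in_map. auto.
Qed.

Lemma finite_fo_free2 p : finitely_many (fo_free2 p).
Proof.
induction p as [s t|s t|s X|p IH|p IHp q IHq|n p IH]; simpl; auto using finite_or;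
  try (exists nil; tauto).
destruct X as [k|a].
- exists (k :: nil). intros m E. left. congruence.
- exists nil. intros m E. discriminate.
Qed.

Lemma finite_fo_par2 p : finitely_many (fo_par2 p).
Proof.
induction p as [s t|s t|s X|p IH|p IHp q IHq|n p IH]; simpl; auto using finite_or;
  try (exists nil; tauto).
destruct X as [k|a].
- exists nil. intros m E. discriminate.
- exists (a :: nil). intros m E. left. congruence.
Qed.

Definition no_vars : nat -> V := fun _ => empty.

(** * Satisfaction relative to a set of indices *)

(* For coherent [δ] and [F] this is satisfaction of the restriction of [φ] to [δ], without
   the collapse of the indices; see [sat_restr]. *)
Fixpoint satF (δ : V) (F : V -> Prop) (φ : form) (s S : nat -> V) : Prop :=
  match φ with
  | FO p => fo_sat δ (fo_cut δ p) s S
  | SAll k ψ => forall X, X ⊆ V_ δ -> satF δ F ψ s (upd S k X)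
  | SEx k ψ => exists X, X ⊆ V_ δ /\ satF δ F ψ s (upd S k X)
  | BigAnd ξ ψ => forall ζ, ζ ∈ ξ -> F ζ -> satF δ F (ψ ζ) s S
  | BigOr ξ ψ => exists ζ, ζ ∈ ξ /\ F ζ /\ satF δ F (ψ ζ) s S
  end.

Lemma upd_eq s n x : upd s n x n = x.
Proof. unfold upd. now destruct Nat.eq_dec. Qed.

Lemma upd_neq s n m x : m <> n -> upd s n x m = s m.
Proof. unfold upd. now destruct Nat.eq_dec. Qed.

(** A block of quantifiers becomes a single quantifier over assignments, and repeated names in the
    block do no harm. *)
Definition reassign (δ : V) (ks : list nat) (S S' : nat -> V) : Prop :=
  forall k, (In k ks -> S' k ⊆ V_ δ) /\ (~ In k ks -> S' k = S k).

Lemma reassign_cons δ k ks S S' :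
  reassign δ (k :: ks) S S' <-> exists X, X ⊆ V_ δ /\ reassign δ ks (upd S k X) S'.
Proof.
split.
- intros H. exists (S' k). split; [apply H; simpl; auto|]. intros m. split.
  + intros Hm. apply H. simpl; auto.
  + intros Hm. destruct (Nat.eq_dec m k) as [->|N].
    * now rewrite upd_eq.
    * rewrite upd_neq by auto. apply H. simpl. intuition congruence.
- intros [X [HX H]] m. destruct (H m) as [H1 H2]. simpl. split.
  + intros Hm. destruct (classic (In m ks)) as [K|K]; auto.
    rewrite H2 by auto. destruct Hm as [->|]; [|tauto]. now rewrite upd_eq.
  + intros Hm. rewrite H2 by tauto. apply upd_neq. intuition congruence.
Qed.

Lemma reassign_nil δ S S' : reassign δ nil S S' <-> S' = S.
Proof.
split.
- intros H. apply functional_extensionality. intros k. apply H. simpl; auto.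
- intros -> k. simpl. tauto.
Qed.

Definition quant {A : Type} (b : bool) (P Q : A -> Prop) : Prop :=
  if b then forall x, P x -> Q x else exists x, P x /\ Q x.

Lemma quant_iff (A : Type) b (P Q R : A -> Prop) : (forall x, P x -> (Q x <-> R x)) ->
  (quant b P Q <-> quant b P R).
Proof.
intros H. destruct b; simpl; split.
- intros K x Hx. apply H; auto.
- intros K x Hx. apply H; auto.
- intros [x [Hx K]]. exists x. split; auto. apply H; auto.
- intros [x [Hx K]]. exists x. split; auto. apply H; auto.
Qed.

Lemma Qs_quant b δ (P : form -> (nat -> V) -> Prop) :
  (forall k ψ S, P (SAll k ψ) S <-> forall X, X ⊆ V_ δ -> P ψ (upd S k X)) ->
  (forall k ψ S, P (SEx k ψ) S <-> exists X, X ⊆ V_ δ /\ P ψ (upd S k X)) ->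
  forall ks ψ S, P (Qs b ks ψ) S <-> quant b (reassign δ ks S) (P ψ).
Proof.
intros HA HE ks ψ. induction ks as [|k ks IH]; intros S.
- destruct b; simpl; split.
  + intros H S' E. apply reassign_nil in E. now subst.
  + intros H. apply H. now apply reassign_nil.
  + intros H. exists S. split; auto. now apply reassign_nil.
  + intros [S' [E H]]. apply reassign_nil in E. now subst.
- destruct b; simpl in *.
  + rewrite HA. split.
    * intros H S' E. apply reassign_cons in E. destruct E as [X [HX E]].
      specialize (H X HX). rewrite IH in H. auto.
    * intros H X HX. apply IH. intros S' E. apply H. apply reassign_cons. eauto.
  + rewrite HE. split.
    * intros [X [HX H]]. apply IH in H. destruct H as [S' [E H]]. exists S'.
      split; auto. apply reassign_cons. eauto.
    * intros [S' [E H]]. apply reassign_cons in E. destruct E as [X [HX E]].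
      exists X. split; auto. apply IH. eauto.
Qed.

Lemma satF_Qs b δ F ks ψ s S :
  satF δ F (Qs b ks ψ) s S <-> quant b (reassign δ ks S) (satF δ F ψ s).
Proof. apply (Qs_quant b δ (fun φ S => satF δ F φ s S)); reflexivity. Qed.

Lemma sat_Qs b δ ks ψ s S :
  sat δ (Qs b ks ψ) s S <-> quant b (reassign δ ks S) (sat δ ψ s).
Proof. apply (Qs_quant b δ (fun φ S => sat δ φ s S)); reflexivity. Qed.

Lemma satF_Big b δ F ξ f s S :
  satF δ F (Big b ξ f) s S <->
  quant b (fun i => i ∈ ξ /\ F i) (fun i => satF δ F (f i) s S).
Proof.
destruct b; simpl; split.
- intros H i [Hi K]. auto.
- intros H i Hi K. auto.
- intros [i [Hi [K H]]]. eauto.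
- intros [i [[Hi K] H]]. eauto.
Qed.

Lemma fo_cut_over κ p : fo_over κ p -> fo_cut κ p = p.
Proof.
induction p as [s t|s t|s X|p IH|p IHp q IHq|n p IH]; simpl; intros H; auto.
- destruct X as [k|a]; simpl; auto. destruct H as [_ H]. now rewrite inter_id.
- now rewrite IH.
- rewrite IHp, IHq; tauto.
- now rewrite IH.
Qed.

Lemma sat_satF κ b ξ φ : isC b κ ξ φ ->
  forall s S, sat κ φ s S <-> satF κ (fun _ => True) φ s S.
Proof.
intros H. pattern b, ξ, φ. revert b ξ φ H. apply isC_ind_all.
- intros _ p H s S. simpl. now rewrite fo_cut_over.
- intros b ξ ks ψ _ IH s S. rewrite sat_Qs, satF_Qs. apply quant_iff. auto.
- intros b ξ φ _ _ IH _ _ s S. destruct b; simpl.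
  + split; intros H i Hi; [intros _|]; apply IH; auto.
  + split; intros [i [Hi H]]; exists i; split; auto.
    * split; auto. apply IH; auto.
    * apply IH; tauto.
Qed.

(** * First-order formulas *)

Definition FOr p q := FNot (FAnd (FNot p) (FNot q)).
Definition FImp p q := FNot (FAnd p (FNot q)).
Definition FIff p q := FAnd (FImp p q) (FImp q p).
Definition FEx n p := FNot (FAll n (FNot p)).

Lemma sat_or δ p q s S : fo_sat δ (FOr p q) s S <-> fo_sat δ p s S \/ fo_sat δ q s S.
Proof. simpl. tauto. Qed.

Lemma sat_imp δ p q s S : fo_sat δ (FImp p q) s S <-> (fo_sat δ p s S -> fo_sat δ q s S).
Proof. simpl. tauto. Qed.

Lemma sat_iff δ p q s S : fo_sat δ (FIff p q) s S <-> (fo_sat δ p s S <-> fo_sat δ q s S).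
Proof. simpl. tauto. Qed.

Lemma sat_and δ p q s S : fo_sat δ (FAnd p q) s S <-> fo_sat δ p s S /\ fo_sat δ q s S.
Proof. reflexivity. Qed.

Lemma sat_not δ p s S : fo_sat δ (FNot p) s S <-> ~ fo_sat δ p s S.
Proof. reflexivity. Qed.

Lemma sat_all δ n p s S :
  fo_sat δ (FAll n p) s S <-> forall x, x ∈ V_ δ -> fo_sat δ p (upd s n x) S.
Proof. reflexivity. Qed.

Lemma sat_ex δ n p s S :
  fo_sat δ (FEx n p) s S <-> exists x, x ∈ V_ δ /\ fo_sat δ p (upd s n x) S.
Proof.
simpl. split.
- intros H. apply NNPP. intros N. apply H. intros x Hx K. apply N. eauto.
- intros [x [Hx H]] N. exact (N x Hx H).
Qed.

(** The formulas below bind names from [n] upwards; this condition on their arguments prevents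
    capture. *)
Definition tlt (n : nat) (t : term) : Prop :=
  match t with var m => m < n | par _ => True end.

Lemma tlt_le n m t : tlt n t -> n <= m -> tlt m t.
Proof. destruct t; simpl; auto; lia. Qed.

Lemma value_upd n m t s x : tlt n t -> n <= m -> value (upd s m x) t = value s t.
Proof. destruct t; simpl; auto. intros. rewrite upd_neq; auto. lia. Qed.

Definition upairF w z x y :=
  FAll w (FIff (FMem (var w) z) (FOr (FEq (var w) x) (FEq (var w) y))).

Lemma sat_upairF δ w z x y s S : ordinal δ ->
  tlt w z -> tlt w x -> tlt w y ->
  value s z ∈ V_ δ -> value s x ∈ V_ δ -> value s y ∈ V_ δ ->
  (fo_sat δ (upairF w z x y) s S <-> value s z = upair (value s x) (value s y)).
Proof.
intros Od Tz Tx Ty Vz Vx Vy. unfold upairF. rewrite sat_all. split.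
- intros H. apply extensionality. intros u. rewrite in_upair. split.
  + intros Hu. assert (Vu : u ∈ V_ δ) by (apply (V_trans δ (value s z)); auto).
    specialize (H u Vu). rewrite sat_iff, sat_or in H. simpl in H.
    rewrite upd_eq, !(value_upd w) in H by auto. tauto.
  + intros Hu. assert (Vu : u ∈ V_ δ) by (destruct Hu; subst; auto).
    specialize (H u Vu). rewrite sat_iff, sat_or in H. simpl in H.
    rewrite upd_eq, !(value_upd w) in H by auto. tauto.
- intros E u Vu. rewrite sat_iff, sat_or. simpl.
  rewrite upd_eq, !(value_upd w), E, in_upair by auto. tauto.
Qed.

Definition pairF n z x y :=
  FEx n (FEx (S n) (FAnd (upairF (S (S n)) (var n) x x)
    (FAnd (upairF (S (S n)) (var (S n)) x y) (upairF (S (S n)) z (var n) (var (S n)))))).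

Lemma sat_pairF δ n z x y s S : ordinal δ ->
  tlt n z -> tlt n x -> tlt n y ->
  value s z ∈ V_ δ -> value s x ∈ V_ δ -> value s y ∈ V_ δ ->
  (fo_sat δ (pairF n z x y) s S <-> value s z = opair (value s x) (value s y)).
Proof.
intros Od Tz Tx Ty Vz Vx Vy.
assert (Key : forall u w, u ∈ V_ δ -> w ∈ V_ δ ->
  (fo_sat δ (FAnd (upairF (Datatypes.S (Datatypes.S n)) (var n) x x)
    (FAnd (upairF (Datatypes.S (Datatypes.S n)) (var (Datatypes.S n)) x y)
      (upairF (Datatypes.S (Datatypes.S n)) z (var n) (var (Datatypes.S n)))))
    (upd (upd s n u) (Datatypes.S n) w) S <->
   u = upair (value s x) (value s x) /\ w = upair (value s x) (value s y) /\
   value s z = upair u w)).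
{ intros u w Vu Vw. rewrite !sat_and.
  assert (Ev : forall t, tlt n t ->
    value (upd (upd s n u) (Datatypes.S n) w) t = value s t).
  { intros t Ht. rewrite (value_upd n), (value_upd n); auto. }
  rewrite !sat_upairF; simpl; auto; rewrite ?Ev, ?upd_eq, ?(upd_neq _ (Datatypes.S n) n),
    ?upd_eq by (auto; lia); auto;
    try (eapply tlt_le; eauto; lia); try tauto; try lia. }
unfold pairF. rewrite sat_ex. split.
- intros [u [Vu H]]. apply sat_ex in H. destruct H as [w [Vw H]].
  apply Key in H; auto. destruct H as [-> [-> ->]]. reflexivity.
- intros E. assert (Hu : upair (value s x) (value s x) ∈ V_ δ).
  { apply (V_trans δ (value s z)); auto. rewrite E. apply in_upair. auto. }
  assert (Hw : upair (value s x) (value s y) ∈ V_ δ).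
  { apply (V_trans δ (value s z)); auto. rewrite E. apply in_upair. auto. }
  exists (upair (value s x) (value s x)). split; auto. apply sat_ex.
  exists (upair (value s x) (value s y)). split; auto. apply Key; auto.
Qed.

Definition interF n y X v :=
  FAll n (FIff (FMem (var n) y) (FAnd (FMem (var n) v) (FIn (var n) X))).

Lemma sat_interF δ n y X v s S : ordinal δ -> tlt n y -> tlt n v ->
  value s y ∈ V_ δ -> value s v ∈ V_ δ ->
  (fo_sat δ (interF n y X v) s S <-> value s y = inter (value S X) (value s v)).
Proof.
intros Od Ty Tv Vy Vv. unfold interF. rewrite sat_all. split.
- intros H. apply extensionality. intros u. rewrite in_inter. split.
  + intros Hu. assert (Vu : u ∈ V_ δ) by (apply (V_trans δ (value s y)); auto).
    specialize (H u Vu). rewrite sat_iff, sat_and in H. simpl in H.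
    rewrite upd_eq, !(value_upd n) in H by auto. tauto.
  + intros Hu. assert (Vu : u ∈ V_ δ) by (apply (V_trans δ (value s v)); tauto).
    specialize (H u Vu). rewrite sat_iff, sat_and in H. simpl in H.
    rewrite upd_eq, !(value_upd n) in H by auto. tauto.
- intros E u Vu. rewrite sat_iff, sat_and. simpl.
  rewrite upd_eq, !(value_upd n), E, in_inter by auto. tauto.
Qed.

(* [var 0] is the stage to which the members of [Xs] are cut down. *)
Fixpoint encF (n : nat) (t : term) (Xs : list term) : fo :=
  match Xs with
  | nil => FEq t (par empty)
  | X :: Xs =>
      FEx n (FEx (S n) (FAnd (interF (S (S n)) (var n) X (var 0))
        (FAnd (pairF (S (S n)) t (var n) (var (S n))) (encF (S n + 1) (var (S n)) Xs))))
  end.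

Lemma sat_encF δ S Xs : ordinal δ -> forall n t s, 1 <= n -> tlt n t ->
  value s t ∈ V_ δ -> s 0 ∈ V_ δ ->
  (fo_sat δ (encF n t Xs) s S <->
   value s t = enc (map (fun X => inter (value S X) (s 0)) Xs)).
Proof.
intros Od. induction Xs as [|X Xs IH]; intros n t s Hn Ht Vt V0; [simpl; reflexivity|].
assert (Key : forall y t', y ∈ V_ δ -> t' ∈ V_ δ ->
  (fo_sat δ (FAnd (interF (Datatypes.S (Datatypes.S n)) (var n) X (var 0))
        (FAnd (pairF (Datatypes.S (Datatypes.S n)) t (var n) (var (Datatypes.S n)))
          (encF (Datatypes.S n + 1) (var (Datatypes.S n)) Xs)))
    (upd (upd s n y) (Datatypes.S n) t') S <->
   y = inter (value S X) (s 0) /\ value s t = opair y t' /\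
   t' = enc (map (fun X => inter (value S X) (s 0)) Xs))).
{ intros y t' Vy Vt'. rewrite !sat_and.
  assert (Et : value (upd (upd s n y) (Datatypes.S n) t') t = value s t).
  { rewrite (value_upd n), (value_upd n); auto. }
  assert (E0 : upd (upd s n y) (Datatypes.S n) t' 0 = s 0).
  { rewrite !upd_neq by lia. reflexivity. }
  assert (En : upd (upd s n y) (Datatypes.S n) t' n = y).
  { rewrite upd_neq by lia. apply upd_eq. }
  assert (En' : upd (upd s n y) (Datatypes.S n) t' (Datatypes.S n) = t') by apply upd_eq.
  rewrite sat_interF, sat_pairF, IH; simpl; rewrite ?Et, ?E0, ?En, ?En'; auto;
    try reflexivity; try lia; try (eapply tlt_le; eauto; lia). }
cbn [encF map enc]. rewrite sat_ex. split.
- intros [y [Vy H]]. apply sat_ex in H. destruct H as [t' [Vt' H]].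
  apply Key in H; auto. destruct H as [<- [-> <-]]. reflexivity.
- intros E. set (y := inter (value S X) (s 0)) in *.
  set (t' := enc _) in E.
  assert (Hy : upair y t' ∈ V_ δ).
  { apply (V_trans δ (value s t)); auto. rewrite E. apply in_upair. auto. }
  assert (Vy : y ∈ V_ δ).
  { apply (V_trans δ (upair y t')); auto. apply in_upair. auto. }
  assert (Vt' : t' ∈ V_ δ).
  { apply (V_trans δ (upair y t')); auto. apply in_upair. auto. }
  exists y. split; auto. apply sat_ex. exists t'. split; auto. apply Key; auto.
Qed.

Lemma fo_cut_encF δ Xs : forall n t,
  fo_cut δ (encF n t Xs) = encF n t (map (cut_term δ) Xs).
Proof.
induction Xs as [|X Xs IH]; intros n t; [reflexivity|].
simpl. unfold FEx. repeat f_equal. apply IH.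
Qed.

(** [var 0] stands for a stage V_γ, and the formula puts the sequence c, V_γ, X ∩ V_γ, ... ([X] in
    [Xs]) into [T]. The bound variables 1, 2, 3 are this sequence and its tails; the tails lie in
    every transitive level that contains the sequence. *)
Definition tupF (c : V) (T : term) (Xs : list term) : fo :=
  FEx 1 (FEx 2 (FEx 3 (FAnd (FIn (var 1) T)
    (FAnd (pairF 4 (var 1) (par c) (var 2))
      (FAnd (pairF 4 (var 2) (var 0) (var 3)) (encF 4 (var 3) Xs)))))).

Lemma sat_tupF δ c T Xs s S : ordinal δ -> s 0 ∈ V_ δ -> c ∈ V_ δ ->
  (fo_sat δ (tupF c T Xs) s S <->
   let t := enc (c :: s 0 :: map (fun X => inter (value S X) (s 0)) Xs) in
   t ∈ value S T /\ t ∈ V_ δ).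
Proof.
intros Od V0 Vc. cbv zeta.
assert (Key : forall x y z, x ∈ V_ δ -> y ∈ V_ δ -> z ∈ V_ δ ->
  (fo_sat δ (FAnd (FIn (var 1) T)
    (FAnd (pairF 4 (var 1) (par c) (var 2))
      (FAnd (pairF 4 (var 2) (var 0) (var 3)) (encF 4 (var 3) Xs))))
    (upd (upd (upd s 1 x) 2 y) 3 z) S <->
   x ∈ value S T /\ x = opair c y /\ y = opair (s 0) z /\
   z = enc (map (fun X => inter (value S X) (s 0)) Xs))).
{ intros x y z Vx Vy Vz. rewrite !sat_and.
  rewrite !sat_pairF, sat_encF; simpl; unfold upd; simpl; auto; try reflexivity; lia. }
unfold tupF. rewrite sat_ex. split.
- intros [x [Vx H]]. apply sat_ex in H. destruct H as [y [Vy H]].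
  apply sat_ex in H. destruct H as [z [Vz H]]. apply Key in H; auto.
  destruct H as [H [-> [-> ->]]]. cbn [enc]. auto.
- cbn [enc]. intros [H K]. set (z := enc _) in *.
  assert (V2 : forall u w, opair u w ∈ V_ δ -> w ∈ V_ δ).
  { intros u w Hw. apply (V_trans δ (upair u w)); auto; [|apply in_upair; auto].
    apply (V_trans δ (opair u w)); auto. apply in_upair. auto. }
  assert (Vy := V2 _ _ K). assert (Vz := V2 _ _ Vy).
  exists (opair c (opair (s 0) z)). split; auto. apply sat_ex.
  exists (opair (s 0) z). split; auto. apply sat_ex. exists z. split; auto.
  apply Key; auto.
Qed.

Lemma fo_cut_tupF δ c T Xs :
  fo_cut δ (tupF c T Xs) = tupF c (cut_term δ T) (map (cut_term δ) Xs).
Proof. unfold tupF, FEx. cbn [fo_cut]. repeat f_equal. apply fo_cut_encF. Qed.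

Lemma fo_over_encF κ Xs : empty ∈ V_ κ -> Forall (par2_over κ) Xs ->
  forall n t, par1_over κ t -> fo_over κ (encF n t Xs).
Proof.
intros V0 H. induction H as [|X Xs HX H IH]; intros n t Ht; simpl; auto 20.
repeat split; auto. apply IH. simpl. auto.
Qed.

Lemma fo_over_tupF κ c T Xs : empty ∈ V_ κ -> c ∈ V_ κ -> par2_over κ T ->
  Forall (par2_over κ) Xs -> fo_over κ (tupF c T Xs).
Proof.
intros V0 Vc HT H. simpl. repeat split; auto. apply fo_over_encF; simpl; auto.
Qed.

Lemma free1_encF m Xs : forall n t, fo_free1 (encF n t Xs) m -> t = var m \/ m = 0.
Proof.
induction Xs as [|X Xs IH]; intros n t H; simpl in H.
- destruct H as [H|H]; [auto|discriminate].
- destruct H as [Hn [Hm H]]. destruct H as [H|[H|H]];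
    try (apply IH in H); intuition congruence.
Qed.

Lemma free1_tupF c T Xs m : fo_free1 (tupF c T Xs) m -> m = 0.
Proof.
simpl. intros [N1 [N2 [N3 H]]]. destruct H as [H|[H|[H|H]]];
  try (apply free1_encF in H); intuition congruence.
Qed.

Lemma free2_encF m Xs : forall n t, fo_free2 (encF n t Xs) m -> In (var m) Xs.
Proof.
induction Xs as [|X Xs IH]; intros n t H; simpl in H; [tauto|].
destruct H as [H|[H|H]].
- simpl. tauto.
- tauto.
- simpl. right. eapply IH; eauto.
Qed.

Lemma par2_encF A Xs : forall n t, fo_par2 (encF n t Xs) A -> In (par A) Xs.
Proof.
induction Xs as [|X Xs IH]; intros n t H; simpl in H; [tauto|].
destruct H as [H|[H|H]].
- simpl. tauto.
- tauto.
- simpl. right. eapply IH; eauto.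
Qed.

Lemma free2_tupF c T Xs m : fo_free2 (tupF c T Xs) m -> T = var m \/ In (var m) Xs.
Proof.
simpl. intros [H|[H|[H|H]]]; auto; try tauto. apply free2_encF in H. auto.
Qed.

Lemma par2_tupF c T Xs A : fo_par2 (tupF c T Xs) A -> T = par A \/ In (par A) Xs.
Proof.
simpl. intros [H|[H|[H|H]]]; auto; try tauto. apply par2_encF in H. auto.
Qed.

(** * Formula trees of a given level *)

(* The name [1] is left to the quantifier added in [raise_limit]. *)
Definition nm (d : nat) : nat := match d with 0 => 0 | S _ => S d end.

Lemma nm_inj d e : nm d = nm e -> d = e.
Proof. destruct d, e; simpl; congruence. Qed.

Definition TT : fo := FAll 0 (FEq (var 0) (var 0)).

(* [d] counts the variables quantified so far, and [c] lists the labels [ι i] of the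
   members [i] chosen at the infinitary connectives; the leaf [L b d c] depends on the
   history of the node only through them. *)
Definition G (L : bool -> nat -> list V -> fo) (ι : V -> V) :
  V -> bool -> nat -> list V -> form :=
  Fix mem_wf (fun _ => bool -> nat -> list V -> form)
    (fun k rec =>
      let rec' i := match excluded_middle_informative (i ∈ k) with
                    | left h => rec i h
                    | right _ => fun _ _ _ => FO TT
                    end in
      fun b d c =>
        if excluded_middle_informative (k = empty) then FO (L b d c)
        else if excluded_middle_informative (exists j, k = succ j) then
          Qs b (nm d :: nil) (rec' (pick (fun j => k = succ j)) (negb b) (S d) c)
        else Big b k (fun i => rec' i b d (ι i :: c))).

Lemma G_unfold L ι k b d c :
  G L ι k b d c =
    if excluded_middle_informative (k = empty) then FO (L b d c)
    else if excluded_middle_informative (exists j, k = succ j) then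
      Qs b (nm d :: nil) (G L ι (pick (fun j => k = succ j)) (negb b) (S d) c)
    else Big b k (fun i => if excluded_middle_informative (i ∈ k)
      then G L ι i b d (ι i :: c) else FO TT).
Proof.
unfold G at 1. rewrite Fix_eq.
- fold (G L ι). destruct (excluded_middle_informative (k = empty)); auto.
  destruct (excluded_middle_informative (exists j, k = succ j)) as [e|ns].
  + assert (E := pick_spec _ e).
    destruct (excluded_middle_informative (pick (fun j => k = succ j) ∈ k)) as [h|h]; auto.
    destruct h. pattern k at 2. rewrite E. apply mem_succ.
  + f_equal. apply functional_extensionality. intros i.
    now destruct (excluded_middle_informative (i ∈ k)).
- intros x f g H. assert (f = g) as ->; auto.
  apply functional_extensionality_dep. intros i.
  apply functional_extensionality_dep. apply H.
Qed.

Lemma G_empty L ι b d c : G L ι empty b d c = FO (L b d c).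
Proof. rewrite G_unfold. destruct excluded_middle_informative; tauto. Qed.

Lemma G_succ L ι k b d c :
  G L ι (succ k) b d c = Qs b (nm d :: nil) (G L ι k (negb b) (S d) c).
Proof.
rewrite G_unfold. destruct excluded_middle_informative as [e|_].
{ destruct (succ_not_empty _ e). }
destruct excluded_middle_informative as [e|n].
- apply pick_spec in e. apply succ_inj in e. now rewrite <- e.
- destruct n. eauto.
Qed.

Lemma G_limit L ι k b d c : limit k ->
  exists f, G L ι k b d c = Big b k f /\
    forall i, i ∈ k -> f i = G L ι i b d (ι i :: c).
Proof.
intros Lk. rewrite G_unfold. destruct excluded_middle_informative as [e|_].
{ destruct Lk as [_ [N _]]. tauto. }
destruct excluded_middle_informative as [[j ->]|n].
- destruct (limit_not_succ _ Lk).
- eexists. split; [reflexivity|]. intros i Hi. simpl.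
  now destruct excluded_middle_informative.
Qed.

Lemma ord_rect (P : V -> Prop) :
  P empty -> (forall k, ordinal k -> P k -> P (succ k)) ->
  (forall k, limit k -> (forall i, i ∈ k -> P i) -> P k) ->
  forall k, ordinal k -> P k.
Proof.
intros H0 HS HL k. induction (mem_wf k) as [k _ IH]. intros Ok.
destruct (ord_cases k Ok) as [->|[[j [Oj ->]]|L]]; auto.
- apply HS; auto. apply IH; auto using mem_succ.
- apply HL; auto. intros i Hi. apply IH; eauto using ord_mem.
Qed.

(** Limit levels admit only finitely many free second-order variables and parameters, although the
    tree branches infinitely. [N d] collects the names available to a leaf at depth [d]; by [NS] one
    more quantifier adds only the name that it binds, so the free names of a subtree at depth [d]
    stay in [N d]. *)
Section Shape.
Context (κ : V) (L : bool -> nat -> list V -> fo) (ι : V -> V).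
Context (W : V -> Prop) (N : nat -> nat -> Prop) (A : V -> Prop).
Hypothesis Lover : forall b d c, Forall W c -> fo_over κ (L b d c).
Hypothesis Lfree1 : forall b d c n, ~ fo_free1 (L b d c) n.
Hypothesis Lfree2 : forall b d c n, fo_free2 (L b d c) n -> N d n.
Hypothesis Lpar2 : forall b d c B, fo_par2 (L b d c) B -> A B.
Hypothesis NS : forall d n, N (S d) n -> n = nm d \/ N d n.
Hypothesis Nfin : forall d, finitely_many (N d).
Hypothesis Afin : finitely_many A.

Lemma free1_G k : ordinal k -> forall b d c n, ~ free1 (G L ι k b d c) n.
Proof.
intros Ok. pattern k. apply ord_rect; auto; clear k Ok.
- intros. rewrite G_empty. simpl. apply Lfree1.
- intros k Ok IH b d c n. rewrite G_succ, free1_Qs. apply IH.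
- intros k Lk IH b d c n. destruct (G_limit L ι k b d c Lk) as [f [-> Hf]].
  rewrite free1_Big. intros [i [Hi H]]. rewrite Hf in H by auto. exact (IH i Hi _ _ _ _ H).
Qed.

Lemma free2_G k : ordinal k -> forall b d c n, free2 (G L ι k b d c) n -> N d n.
Proof.
intros Ok. pattern k. apply ord_rect; auto; clear k Ok.
- intros b d c n. rewrite G_empty. simpl. apply Lfree2.
- intros k Ok IH b d c n. rewrite G_succ, free2_Qs. intros [H1 H2].
  apply IH, NS in H2. simpl in H1. intuition congruence.
- intros k Lk IH b d c n. destruct (G_limit L ι k b d c Lk) as [f [-> Hf]].
  rewrite free2_Big. intros [i [Hi H]]. rewrite Hf in H by auto. eauto.
Qed.

Lemma par2_G k : ordinal k -> forall b d c B, par2 (G L ι k b d c) B -> A B.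
Proof.
intros Ok. pattern k. apply ord_rect; auto; clear k Ok.
- intros b d c B. rewrite G_empty. simpl. apply Lpar2.
- intros k Ok IH b d c B. rewrite G_succ, par2_Qs. apply IH.
- intros k Lk IH b d c B. destruct (G_limit L ι k b d c Lk) as [f [-> Hf]].
  rewrite par2_Big. intros [i [Hi H]]. rewrite Hf in H by auto. eauto.
Qed.

Lemma isC_G k : ordinal k -> (forall i, i ∈ k -> W (ι i)) ->
  forall b d c, Forall W c -> isC b κ k (G L ι k b d c).
Proof.
intros Ok. pattern k. apply ord_rect; auto; clear k Ok.
- intros _ b d c Hc. rewrite G_empty. apply isC_zero. auto.
- intros k Ok IH Hι b d c Hc. rewrite G_succ. apply isC_succ. apply IH; auto.
  intros i Hi. apply Hι, in_succ. auto.
- intros k Lk IH Hι b d c Hc.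
  assert (F2 := free2_G k (proj1 Lk) b d c). assert (P2 := par2_G k (proj1 Lk) b d c).
  destruct (G_limit L ι k b d c Lk) as [f [E Hf]]. rewrite E in *.
  apply isC_limit; auto.
  + intros i Hi. rewrite Hf by auto. apply IH; auto.
    intros j Hj. apply Hι. apply (ord_trans k i); auto. apply Lk.
  + exact (finite_sub _ _ _ (Nfin d) F2).
  + exact (finite_sub _ _ _ Afin P2).
Qed.

End Shape.

Section Leaves.
Context (δ : V) (F : V -> Prop) (s : nat -> V) (ι : V -> V).

Lemma satF_G_rel L M (R : nat -> (nat -> V) -> (nat -> V) -> Prop) :
  (forall b d c S S', R d S S' ->
    (fo_sat δ (fo_cut δ (L b d c)) s S <-> fo_sat δ (fo_cut δ (M b d c)) s S')) ->
  (forall d S S' X, X ⊆ V_ δ -> R d S S' ->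
    R (Datatypes.S d) (upd S (nm d) X) (upd S' (nm d) X)) ->
  forall k, ordinal k -> forall b d c S S', R d S S' ->
    (satF δ F (G L ι k b d c) s S <-> satF δ F (G M ι k b d c) s S').
Proof.
intros HL HR k Ok. pattern k. apply ord_rect; auto; clear k Ok.
- intros b d c S S' H. rewrite !G_empty. simpl. auto.
- intros k Ok IH b d c S S' H. rewrite !G_succ. destruct b; simpl.
  + split; intros K X HX; eapply IH; eauto.
  + split; intros [X [HX K]]; exists X; split; auto; eapply IH; eauto.
- intros k Lk IH b d c S S' H.
  destruct (G_limit L ι k b d c Lk) as [f [-> Hf]].
  destruct (G_limit M ι k b d c Lk) as [g [-> Hg]].
  rewrite !satF_Big. destruct b; simpl.
  + split; intros K i [Hi Fi]; specialize (K i (conj Hi Fi)); revert K;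
      rewrite Hf, Hg by auto; apply IH; auto.
  + split; intros [i [[Hi Fi] K]]; exists i; split; auto; revert K;
      rewrite Hf, Hg by auto; apply IH; auto.
Qed.

Hypothesis F0 : F empty.

(** Negation swaps the polarity of every node and moves to the leaves. [Q] ignores the sets
    quantified at depth at least 1, so it passes through the whole tree. Drawing it through an
    existential block or a disjunction needs some witness: the empty set, or the index 0, which
    survives by [F0]. *)
Lemma satF_G_neg L M (Q : (nat -> V) -> Prop) :
  (forall d S X, 1 <= d -> (Q (upd S (nm d) X) <-> Q S)) ->
  (forall b d c S, fo_sat δ (fo_cut δ (L b d c)) s S <->
    (Q S \/ ~ fo_sat δ (fo_cut δ (M (negb b) d c)) s S)) ->
  forall k, ordinal k -> forall b d c S, 1 <= d ->
    (satF δ F (G L ι k b d c) s S <-> (Q S \/ ~ satF δ F (G M ι k (negb b) d c) s S)).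
Proof.
intros HQ HL k Ok. pattern k. apply ord_rect; auto; clear k Ok.
- intros b d c S _. rewrite !G_empty. simpl. auto.
- intros k Ok IH b d c S Hd. rewrite !G_succ. destruct b; simpl.
  + split.
    * intros K. destruct (classic (Q S)) as [|NQ]; auto. right. intros [X [HX K']].
      specialize (K X HX). apply IH in K; [|lia]. rewrite HQ in K by auto. simpl in K. tauto.
    * intros K X HX. apply IH; [lia|]. rewrite HQ by auto. destruct K as [K|K]; auto.
      right. intros K'. apply K. eauto.
  + split.
    * intros [X [HX K]]. apply IH in K; [|lia]. rewrite HQ in K by auto.
      destruct K as [K|K]; auto.
    * intros K. destruct (classic (Q S)) as [HQS|NQ].
      { exists empty. split; [intros x Hx; destruct (in_empty x Hx)|].
        apply IH; [lia|]. rewrite HQ by auto. auto. }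
      destruct K as [|K]; [tauto|]. apply NNPP. intros K'. apply K. intros X HX.
      apply NNPP. intros K''. apply K'. exists X. split; auto. apply IH; [lia|]. auto.
- intros k Lk IH b d c S Hd.
  destruct (G_limit L ι k b d c Lk) as [f [-> Hf]].
  destruct (G_limit M ι k (negb b) d c Lk) as [g [-> Hg]].
  rewrite !satF_Big. destruct b; simpl.
  + split.
    * intros K. destruct (classic (Q S)) as [|NQ]; auto. right. intros [i [[Hi Fi] K']].
      specialize (K i (conj Hi Fi)). rewrite Hf in K by auto. rewrite Hg in K' by auto.
      apply IH in K; auto. tauto.
    * intros K i [Hi Fi]. rewrite Hf by auto. apply IH; auto. destruct K as [K|K]; auto.
      right. intros K'. apply K. exists i. split; auto. now rewrite Hg.
  + split.
    * intros [i [[Hi Fi] K]]. rewrite Hf in K by auto. apply IH in K; auto.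
      destruct K as [K|K]; auto. right. intros K'. apply K.
      specialize (K' i (conj Hi Fi)). now rewrite Hg in K'.
    * intros K. destruct (classic (Q S)) as [HQS|NQ].
      { exists empty. assert (H0 := limit_empty k Lk). split; auto.
        rewrite Hf by auto. apply IH; auto. }
      destruct K as [|K]; [tauto|]. apply NNPP. intros K'. apply K. intros i [Hi Fi].
      rewrite Hg by auto. apply NNPP. intros K''. apply K'. exists i. split; auto.
      rewrite Hf by auto. apply IH; auto.
Qed.

(** Constant leaves give true and false formulas of every level and polarity, used to fill up
    connectives. *)
Lemma satF_G_const q (Q : Prop) :
  (forall S, fo_sat δ (fo_cut δ q) s S <-> Q) ->
  forall k, ordinal k -> forall b d c S, satF δ F (G (fun _ _ _ => q) ι k b d c) s S <-> Q.
Proof.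
intros HQ k Ok. pattern k. apply ord_rect; auto; clear k Ok.
- intros b d c S. rewrite !G_empty. simpl. auto.
- intros k Ok IH b d c S. rewrite !G_succ.
  assert (H0 : empty ⊆ V_ δ) by (intros x Hx; destruct (in_empty x Hx)).
  destruct b; simpl; split.
  + intros K. specialize (K empty H0). now rewrite IH in K.
  + intros K X HX. now apply IH.
  + intros [X [HX K]]. now rewrite IH in K.
  + intros K. exists empty. split; auto. now apply IH.
- intros k Lk IH b d c S.
  destruct (G_limit (fun _ _ _ => q) ι k b d c Lk) as [f [-> Hf]].
  assert (H0 := limit_empty k Lk).
  rewrite !satF_Big. destruct b; simpl; split.
  + intros K. specialize (K empty (conj H0 F0)). rewrite Hf, IH in K; auto.
  + intros K i [Hi Fi]. rewrite Hf by auto. now apply IH.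
  + intros [i [[Hi Fi] K]]. rewrite Hf, IH in K; auto.
  + intros K. exists empty. split; auto. rewrite Hf by auto. now apply IH.
Qed.

End Leaves.

(** * Adding a first-order conjunct to a sentence *)

(** Putting the conjunct at every leaf leaves the blocks, the connectives and hence the level
    unchanged. *)
Fixpoint andq (q : fo) (φ : form) : form :=
  match φ with
  | FO p => FO (FAnd q p)
  | SAll k ψ => SAll k (andq q ψ)
  | SEx k ψ => SEx k (andq q ψ)
  | BigAnd ξ ψ => BigAnd ξ (fun ζ => andq q (ψ ζ))
  | BigOr ξ ψ => BigOr ξ (fun ζ => andq q (ψ ζ))
  end.

Lemma andq_Qs b q ks φ : andq q (Qs b ks φ) = Qs b ks (andq q φ).
Proof. destruct b; induction ks; simpl in *; congruence. Qed.

Lemma andq_Qs_inv b q ks : forall ψ φ, Qs b ks ψ = andq q φ ->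
  exists φ', φ = Qs b ks φ' /\ ψ = andq q φ'.
Proof.
induction ks as [|k ks IH]; intros ψ φ E.
- destruct b; simpl in *; eauto.
- destruct b, φ; simpl in E; try discriminate; injection E as -> E;
    destruct (IH _ _ E) as [φ' [-> ->]]; exists φ'; auto.
Qed.

Lemma free1_andq q φ n : free1 (andq q φ) n -> fo_free1 q n \/ free1 φ n.
Proof.
induction φ as [p|k φ IH|k φ IH|ξ φ IH|ξ φ IH]; simpl; auto.
- intros [ζ [Hζ H]]. destruct (IH _ H); eauto.
- intros [ζ [Hζ H]]. destruct (IH _ H); eauto.
Qed.

Lemma free2_andq q φ n : free2 (andq q φ) n -> fo_free2 q n \/ free2 φ n.
Proof.
induction φ as [p|k φ IH|k φ IH|ξ φ IH|ξ φ IH]; simpl; auto; try tauto.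
- intros [ζ [Hζ H]]. destruct (IH _ H); eauto.
- intros [ζ [Hζ H]]. destruct (IH _ H); eauto.
Qed.

Lemma par2_andq q φ A : par2 (andq q φ) A -> fo_par2 q A \/ par2 φ A.
Proof.
induction φ as [p|k φ IH|k φ IH|ξ φ IH|ξ φ IH]; simpl; auto.
- intros [ζ [Hζ H]]. destruct (IH _ H); eauto.
- intros [ζ [Hζ H]]. destruct (IH _ H); eauto.
Qed.

Lemma free2_andq_r q φ n : free2 φ n -> free2 (andq q φ) n.
Proof.
induction φ as [p|k φ IH|k φ IH|ξ φ IH|ξ φ IH]; simpl; auto; try tauto.
- intros [ζ [Hζ H]]. eauto.
- intros [ζ [Hζ H]]. eauto.
Qed.

Lemma par2_andq_r q φ A : par2 φ A -> par2 (andq q φ) A.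
Proof.
induction φ as [p|k φ IH|k φ IH|ξ φ IH|ξ φ IH]; simpl; auto.
- intros [ζ [Hζ H]]. eauto.
- intros [ζ [Hζ H]]. eauto.
Qed.

Lemma isC_andq κ q : fo_over κ q -> forall b ξ φ, isC b κ ξ φ -> isC b κ ξ (andq q φ).
Proof.
intros Hq. apply isC_ind_all.
- intros b p Hp. apply isC_zero. simpl. auto.
- intros b ξ ks ψ _ IH. rewrite andq_Qs. now apply isC_succ.
- intros b ξ φ L _ IH F2 P2.
  assert (E : andq q (Big b ξ φ) = Big b ξ (fun i => andq q (φ i))) by now destruct b.
  assert (F2' := finite_sub _ _ _ (finite_or _ _ _ (finite_fo_free2 q) F2)
    (free2_andq q (Big b ξ φ))).
  assert (P2' := finite_sub _ _ _ (finite_or _ _ _ (finite_fo_par2 q) P2)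
    (par2_andq q (Big b ξ φ))).
  rewrite E in *. apply isC_limit; auto.
Qed.

(** Indescribability assigns a level only to the restriction of the whole conjunction;
    [sat_andq_elim] needs one for the restriction of [φ] itself. *)
Lemma isC_andq_inv κ q b ξ φ : isC b κ ξ (andq q φ) -> isC b κ ξ φ.
Proof.
intros H. remember (andq q φ) as ψ eqn:E. revert φ E. pattern b, ξ, ψ.
revert b ξ ψ H. apply isC_ind_all.
- intros b p Hp φ E. destruct φ; simpl in E; try discriminate. injection E as ->.
  apply isC_zero. apply Hp.
- intros b ξ ks ψ _ IH φ E. destruct (andq_Qs_inv _ _ _ _ _ E) as [φ' [-> ->]].
  apply isC_succ. auto.
- intros b ξ f L _ IH F2 P2 φ E. rewrite E in F2, P2.
  assert (H : exists g, φ = Big b ξ g /\ f = fun i => andq q (g i)).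
  { destruct b, φ; simpl in E; try discriminate; injection E as -> ->; simpl; eauto. }
  destruct H as [g [-> ->]].
  apply isC_limit; auto.
  + exact (finite_sub _ _ _ F2 (free2_andq_r q _)).
  + exact (finite_sub _ _ _ P2 (par2_andq_r q _)).
Qed.

Lemma sat_andq_intro κ q s φ : (forall S, fo_sat κ q s S) ->
  forall S, sat κ φ s S -> sat κ (andq q φ) s S.
Proof.
intros Hq. induction φ as [p|k φ IH|k φ IH|ξ φ IH|ξ φ IH]; simpl; auto.
- intros S [X [HX H]]. eauto.
- intros S [X [HX H]]. eauto.
Qed.

(** Some leaf is always reached, since limit connectives are nonempty and the empty set is available
    to universal quantifiers. Which second-order assignment arrives there is not controlled, hence
    [S']. *)
Lemma sat_andq_elim κ q s b ξ φ : isC b κ ξ φ -> forall S, sat κ (andq q φ) s S ->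
  (exists S', fo_sat κ q s S') /\ sat κ φ s S.
Proof.
intros H. pattern b, ξ, φ. revert b ξ φ H. apply isC_ind_all.
- simpl. intros _ p _ S [H1 H2]. eauto.
- intros b ξ ks ψ _ IH. destruct b; simpl.
  + induction ks as [|k ks IHk]; simpl; auto. intros S H.
    assert (H0 : empty ⊆ V_ κ) by (intros x Hx; destruct (in_empty x Hx)). split.
    * apply (IHk _ (H empty H0)).
    * intros X HX. apply (IHk _ (H X HX)).
  + induction ks as [|k ks IHk]; simpl; auto. intros S [X [HX H]].
    destruct (IHk _ H). eauto.
- intros b ξ f L _ IH _ _ S. assert (H0 := limit_empty ξ L). destruct b; simpl.
  + intros H. split.
    * apply (IH empty H0 _ (H empty H0)).
    * intros i Hi. apply (IH i Hi _ (H i Hi)).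
  + intros [i [Hi H]]. destruct (IH i Hi _ H). eauto.
Qed.

Lemma cut_andq α q φ : cut α (andq q φ) = andq (fo_cut α q) (cut α φ).
Proof.
induction φ as [p|k φ IH|k φ IH|ξ φ IH|ξ φ IH]; simpl; try congruence;
  f_equal; apply functional_extensionality; auto.
Qed.

Lemma restr_andq b κ α q φ :
  restr b κ α (andq q φ) = andq (fo_cut α q) (restr b κ α φ).
Proof.
induction φ as [p|k φ IH|k φ IH|ξ φ IH|ξ φ IH]; simpl; try congruence;
  (destruct (excluded_middle_informative (ξ ∈ κ));
  [exact (cut_andq α q (Big _ ξ φ)) || (simpl; f_equal; apply functional_extensionality;
     intros i; apply cut_andq)
  |simpl; f_equal; apply functional_extensionality; auto]).
Qed.

Lemma indescribable_reflect b ξ κ S q φ : indescribable b ξ κ S ->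
  fo_over κ q -> (forall n, ~ fo_free1 q n) -> (forall n, ~ fo_free2 q n) ->
  (forall s', fo_sat κ q no_vars s') ->
  is_Pi κ ξ φ -> sentence φ -> models κ φ ->
  exists α, α ∈ S /\ regular α /\ models α (restr b κ α φ) /\
    exists s', fo_sat α (fo_cut α q) no_vars s'.
Proof.
intros [_ [_ [_ H]]] Hq F1 F2 Tq HP [Sn1 Sn2] M.
destruct (H (andq q φ)) as [α [Hα [Rα [D [[η Fα] Mα]]]]].
- exact (isC_andq κ q Hq true ξ φ HP).
- split.
  + intros n K. apply free1_andq in K. destruct K; [eapply F1 | eapply Sn1]; eauto.
  + intros n K. apply free2_andq in K. destruct K; [eapply F2 | eapply Sn2]; eauto.
- apply sat_andq_intro; auto.
- rewrite restr_andq in *. exists α. split; auto. split; auto.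
  assert (K : exists c, isC c α η (restr b κ α φ)).
  { destruct Fα as [Fα|Fα]; [exists true|exists false]; eapply isC_andq_inv;
      simpl; eauto. }
  destruct K as [c K]. destruct (sat_andq_elim α _ _ _ _ _ K _ Mα) as [K1 K2].
  split; auto.
Qed.

(** * Trivial sentences of each level, and the closure properties that follow from
    indescribability *)

Lemma isC_const b κ q k d : fo_over κ q -> (forall n, ~ fo_free1 q n) ->
  (forall n, ~ fo_free2 q n) -> ordinal k ->
  let φ := G (fun _ _ _ => q) (fun _ => empty) k b d nil in
  isC b κ k φ /\ sentence φ /\ (forall A, par2 φ A -> fo_par2 q A).
Proof.
intros Hq F1 F2 Ok.
assert (K2 := free2_G (fun _ _ _ => q) (fun _ => empty) (fun _ _ => False)
  (fun _ _ _ n H => F2 n H) ltac:(tauto) k Ok b d nil).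
assert (K3 := par2_G (fun _ _ _ => q) (fun _ => empty) (fo_par2 q)
  (fun _ _ _ B H => H) k Ok b d nil).
split; [|split; auto].
- apply isC_G with (W := fun _ => True) (N := fun _ _ => False) (A := fo_par2 q);
    auto using finite_fo_par2; try tauto.
  intros _. exists nil. tauto.
- split; [|exact K2]. apply free1_G; auto.
Qed.

(** With the graph of a function as [H], the restriction of this sentence to α says that [V_ α] is
    closed under the function. *)
Definition hF (H : V) : fo :=
  FAll 0 (FEx 1 (FEx 2 (FAnd (FIn (var 2) (par H)) (pairF 3 (var 2) (var 0) (var 1))))).

Lemma sat_hF δ H s S : ordinal δ -> (forall n, s n ∈ V_ δ) ->
  (fo_sat δ (hF H) s S <->
   forall x, x ∈ V_ δ -> exists y, y ∈ V_ δ /\ opair x y ∈ V_ δ /\ opair x y ∈ H).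
Proof.
intros Od Hs. unfold hF. rewrite sat_all.
assert (Key : forall x y z, x ∈ V_ δ -> y ∈ V_ δ -> z ∈ V_ δ ->
  (fo_sat δ (FAnd (FIn (var 2) (par H)) (pairF 3 (var 2) (var 0) (var 1)))
    (upd (upd (upd s 0 x) 1 y) 2 z) S <-> z ∈ H /\ z = opair x y)).
{ intros x y z Vx Vy Vz. rewrite !sat_and. rewrite !sat_pairF; simpl; unfold upd; simpl;
    auto; try reflexivity; lia. }
split.
- intros K x Hx. specialize (K x Hx). apply sat_ex in K. destruct K as [y [Vy K]].
  apply sat_ex in K. destruct K as [z [Vz K]]. apply Key in K; auto.
  destruct K as [K ->]. eauto.
- intros K x Hx. destruct (K x Hx) as [y [Vy [Vz Hz]]]. apply sat_ex. exists y.
  split; auto. apply sat_ex. exists (opair x y). split; auto. now apply Key.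
Qed.

(** A true sentence of level exactly [ξ], to which first-order conjuncts can be attached. *)
Lemma indescribable_pos b ξ κ S : indescribable b ξ κ S -> ordinal ξ ->
  exists φ, is_Pi κ ξ φ /\ sentence φ /\ models κ φ.
Proof.
intros H Oξ.
destruct (isC_const true κ TT ξ 1) as [K1 [K2 K3]]; simpl; auto.
- intros n [N [K|K]]; congruence.
- eexists. split; [exact K1|]. split; auto. apply (sat_satF κ true ξ _ K1).
  eapply satF_G_const; auto; [|exact I]. intros s. simpl. tauto.
Qed.

Lemma indescribable_limit b ξ κ S : indescribable b ξ κ S -> ordinal ξ -> limit κ.
Proof.
intros H Oξ. assert (Oκ : ordinal κ) by apply H.
assert (Sκ : S ⊆ κ) by apply H.
destruct (indescribable_pos b ξ κ S H Oξ) as [φ [K1 [K2 K3]]].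
destruct (ord_cases κ Oκ) as [->|[[ν [Oν ->]]|]]; auto; exfalso.
- destruct H as [_ [_ [_ H]]].
  destruct (H φ K1 K2 K3) as [α [Hα _]]. exact (in_empty _ (Sκ _ Hα)).
(* First-order parameters are not cut by restriction, so reflecting the existence of [ν] to α gives
   ν < α, impossible for α < ν + 1. *)
- set (q := FEx 0 (FEq (var 0) (par ν))).
  assert (Hν : ν ∈ V_ (succ ν)) by (apply ord_in_V; auto using mem_succ).
  destruct (indescribable_reflect b ξ (succ ν) S q φ H) as [α [Hα [Rα [_ [s Hs]]]]]; auto.
  + simpl. auto.
  + simpl. intros n [N [E|E]]; congruence.
  + intros s. apply sat_ex. exists ν. simpl. rewrite upd_eq. auto.
  + assert (Oα : ordinal α) by apply Rα.
    change (fo_sat α (FEx 0 (FEq (var 0) (par ν))) no_vars s) in Hs.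
    apply sat_ex in Hs. destruct Hs as [x [Hx E]]. simpl in E. rewrite upd_eq in E.
    subst x. rewrite ord_in_V in Hx by auto. specialize (Sκ _ Hα). apply in_succ in Sκ.
    destruct Sκ as [K| ->]; [exact (mem_asym _ _ Hx K) | exact (mem_irrefl _ Hx)].
Qed.

(** Reflection can be confined to any club: the graph of the function defining the club is a
    second-order parameter, and [hF] for it joins [φ] as a first-order conjunct. *)
Lemma indescribable_closed b ξ κ S h φ : indescribable b ξ κ S -> ordinal ξ ->
  maps (V_ κ) (V_ κ) h -> is_Pi κ ξ φ -> sentence φ -> models κ φ ->
  exists α, α ∈ S /\ regular α /\ closed_at h α /\ models α (restr b κ α φ).
Proof.
intros H Oξ Hh K1 K2 K3. assert (Lκ := indescribable_limit b ξ κ S H Oξ).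
assert (Oκ := proj1 Lκ). assert (H0 : empty ∈ V_ κ) by (apply V_empty_mem; apply Lκ).
set (E := img (V_ κ) (fun x => opair x (h x))).
assert (HE : forall x y, opair x y ∈ E -> y = h x).
{ intros x y K. apply in_img in K. destruct K as [z [_ K]].
  apply opair_inj in K. destruct K as [-> ->]. reflexivity. }
destruct (indescribable_reflect b ξ κ S (hF E) φ H) as [α [Hα [Rα [Mα [s Hs]]]]]; auto.
- assert (par2_over κ (par E)).
  { simpl. intros z Hz. apply in_img in Hz. destruct Hz as [x [Hx ->]].
    apply opair_V; auto. }
  simpl. auto 20.
- intros n. simpl. intuition congruence.
- intros n. simpl. intuition congruence.
- intros s. apply sat_hF; auto. intros x Hx. exists (h x).
  assert (h x ∈ V_ κ) by auto. split; auto. split; [now apply opair_V|].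
  apply in_img. eauto.
- exists α. split; auto. split; auto. split; auto.
  assert (Lα : limit α) by apply Rα. split; auto.
  change (fo_cut α (hF E)) with (hF (inter E (V_ α))) in Hs.
  rewrite sat_hF in Hs; [|apply Lα|intros n; apply V_empty_mem; apply Lα].
  intros x Hx. destruct (Hs x Hx) as [y [Hy [_ Hxy]]]. apply in_inter in Hxy.
  destruct Hxy as [Hxy _]. apply HE in Hxy. now subst.
Qed.

Lemma indescribable_inacc b ξ κ S : indescribable b ξ κ S -> ordinal ξ -> inacc κ.
Proof.
intros H Oξ. assert (Lκ := indescribable_limit b ξ κ S H Oξ). assert (Oκ := proj1 Lκ).
assert (H0 : empty ∈ V_ κ) by (apply V_empty_mem; apply Lκ).
assert (Sκ : S ⊆ κ) by apply H.
destruct (indescribable_pos b ξ κ S H Oξ) as [φ [K1 [K2 K3]]].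
split; auto. split.
(* The function is immaterial. Any reflection point is a limit ordinal below [κ], and so at least
   ω. *)
- destruct (indescribable_closed b ξ κ S (fun _ => empty) φ H Oξ) as [α [Hα [Rα _]]]; auto.
  { now intros _ _. }
  apply (ord_sub_mem omega α); auto using ord_omega. apply omega_sub. apply Rα.
- intros x f Hx Hf.
  (* Every value of [h] contains [x]. A closure point α therefore has [x], hence all [z] in [x], in
     [V_ α], and then each [f z] lies below α. *)
  set (h := fun z => upair x (if excluded_middle_informative (z ∈ x) then f z else empty)).
  destruct (indescribable_closed b ξ κ S h φ H Oξ) as [α [Hα [Rα [[Lα C] _]]]]; auto.
  { intros z Hz. unfold h. apply upair_V; auto. split; auto.
    destruct excluded_middle_informative; auto. apply ord_in_V; auto.
    now apply (ord_mem κ); auto; apply Hf. }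
  exists α. split; auto. intros z Hz.
  assert (Vx : x ∈ V_ α).
  { specialize (C empty (V_empty_mem α (proj1 Lα) (proj1 (proj2 Lα)))). unfold h in C.
    now apply upair_V in C. }
  specialize (C z (V_trans α x z (proj1 Lα) Vx Hz)). unfold h in C.
  apply upair_V in C; auto. destruct C as [_ C].
  destruct excluded_middle_informative; [|tauto].
  rewrite ord_in_V in C; auto; [apply Lα|]. apply (ord_mem κ); auto.
Qed.

(** * Transitive collapses and canonical functions *)

Lemma in_collapse X β y : y ∈ collapse X β <-> exists x, x ∈ β /\ x ∈ X /\ y = collapse X x.
Proof.
rewrite collapse_eq, in_img. split.
- intros [x [Hx ->]]. apply in_inter in Hx. exists x. tauto.
- intros [x [H1 [H2 ->]]]. exists x. rewrite in_inter. tauto.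
Qed.

Lemma in_ot X y : y ∈ ot X <-> exists x, x ∈ X /\ y = collapse X x.
Proof. apply in_img. Qed.

Lemma collapse_mem X x β : x ∈ X -> x ∈ β -> collapse X x ∈ collapse X β.
Proof. intros H K. apply in_collapse. eauto. Qed.

Lemma collapse_inj X x y : ordinal x -> ordinal y -> x ∈ X -> y ∈ X ->
  collapse X x = collapse X y -> x = y.
Proof.
intros Ox Oy Hx Hy E. destruct (ord_tri x Ox y Oy) as [H|[H|H]]; auto;
  apply (collapse_mem X) in H; auto; rewrite E in H; destruct (mem_irrefl _ H).
Qed.

Lemma collapse_ord X β : ordinal β -> ordinal (collapse X β).
Proof.
induction (mem_wf β) as [β _ IH]. intros Oβ. split.
- intros y Hy z Hz. apply in_collapse in Hy. destruct Hy as [x [Hx [Kx ->]]].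
  apply in_collapse in Hz. destruct Hz as [w [Hw [Kw ->]]].
  apply collapse_mem; auto. now apply (ord_trans β x).
- intros y Hy. apply in_collapse in Hy. destruct Hy as [x [Hx [Kx ->]]].
  exact (proj1 (IH x Hx (ord_mem β x Oβ Hx))).
Qed.

Lemma collapse_ext X Y β : ordinal β -> (forall x, x ∈ β -> (x ∈ X <-> x ∈ Y)) ->
  collapse X β = collapse Y β.
Proof.
induction (mem_wf β) as [β _ IH]. intros Oβ H. apply extensionality. intros y.
rewrite !in_collapse.
assert (K : forall x, x ∈ β -> collapse X x = collapse Y x).
{ intros x Hx. apply IH; auto. now apply (ord_mem β). intros z Hz. apply H.
  now apply (ord_trans β x). }
split; intros [x [Hx [Kx ->]]]; exists x; split; auto; split; auto; try apply H; auto.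
symmetry. auto.
Qed.

Lemma collapse_id X β : ordinal β -> β ⊆ X -> collapse X β = β.
Proof.
induction (mem_wf β) as [β _ IH]. intros Oβ H.
assert (K : forall x, x ∈ β -> collapse X x = x).
{ intros x Hx. apply IH; auto. now apply (ord_mem β). intros z Hz. apply H.
  now apply (ord_trans β x). }
apply extensionality. intros y. rewrite in_collapse. split.
- intros [x [Hx [_ ->]]]. now rewrite K.
- intros Hy. exists y. rewrite K; auto.
Qed.

Lemma collapse_le X β : ordinal β -> collapse X β ⊆ β.
Proof.
induction (mem_wf β) as [β _ IH]. intros Oβ y Hy. apply in_collapse in Hy.
destruct Hy as [x [Hx [_ ->]]]. assert (Ox := ord_mem _ _ Oβ Hx).
apply (ord_sub_mem _ x); auto. now apply collapse_ord.
Qed.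

Lemma ot_collapse X β : X ⊆ β -> ot X = collapse X β.
Proof.
intros H. apply extensionality. intros y. rewrite in_ot, in_collapse. split.
- intros [x [Hx ->]]. eauto.
- intros [x [_ [Hx ->]]]. eauto.
Qed.

Lemma collapse_succ X k : k ∈ X -> ordinal k -> collapse X (succ k) = succ (collapse X k).
Proof.
intros Hk Ok. apply extensionality. intros y. rewrite in_succ, !in_collapse. split.
- intros [x [Hx [Kx ->]]]. apply in_succ in Hx. destruct Hx as [Hx| ->]; eauto.
- intros [[x [Hx [Kx ->]]]| ->]; eexists; rewrite in_succ; eauto.
Qed.

Lemma collapse_empty X : collapse X empty = empty.
Proof.
apply extensionality. intros y. rewrite in_collapse. split.
- intros [x [Hx _]]. destruct (in_empty _ Hx).
- intros H. destruct (in_empty _ H).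
Qed.

Lemma collapse_inv_spec X j : j ∈ ot X ->
  collapse_inv X j ∈ X /\ collapse X (collapse_inv X j) = j.
Proof.
intros H. apply in_ot in H. destruct H as [x [Hx ->]]. unfold collapse_inv.
apply epsilon_spec. eauto.
Qed.

Lemma collapse_inv_collapse X x : (forall y, y ∈ X -> ordinal y) -> x ∈ X ->
  collapse X x ∈ ot X /\ collapse_inv X (collapse X x) = x.
Proof.
intros H Hx. assert (K : collapse X x ∈ ot X) by (apply in_ot; eauto). split; auto.
apply collapse_inv_spec in K. destruct K as [K1 K2]. apply collapse_inj in K2; auto.
Qed.

(* [F] is [F^κ_ξ(α)], by the last clause for [η = ξ]. *)
Definition coherent (b : V -> V -> V -> V) (κ ξ α : V) (F : V -> Prop) : Prop :=
  (forall k, F k -> k ∈ ξ) /\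
  (empty ∈ ξ -> F empty) /\
  (forall k, succ k ∈ ξ -> F k -> F (succ k)) /\
  (forall k, F (succ k) \/ succ k = ξ -> F k) /\
  (forall η, F η \/ η = ξ -> forall k, k ∈ canF b κ η α <-> k ∈ η /\ F k).

Lemma lt_card_succ_ord ξ κ : lt_card_succ ξ κ -> ordinal ξ.
Proof. intros [μ [[[O _] _] H]]. now apply (ord_mem μ). Qed.

Lemma lt_card_succ_mem ξ κ k : lt_card_succ ξ κ -> k ∈ ξ -> lt_card_succ k κ.
Proof.
intros [μ [M H]] Hk. exists μ. split; auto. apply (ord_trans μ ξ); auto.
apply M.
Qed.

(** [ι] inverts the bijection b_(κ,ξ), or is the identity if ξ < κ, so that F^κ_ξ(α) becomes the set
    of indices whose label is below α. The conditions on each single index hold on a club, and the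
    labels allow a diagonal intersection over all of them. *)
Lemma coherent_club b κ ξ : canonical_bijections b -> regular κ -> inacc κ ->
  lt_card_succ ξ κ ->
  exists ι, maps ξ κ ι /\ (forall i j, i ∈ ξ -> j ∈ ξ -> ι i = ι j -> i = j) /\
    club κ (fun α => coherent b κ ξ α (fun k => k ∈ ξ /\ ι k ∈ α)).
Proof.
intros hb Rκ Iκ Hξ. assert (Oξ := lt_card_succ_ord _ _ Hξ).
destruct Iκ as [Lκ [_ Bκ]]. assert (Oκ := proj1 Lκ). destruct (hb κ Rκ) as [hb1 _].
assert (Hcan : exists ι, maps ξ κ ι /\ (forall i j, i ∈ ξ -> j ∈ ξ -> ι i = ι j -> i = j) /\
   club κ (fun α => forall k, k ∈ canF b κ ξ α <-> k ∈ ξ /\ ι k ∈ α)).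
{ destruct (classic (ξ ∈ κ)) as [Kξ|Kξ].
  - exists (fun k => k). split; [|split; auto].
    { intros k Hk. now apply (ord_trans κ ξ). }
    apply (club_mono κ (fun α => ξ ∈ V_ α)).
    { apply club_const; auto. now apply ord_in_V. }
    intros α Hα Lα Vξ k. unfold canF. destruct excluded_middle_informative; [|tauto].
    rewrite ord_in_V in Vξ; auto; [|apply Lα]. split; [|tauto]. intros Hk. split; auto.
    apply (ord_trans α ξ); auto. apply Lα.
  - assert (Sξ := ord_notin _ _ Oξ Oκ Kξ). destruct (hb1 ξ Oξ Sξ Hξ) as [B1 [B2 B3]].
    destruct (family_choice V V empty (fun k => k ∈ ξ)
      (fun k i => i ∈ κ /\ b κ ξ i = k) B3) as [ι Hι].
    exists ι. split; [intros k Hk; now apply Hι|]. split.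
    { intros i j Hi Hj E. destruct (Hι i Hi) as [_ <-]. destruct (Hι j Hj) as [_ <-].
      now rewrite E. }
    apply club_all. intros α Hα Lα k. unfold canF.
    destruct excluded_middle_informative; [tauto|]. rewrite in_img. split.
    + intros [i [Hi ->]]. assert (Ki : i ∈ κ) by now apply (ord_trans κ α).
      split; auto. destruct (Hι (b κ ξ i) (B1 i Ki)) as [H1 H2].
      apply B2 in H2; auto. now rewrite H2.
    + intros [Hk Hi]. exists (ι k). split; auto. symmetry. now apply Hι. }
destruct Hcan as [ι [Hι [Inj Cξ]]]. exists ι. split; auto. split; auto.
assert (Vι : forall k, k ∈ ξ -> ι k ∈ V_ κ).
{ intros k Hk. apply ord_in_V; auto. apply (ord_mem κ); auto. }
assert (Oι : forall k, k ∈ ξ -> ordinal (ι k)).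
{ intros k Hk. apply (ord_mem κ); auto. }
assert (Diag : forall Q : V -> V -> Prop, (forall k, k ∈ ξ -> club κ (Q k)) ->
  club κ (fun α => forall k, k ∈ ξ -> ι k ∈ α -> Q k α)).
{ intros Q HQ. apply (club_mono κ (fun α => forall k, k ∈ ξ -> ι k ∈ V_ α -> Q k α)).
  - apply (club_diag V κ (fun k => k ∈ ξ) ι Q); auto.
  - intros α Hα Lα K k Hk Hi. apply K; auto. apply ord_in_V; auto. apply Lα. }
assert (Pt : forall k, k ∈ ξ -> club κ (fun α => ι k ∈ α)).
{ intros k Hk. apply (club_mono κ (fun α => ι k ∈ V_ α)).
  - apply club_const; auto.
  - intros α _ Lα. rewrite ord_in_V; auto. apply Lα. }
assert (C0 : club κ (fun α => empty ∈ ξ -> ι empty ∈ α)) by (apply club_imp; auto).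
assert (C1 : club κ (fun α => forall k, k ∈ ξ -> ι k ∈ α -> succ k ∈ ξ -> ι (succ k) ∈ α)).
{ apply Diag. intros k Hk. apply club_imp. auto. }
assert (C2 : club κ (fun α => forall k, k ∈ ξ -> ι k ∈ α ->
   forall j, j ∈ ξ -> succ j = k -> ι j ∈ α)).
{ apply Diag. intros k Hk. destruct (classic (exists j, succ j = k)) as [[j <-]|N].
  - assert (Hj : j ∈ ξ) by (apply (ord_trans ξ (succ j)); auto using mem_succ).
    apply (club_mono κ (fun α => ι j ∈ α)); auto.
    intros α _ _ K i _ E. apply succ_inj in E. now subst.
  - apply club_all. intros. destruct N. eauto. }
assert (C3 : club κ (fun α => forall j, j ∈ ξ -> succ j = ξ -> ι j ∈ α)).
{ destruct (classic (exists j, succ j = ξ)) as [[j E]|N].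
  - apply (club_mono κ (fun α => ι j ∈ α)).
    + apply Pt. rewrite <- E. apply mem_succ.
    + intros α _ _ K i _ E'. rewrite <- E in E'. apply succ_inj in E'. now subst.
  - apply club_all. intros. destruct N. eauto. }
assert (C4 : club κ (fun α => forall η, η ∈ ξ -> ι η ∈ α ->
   forall k, k ∈ canF b κ η α <-> k ∈ η /\ ι k ∈ α)).
{ apply Diag. intros η Hη. assert (Oη := ord_mem _ _ Oξ Hη).
  assert (Sub : forall k, k ∈ η -> k ∈ ξ) by (intros k Hk; now apply (ord_trans ξ η)).
  unfold canF. destruct excluded_middle_informative as [Kη|Kη].
  (* For η < κ the set F^κ_η(α) is all of η, so every label of an index in η must be below α. These
     labels are bounded in [κ] by some γ. *)
  - destruct (Bκ η ι) as [γ [Hγ Kγ]].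
    { now apply ord_in_V. }
    { intros k Hk. auto. }
    apply (club_mono κ (fun α => γ ∈ V_ α)).
    + apply club_const; auto. apply ord_in_V; eauto using ord_mem.
    + intros α Hα Lα K k. rewrite ord_in_V in K; [|apply Lα|eauto using ord_mem].
      split; [|tauto]. intros Hk. split; auto. apply (ord_trans α γ); auto. apply Lα.
  - assert (Sη := ord_notin _ _ Oη Oκ Kη).
    destruct (hb1 η Oη Sη (lt_card_succ_mem _ _ _ Hξ Hη)) as [B1 [B2 B3]].
    (* For η ≥ κ two enumerations of η compete, b_(κ,η) and the one by labels. [g] sends a label to
       the place under b_(κ,η). If α is closed under [g] and under the translation back, both
       enumerations list the same indices below α. *)
    destruct (family_choice V V empty (fun i => i ∈ κ)
      (fun i j => j ∈ κ /\ (forall k, k ∈ η -> ι k = i -> b κ η j = k))) as [g Hg].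
    { intros i Hi. destruct (classic (exists k, k ∈ η /\ ι k = i)) as [[k [Hk <-]]|N].
      - destruct (B3 k Hk) as [j [Hj E]]. exists j. split; auto. intros k' Hk' E'.
        apply Inj in E'; auto. now subst.
      - exists empty. split; [now apply limit_empty|]. intros k Hk E. destruct N. eauto. }
    set (h := fun x => if excluded_middle_informative (x ∈ κ)
      then upair (ι (b κ η x)) (g x) else empty).
    assert (Hh : maps (V_ κ) (V_ κ) h).
    { intros x Hx. unfold h. destruct excluded_middle_informative as [Kx|Kx].
      - destruct (Hg x Kx) as [Hgx _]. apply upair_V; auto. split.
        + apply Vι, Sub, (B1 x Kx).
        + apply ord_in_V; auto. now apply (ord_mem κ).
      - apply V_empty_mem; auto. apply Lκ. }
    apply (club_mono κ (closed_at h)); [now apply club_closed|].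
    intros α Hα Lα [_ C] k.
    assert (C' : forall i, i ∈ α -> ι (b κ η i) ∈ α /\ g i ∈ α).
    { intros i Hi. assert (Ki : i ∈ κ) by now apply (ord_trans κ α).
      assert (Oi := ord_mem _ _ Oκ Ki).
      assert (Vi : i ∈ V_ α) by (apply ord_in_V; auto; apply Lα).
      specialize (C i Vi). unfold h in C. destruct excluded_middle_informative; [|tauto].
      apply upair_V in C; auto. destruct (Hg i Ki) as [Hgi _].
      rewrite !ord_in_V in C; auto; try apply Lα.
      now apply (ord_mem κ). }
    rewrite in_img. split.
    + intros [i [Hi ->]]. assert (Ki : i ∈ κ) by now apply (ord_trans κ α).
      split; auto. now apply C'.
    + intros [Hk Hi]. exists (g (ι k)). split; [now apply C'|].
      symmetry. apply (Hg (ι k)); auto. }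
assert (Call := club_and κ _ _ Lκ Cξ (club_and κ _ _ Lκ C0 (club_and κ _ _ Lκ C1
  (club_and κ _ _ Lκ C2 (club_and κ _ _ Lκ C3 C4))))).
apply (club_mono κ _ _ Call). cbv beta.
intros α Hα Lα [K [K0 [K1 [K2 [K3 K4]]]]].
split; [tauto|]. split; [auto|]. split; [intros k Hk [H1 H2]; auto|]. split.
- intros k [[H1 H2]|E].
  + assert (Hk : k ∈ ξ) by (apply (ord_trans ξ (succ k)); auto using mem_succ). eauto.
  + assert (Hk : k ∈ ξ) by (rewrite <- E; apply mem_succ). auto.
- intros η [[H1 H2]| ->] k.
  + rewrite K4 by auto. split; [|tauto]. intros [H3 H4]. split; auto. split; auto.
    now apply (ord_trans ξ η).
  + rewrite K. tauto.
Qed.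

(** * Restrictions at a point where the canonical functions are coherent *)

Section Coherent.
Context (b : V -> V -> V -> V) (κ ξ α : V) (F : V -> Prop).
Hypothesis Oκ : ordinal κ.
Hypothesis Oξ : ordinal ξ.
Hypothesis HF : coherent b κ ξ α F.

Definition trace : V := sep ξ F.

Lemma in_trace k : k ∈ trace <-> F k.
Proof.
unfold trace. rewrite in_sep. split; [tauto|]. intros H. split; auto.
exact (proj1 HF k H).
Qed.

Lemma coherent_sub η : F η \/ η = ξ -> η ⊆ ξ.
Proof.
intros [H| ->]; [|now intros x]. intros x Hx. apply (ord_trans ξ η); auto.
exact (proj1 HF η H).
Qed.

Lemma coherent_ord η : F η \/ η = ξ -> ordinal η.
Proof. intros [H| ->]; auto. exact (ord_mem ξ η Oξ (proj1 HF η H)). Qed.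

(** By coherence the collapses π^κ_(η,α), for the surviving η, are all restrictions of the one
    collapse of [trace]; hence the restriction of a formula of level η has level
    [collapse trace η]. *)
Lemma canF_collapse η k : F η \/ η = ξ -> ordinal k -> k ⊆ η ->
  collapse (canF b κ η α) k = collapse trace k.
Proof.
intros H Ok Hk. apply collapse_ext; auto. intros x Hx. rewrite in_trace.
destruct HF as [_ [_ [_ [_ K]]]]. rewrite (K η H). specialize (Hk x Hx). tauto.
Qed.

Lemma canf_collapse η : F η \/ η = ξ -> canf b κ η α = collapse trace η.
Proof.
intros H. unfold canf. rewrite (ot_collapse _ η).
- apply canF_collapse; auto; [now apply coherent_ord | now intros x].
- intros x Hx. destruct HF as [_ [_ [_ [_ K]]]]. now apply (K η H) in Hx.
Qed.

Lemma coherent_inv η : F η \/ η = ξ -> forall j, j ∈ canf b κ η α ->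
  let k := collapse_inv (canF b κ η α) j in k ∈ η /\ F k /\ collapse trace k = j.
Proof.
intros H j Hj. cbv zeta. unfold canf in Hj. apply collapse_inv_spec in Hj.
destruct Hj as [H1 H2]. destruct HF as [_ [_ [_ [_ K]]]]. apply (K η H) in H1.
destruct H1 as [H1 H3]. split; auto. split; auto.
rewrite <- H2 at 2. symmetry. apply canF_collapse; auto.
- apply (ord_mem η); auto. now apply coherent_ord.
- intros x Hx. apply (ord_trans η (collapse_inv (canF b κ η α) j)); auto.
  now apply coherent_ord.
Qed.

Lemma coherent_surj η : F η \/ η = ξ -> forall k, k ∈ η -> F k ->
  exists j, j ∈ canf b κ η α /\ collapse_inv (canF b κ η α) j = k.
Proof.
intros H k Hk Fk. destruct HF as [_ [_ [_ [_ K]]]].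
assert (Hk' : k ∈ canF b κ η α) by (apply (K η H); auto).
exists (collapse (canF b κ η α) k). apply collapse_inv_collapse; auto.
intros y Hy. apply (K η H) in Hy. destruct Hy as [Hy _].
apply (ord_mem η); auto. now apply coherent_ord.
Qed.

(** Below [κ] restriction keeps all indices, in accordance with F^κ_η(α) = η there. *)
Lemma coherent_small η : F η \/ η = ξ -> η ∈ κ -> forall k, k ∈ η -> F k.
Proof.
intros H Hη k Hk. destruct HF as [_ [_ [_ [_ K]]]]. specialize (K η H k).
unfold canF in K. destruct excluded_middle_informative; tauto.
Qed.

Lemma coherent_limit η : F η \/ η = ξ -> limit η -> limit (collapse trace η).
Proof.
intros H L. split; [apply collapse_ord; apply L|]. assert (S := coherent_sub η H).
assert (L0 := limit_empty η L). destruct HF as [_ [F0 [FS _]]]. split.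
- intros E. assert (K : collapse trace empty ∈ collapse trace η).
  { apply collapse_mem; auto. apply in_trace. exact (F0 (S _ L0)). }
  rewrite E in K. exact (in_empty _ K).
- intros y Hy. apply in_collapse in Hy. destruct Hy as [x [Hx [Kx ->]]].
  assert (Sx : succ x ∈ η) by now apply L.
  rewrite <- collapse_succ; auto; [|apply (ord_mem η); auto; apply L].
  apply collapse_mem; auto. apply in_trace. rewrite in_trace in Kx.
  exact (FS x (S _ Sx) Kx).
Qed.

Lemma restr_Big_small c η f : (forall i, i ∈ η -> isC c κ i (f i)) -> η ∈ κ ->
  restr b κ α (Big c η f) = Big c η (fun i => cut α (f i)) /\
  restr_defined b κ α (Big c η f) /\
  forall i, i ∈ η -> restr b κ α (f i) = cut α (f i) /\ restr_defined b κ α (f i).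
Proof.
intros H Hη. split; [|split].
- destruct c; simpl; destruct excluded_middle_informative; tauto.
- destruct c; simpl; tauto.
- intros i Hi. assert (Hi' : i ∈ κ) by now apply (ord_trans κ η).
  destruct (restr_small b κ α κ Oκ) as [R1 R2]. destruct c.
  + exact (R1 i (f i) (H i Hi) Hi').
  + exact (R2 i (f i) (H i Hi) Hi').
Qed.

Lemma restr_Big_large c η f : ~ η ∈ κ ->
  restr b κ α (Big c η f) = Big c (canf b κ η α)
    (fun j => restr b κ α (f (collapse_inv (canF b κ η α) j))).
Proof. intros Hη. destruct c; simpl; destruct excluded_middle_informative; tauto. Qed.

Lemma restr_Qs c ks ψ : restr b κ α (Qs c ks ψ) = Qs c ks (restr b κ α ψ).
Proof. destruct c; [apply restr_salls | apply restr_sexs]. Qed.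

(** The value of a connective depends only on which members occur, not on their numbering.
    Reindexing by the inverse collapse runs exactly through the indices of η in [F]; below [κ],
    where only parameters are cut, all indices are in [F] anyway. *)
Lemma sat_restr c η φ : isC c κ η φ -> F η \/ η = ξ ->
  forall s S, sat α (restr b κ α φ) s S <-> satF α F φ s S.
Proof.
intros H. pattern c, η, φ. revert c η φ H. apply isC_ind_all.
- intros c p _ _ s S. simpl. tauto.
- intros c η ks ψ _ IH Hη s S. rewrite restr_Qs, sat_Qs, satF_Qs.
  assert (Fη : F η) by now apply HF.
  apply quant_iff. auto.
- intros c η f L D IH _ _ Hη s S. rewrite satF_Big.
  destruct (classic (η ∈ κ)) as [Kη|Kη].
  + destruct (restr_Big_small c η f D Kη) as [-> [_ K]].
    assert (Sm := coherent_small η Hη Kη).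
    destruct c; simpl; split.
    * intros M i [Hi Fi]. apply IH; auto. destruct (K i Hi) as [-> _]. auto.
    * intros M i Hi. destruct (K i Hi) as [<- _]. apply IH; auto.
    * intros [i [Hi M]]. exists i. split; auto. apply IH; auto.
      destruct (K i Hi) as [-> _]. auto.
    * intros [i [[Hi _] M]]. exists i. split; auto. destruct (K i Hi) as [<- _].
      apply IH; auto.
  + rewrite restr_Big_large by auto. destruct c; simpl; split.
    * intros M i [Hi Fi]. destruct (coherent_surj η Hη i Hi Fi) as [j [Hj E]].
      specialize (M j Hj). rewrite E in M. apply IH in M; auto.
    * intros M j Hj. destruct (coherent_inv η Hη j Hj) as [K1 [K2 _]].
      apply IH; auto.
    * intros [j [Hj M]]. destruct (coherent_inv η Hη j Hj) as [K1 [K2 _]].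
      eexists. split; [split; [exact K1|exact K2]|]. apply IH; auto.
    * intros [i [[Hi Fi] M]]. destruct (coherent_surj η Hη i Hi Fi) as [j [Hj E]].
      exists j. split; auto. rewrite E. apply IH; auto.
Qed.

End Coherent.

(** The cardinal [κ] guarantees that α⁺ = μ exists. If μ ≤ ν, the image of μ in α would have order
    type at most α, hence an ordinal below μ would be in bijection with μ. *)
Lemma lt_card_succ_inj α κ ν f : cardinal κ -> α ∈ κ -> ordinal ν -> maps ν α f ->
  (forall x y, x ∈ ν -> y ∈ ν -> f x = f y -> x = y) -> lt_card_succ ν α.
Proof.
intros Cκ Hα Oν Hf Inj.
destruct (ord_ind_least (fun μ => cardinal μ /\ α ∈ μ) κ) as [μ [Oμ [[Cμ Hμ] Least]]];
  auto; [apply Cκ|].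
assert (Oα := ord_mem _ _ Oμ Hμ).
exists μ. split.
{ split; auto. split; auto. intros ρ Cρ Hρ. apply ord_notin; auto; [apply Cρ|].
  intros K. exact (Least ρ K (conj Cρ Hρ)). }
apply NNPP. intros N. assert (Sμ := ord_notin _ _ Oν Oμ N).
assert (InjX : forall x y, x ∈ μ -> y ∈ μ -> f x = f y -> x = y) by auto.
set (X := img μ f).
assert (SX : X ⊆ α). { intros y Hy. apply in_img in Hy. destruct Hy as [x [Hx ->]]. auto. }
assert (OX : forall y, y ∈ X -> ordinal y) by (intros y Hy; apply (ord_mem α); auto).
assert (Oε : ordinal (ot X)) by (rewrite (ot_collapse X α SX); now apply collapse_ord).
assert (Hε : ot X ∈ μ).
{ apply (ord_sub_mem _ α); auto. rewrite (ot_collapse X α SX). now apply collapse_le. }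
destruct Cμ as [_ Cμ]. apply (Cμ (ot X) Hε).
destruct (family_choice V V empty (fun j => j ∈ ot X)
  (fun j x => x ∈ μ /\ j = collapse X (f x))) as [g Hg].
{ intros j Hj. apply in_ot in Hj. destruct Hj as [y [Hy ->]]. apply in_img in Hy.
  destruct Hy as [x [Hx ->]]. eauto. }
exists g. split; [|split].
- intros j Hj. now apply Hg.
- intros i j Hi Hj E. destruct (Hg i Hi) as [_ ->]. destruct (Hg j Hj) as [_ ->].
  now rewrite E.
- intros x Hx. assert (Hfx : f x ∈ X) by (apply in_img; eauto).
  exists (collapse X (f x)). assert (Hj : collapse X (f x) ∈ ot X) by (apply in_ot; eauto).
  split; auto. destruct (Hg _ Hj) as [K1 K2].
  assert (Hgx : f (g (collapse X (f x))) ∈ X) by (apply in_img; eauto).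
  apply collapse_inj in K2; auto.
Qed.

(** * Restrictions are defined on a club *)

Lemma restr_defined_Qs b κ α c ks ψ :
  restr_defined b κ α (Qs c ks ψ) <-> restr_defined b κ α ψ.
Proof. destruct c; [apply restr_salls | apply restr_sexs]. Qed.

Lemma restr_defined_Big b κ α c η f : regular κ ->
  (forall j, j ∈ canf b κ η α ->
    restr_defined b κ α (f (collapse_inv (canF b κ η α) j)) /\
    isC c α j (restr b κ α (f (collapse_inv (canF b κ η α) j)))) ->
  restr_defined b κ α (Big c η f).
Proof. intros R H. destruct c; simpl; right; split; auto. Qed.

Lemma fo_over_club κ p : limit κ -> fo_over κ p -> club κ (fun β => fo_over β (fo_cut β p)).
Proof.
intros Lκ. assert (T : forall t, par1_over κ t -> club κ (fun β => par1_over β t)).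
{ intros [n|a] H; simpl in *; [now apply club_all | now apply club_const]. }
induction p as [s t|s t|s X|p IH|p IHp q IHq|n p IH]; simpl; auto.
- intros [H K]. apply club_and; auto.
- intros [H K]. apply club_and; auto.
- intros [H _]. apply (club_mono κ (fun β => par1_over β s)); auto.
  intros β _ _ K. split; auto. destruct X as [n|A]; simpl; auto using inter_sub_r.
- intros [H K]. apply club_and; auto.
Qed.

Lemma fo_free2_cut δ p k : fo_free2 (fo_cut δ p) k <-> fo_free2 p k.
Proof.
induction p as [t u|t u|t X|p IH|p IHp q IHq|n p IH]; simpl; try tauto.
destruct X; simpl; [tauto|]. split; discriminate.
Qed.

Lemma par2_fo_cut β p A : fo_par2 (fo_cut β p) A ->
  exists A', fo_par2 p A' /\ A = inter A' (V_ β).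
Proof.
induction p as [s t|s t|s X|p IH|p IHp q IHq|n p IH]; simpl; auto; try tauto.
- intros E. destruct X as [n|B]; simpl in E; [discriminate|]. injection E as <-. eauto.
- intros [H|H]; [destruct (IHp H) as [A' [K1 K2]] | destruct (IHq H) as [A' [K1 K2]]]; eauto.
Qed.

(** The conclusions on [par2] and [free2] are carried along for the limit step: the restricted
    connective must again have finitely many second-order parameters and variables, and these arise
    from those of the original. The clubs of its members are combined by a diagonal intersection. *)
Lemma restr_defined_club b κ ξ ι : regular κ -> ordinal ξ -> maps ξ κ ι ->
  (forall i j, i ∈ ξ -> j ∈ ξ -> ι i = ι j -> i = j) ->
  forall c η φ, isC c κ η φ -> η ∈ ξ \/ η = ξ ->
  club κ (fun β => let F := fun k => k ∈ ξ /\ ι k ∈ β in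
    coherent b κ ξ β F -> F η \/ η = ξ ->
    restr_defined b κ β φ /\ isC c β (collapse (trace ξ F) η) (restr b κ β φ) /\
    (forall A, par2 (restr b κ β φ) A -> exists A', par2 φ A' /\ A = inter A' (V_ β)) /\
    (forall n, free2 (restr b κ β φ) n -> free2 φ n)).
Proof.
intros Rκ Oξ Hι Inj. assert (Lκ : limit κ) by apply Rκ. assert (Oκ := proj1 Lκ).
intros c η φ H. pattern c, η, φ. revert c η φ H. apply isC_ind_all.
- intros c p Hp _. apply (club_mono κ _ _ (fo_over_club κ p Lκ Hp)).
  intros β Hβ Lβ K F HF Hη. rewrite collapse_empty. simpl. split; auto. split.
  + apply isC_zero; auto.
  + split; [apply par2_fo_cut | intros n; apply fo_free2_cut].
- intros c η ks ψ D IH Hη.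
  assert (Hη' : η ∈ ξ).
  { destruct Hη as [Hη|<-]; [|apply mem_succ].
    apply (ord_trans ξ (succ η)); auto using mem_succ. }
  apply (club_mono κ _ _ (IH (or_introl Hη'))). cbv zeta.
  intros β Hβ Lβ K HF Hs.
  assert (Fη : η ∈ ξ /\ ι η ∈ β) by now apply HF.
  destruct (K HF (or_introl Fη)) as [K1 [K2 [K3 K4]]].
  rewrite restr_defined_Qs, restr_Qs.
  rewrite collapse_succ; [|eapply in_trace; eauto|now apply (ord_mem ξ)].
  split; auto. split; [now apply isC_succ|]. split.
  + intros A. rewrite par2_Qs. intros HA. destruct (K3 A HA) as [A' [HA' E]].
    exists A'. now rewrite par2_Qs.
  + intros n. rewrite !free2_Qs. intros [H1 H2]. auto.
- intros c η f L D IH F2 P2 Hη.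
  assert (Sη : forall i, i ∈ η -> i ∈ ξ).
  { intros i Hi. destruct Hη as [Hη| <-]; auto. now apply (ord_trans ξ η). }
  assert (Diag := club_diag V κ (fun i => i ∈ η) ι _ Lκ
    (fun i j Hi Hj => Inj i j (Sη i Hi) (Sη j Hj))
    (fun i Hi => IH i Hi (or_introl (Sη i Hi)))).
  apply (club_mono κ _ _ Diag). cbv zeta.
  intros β Hβ Lβ K HF Hη'. set (F := fun k => k ∈ ξ /\ ι k ∈ β) in *.
  assert (K' : forall i, i ∈ η -> F i ->
    restr_defined b κ β (f i) /\
    isC c β (collapse (trace ξ F) i) (restr b κ β (f i)) /\
    (forall A, par2 (restr b κ β (f i)) A -> exists A', par2 (f i) A' /\ A = inter A' (V_ β)) /\
    (forall n, free2 (restr b κ β (f i)) n -> free2 (f i) n)).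
  { intros i Hi Fi. apply K; auto. apply ord_in_V; [apply Lβ| |apply Fi].
    apply (ord_mem κ); auto. }
  clear K Diag.
  assert (Lη : limit (collapse (trace ξ F) η)) by (eapply coherent_limit; eauto).
  destruct (classic (η ∈ κ)) as [Kη|Kη].
  + destruct (restr_Big_small b κ β Oκ c η f D Kη) as [-> [R1 R2]].
    assert (Sm := coherent_small b κ ξ β F HF η Hη' Kη).
    assert (Id : forall i, ordinal i -> i ⊆ η -> collapse (trace ξ F) i = i).
    { intros i Oi Hi. apply collapse_id; auto. intros x Hx.
      eapply in_trace; eauto. }
    rewrite (Id η (proj1 L) (fun x Hx => Hx)) in *. split; auto.
    assert (P : forall A, par2 (Big c η (fun i => cut β (f i))) A ->
      exists A', par2 (Big c η f) A' /\ A = inter A' (V_ β)).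
    { intros A HA. apply par2_Big in HA. destruct HA as [i [Hi HA]].
      destruct (R2 i Hi) as [<- _] in HA. destruct (K' i Hi (Sm i Hi)) as [_ [_ [K3 _]]].
      destruct (K3 A HA) as [A' [HA' E]]. exists A'. split; auto. apply par2_Big. eauto. }
    assert (Q : forall n, free2 (Big c η (fun i => cut β (f i))) n -> free2 (Big c η f) n).
    { intros n Hn. apply free2_Big in Hn. destruct Hn as [i [Hi Hn]].
      destruct (R2 i Hi) as [<- _] in Hn. destruct (K' i Hi (Sm i Hi)) as [_ [_ [_ K4]]].
      apply free2_Big. eauto. }
    split; [|split; auto]. apply isC_limit; auto.
    * intros i Hi. destruct (R2 i Hi) as [<- _].
      destruct (K' i Hi (Sm i Hi)) as [_ [K2 _]]. rewrite Id in K2; auto.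
      -- apply (ord_mem η); auto. apply L.
      -- intros x Hx. apply (ord_trans η i); auto. apply L.
    * exact (finite_sub _ _ _ F2 Q).
    * exact (finite_img _ _ _ _ _ P2 P).
  + assert (Inv := coherent_inv b κ ξ β F Oξ HF η Hη'). cbv zeta in Inv.
    rewrite restr_Big_large by auto.
    rewrite <- (canf_collapse b κ ξ β F Oξ HF η Hη') in *.
    split.
    { apply restr_defined_Big; auto. intros j Hj. destruct (Inv j Hj) as [I1 [I2 I3]].
      destruct (K' _ I1 I2) as [K1 [K2 _]]. rewrite I3 in K2. auto. }
    assert (P : forall A, par2 (Big c (canf b κ η β)
        (fun j => restr b κ β (f (collapse_inv (canF b κ η β) j)))) A ->
      exists A', par2 (Big c η f) A' /\ A = inter A' (V_ β)).
    { intros A HA. apply par2_Big in HA. destruct HA as [j [Hj HA]].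
      destruct (Inv j Hj) as [I1 [I2 I3]]. destruct (K' _ I1 I2) as [_ [_ [K3 _]]].
      destruct (K3 A HA) as [A' [HA' E]]. exists A'. split; auto. apply par2_Big. eauto. }
    assert (Q : forall n, free2 (Big c (canf b κ η β)
        (fun j => restr b κ β (f (collapse_inv (canF b κ η β) j)))) n ->
      free2 (Big c η f) n).
    { intros n Hn. apply free2_Big in Hn. destruct Hn as [j [Hj Hn]].
      destruct (Inv j Hj) as [I1 [I2 I3]]. destruct (K' _ I1 I2) as [_ [_ [_ K4]]].
      apply free2_Big. eauto. }
    split; [|split; auto]. apply isC_limit; auto.
    * intros j Hj. destruct (Inv j Hj) as [I1 [I2 I3]].
      destruct (K' _ I1 I2) as [_ [K2 _]]. now rewrite I3 in K2.
    * exact (finite_sub _ _ _ F2 Q).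
    * exact (finite_img _ _ _ _ _ P2 P).
Qed.

(** * Raising the level of a formula *)

Lemma isC_finite b κ ξ φ : isC b κ ξ φ ->
  finitely_many (free2 φ) /\ finitely_many (par2 φ).
Proof.
intros H. pattern b, ξ, φ. revert b ξ φ H. apply isC_ind_all.
- intros _ p _. split; [apply finite_fo_free2 | apply finite_fo_par2].
- intros b ξ ks ψ _ [H1 H2]. split.
  + apply (finite_sub _ _ _ H1). intros n. rewrite free2_Qs. tauto.
  + apply (finite_sub _ _ _ H2). intros A. now rewrite par2_Qs.
- auto.
Qed.

Fixpoint nogap (φ : form) : Prop :=
  match φ with
  | FO p => ~ fo_free2 p 1
  | SAll k ψ | SEx k ψ => k <> 1 /\ nogap ψ
  | BigAnd ξ ψ | BigOr ξ ψ => forall ζ, ζ ∈ ξ -> nogap (ψ ζ)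
  end.

Lemma nogap_Qs b ks ψ : nogap (Qs b ks ψ) <-> ~ In 1 ks /\ nogap ψ.
Proof. destruct b; induction ks; simpl in *; tauto. Qed.

Lemma nogap_Big b ξ f : nogap (Big b ξ f) <-> forall ζ, ζ ∈ ξ -> nogap (f ζ).
Proof. destruct b; simpl; tauto. Qed.

Lemma fo_sat_nogap δ p S S' : (forall k, k <> 1 -> S k = S' k) -> ~ fo_free2 p 1 ->
  forall s, fo_sat δ p s S <-> fo_sat δ p s S'.
Proof.
intros E. induction p as [t u|t u|t X|p IH|p IHp q IHq|n p IH]; simpl; intros H s;
  try tauto.
- destruct X as [k|A]; simpl; [|tauto]. rewrite E; [tauto|congruence].
- rewrite IH; tauto.
- rewrite IHp, IHq; tauto.
- split; intros K x Hx; apply IH; auto.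
Qed.

Lemma satF_nogap δ F φ : nogap φ -> forall s S S', (forall k, k <> 1 -> S k = S' k) ->
  satF δ F φ s S -> satF δ F φ s S'.
Proof.
assert (U : forall k X S S', (forall k, k <> 1 -> S k = S' k) ->
  forall m, m <> 1 -> upd S k X m = upd S' k X m).
{ intros k X S S' E m Hm. unfold upd. destruct Nat.eq_dec; auto. }
induction φ as [p|k φ IH|k φ IH|ξ φ IH|ξ φ IH]; simpl.
- intros H s S S' E. apply fo_sat_nogap; [symmetry; auto|]. now rewrite fo_free2_cut.
- intros [_ H] s S S' E K X HX. eapply IH; eauto.
- intros [_ H] s S S' E [X [HX K]]. exists X. split; auto. eapply IH; eauto.
- intros H s S S' E K i Hi Fi. eapply IH; eauto.
- intros H s S S' E [i [Hi [Fi K]]]. exists i. split; auto. split; auto. eapply IH; eauto.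
Qed.

Definition gate (c : bool) (P Q : Prop) : Prop := if c then P -> Q else P /\ Q.

Lemma gate_iff c P Q R : (Q <-> R) -> (gate c P Q <-> gate c P R).
Proof. destruct c; simpl; tauto. Qed.

(** The domain must be nonempty, for the gate has to be reached even when its condition fails.
    Blocks always offer the empty set, limit connectives the index 0. *)
Lemma gate_quant (A : Type) b c (P Q : A -> Prop) (R : Prop) : (exists x, P x) ->
  (quant b P (fun x => gate c R (Q x)) <-> gate c R (quant b P Q)).
Proof.
intros [x0 H0]. destruct b, c; simpl; split.
- intros H r x Hx. auto.
- intros H x Hx r. auto.
- intros H. split; [apply (H x0 H0)|]. intros x Hx. now apply H.
- intros [r H] x Hx. auto.
- intros [x [Hx H]] r. eauto.
- intros H. destruct (classic R) as [r|n].
  + destruct (H r) as [x [Hx Qx]]. exists x. auto.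
  + exists x0. split; auto. tauto.
- intros [x [Hx [r H]]]. eauto.
- intros [r [x [Hx H]]]. eauto.
Qed.

(** The condition on [i] is pushed down to the leaves so that the level is preserved. *)
Fixpoint lift (c : bool) (i : V) (φ : form) : form :=
  match φ with
  | FO p => FO (if c then FImp (FIn (par i) (var 1)) p else FAnd (FIn (par i) (var 1)) p)
  | SAll k ψ => SAll k (lift c i ψ)
  | SEx k ψ => SEx k (lift c i ψ)
  | BigAnd ξ ψ => BigAnd ξ (fun ζ => lift c i (ψ ζ))
  | BigOr ξ ψ => BigOr ξ (fun ζ => lift c i (ψ ζ))
  end.

Lemma lift_Qs c i b ks ψ : lift c i (Qs b ks ψ) = Qs b ks (lift c i ψ).
Proof. destruct b; induction ks; simpl in *; congruence. Qed.

Lemma lift_Big c i b ξ f : lift c i (Big b ξ f) = Big b ξ (fun ζ => lift c i (f ζ)).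
Proof. now destruct b. Qed.

Lemma free1_lift c i φ n : free1 (lift c i φ) n -> free1 φ n.
Proof.
induction φ as [p|k φ IH|k φ IH|ξ φ IH|ξ φ IH]; simpl; auto.
- destruct c; simpl; intros [H|H]; congruence || tauto.
- intros [ζ [Hζ H]]. eauto.
- intros [ζ [Hζ H]]. eauto.
Qed.

Lemma free2_lift c i φ n : free2 (lift c i φ) n -> n = 1 \/ free2 φ n.
Proof.
induction φ as [p|k φ IH|k φ IH|ξ φ IH|ξ φ IH]; simpl; auto; try tauto.
- destruct c; simpl; intros [H|H]; auto; left; congruence.
- intros [ζ [Hζ H]]. destruct (IH _ H); eauto.
- intros [ζ [Hζ H]]. destruct (IH _ H); eauto.
Qed.

Lemma par2_lift c i φ A : par2 (lift c i φ) A -> par2 φ A.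
Proof.
induction φ as [p|k φ IH|k φ IH|ξ φ IH|ξ φ IH]; simpl; auto.
- destruct c; simpl; intros [H|H]; congruence || auto.
- intros [ζ [Hζ H]]. eauto.
- intros [ζ [Hζ H]]. eauto.
Qed.

Lemma isC_lift κ c i : i ∈ V_ κ -> forall b ξ φ, isC b κ ξ φ -> isC b κ ξ (lift c i φ).
Proof.
intros Hi. apply isC_ind_all.
- intros b p Hp. apply isC_zero. destruct c; simpl; auto.
- intros b ξ ks ψ _ IH. rewrite lift_Qs. now apply isC_succ.
- intros b ξ f L _ IH F2 P2.
  assert (F2' := finite_sub _ _ _ (finite_or _ _ _ (finite_list _ (1 :: nil)) F2)
    (fun n H => match free2_lift c i (Big b ξ f) n H with
       | or_introl e => or_introl (or_introl (eq_sym e)) | or_intror h => or_intror h end)).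
  assert (P2' := finite_sub _ _ _ P2 (par2_lift c i (Big b ξ f))).
  rewrite lift_Big in *. apply isC_limit; auto.
Qed.

Lemma satF_lift δ F c i s : F empty -> forall κ b ξ φ, isC b κ ξ φ -> nogap φ ->
  forall S, satF δ F (lift c i φ) s S <-> gate c (i ∈ S 1) (satF δ F φ s S).
Proof.
intros F0 κ b ξ φ H. pattern b, ξ, φ. revert b ξ φ H. apply isC_ind_all.
- intros _ p _ _ S. destruct c; simpl; tauto.
- intros b ξ ks ψ _ IH N S. apply nogap_Qs in N. destruct N as [N1 N2].
  rewrite lift_Qs, satF_Qs, (gate_iff c _ _ _ (satF_Qs b δ F ks ψ s S)), <- gate_quant.
  + apply quant_iff. intros S' E. rewrite IH by auto.
    destruct (E 1) as [_ E1]. rewrite (E1 N1). tauto.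
  + exists (fun k => if in_dec Nat.eq_dec k ks then empty else S k). intros k. split.
    * intros Hk x Hx. destruct in_dec; [|tauto]. destruct (in_empty _ Hx).
    * intros Hk. destruct in_dec; tauto.
- intros b ξ f L _ IH _ _ N S.
  rewrite lift_Big, satF_Big, (gate_iff c _ _ _ (satF_Big b δ F ξ f s S)), <- gate_quant.
  + apply quant_iff. intros j [Hj Fj]. apply IH; auto. rewrite nogap_Big in N. auto.
  + exists empty. split; auto. now apply limit_empty.
Qed.

Section Raise.
Context (κ ξ : V) (ι : V -> V).
Hypothesis Oξ : ordinal ξ.
Hypothesis Hι : forall k, k ∈ ξ -> ι k ∈ V_ κ.
Hypothesis Inj : forall i j, i ∈ ξ -> j ∈ ξ -> ι i = ι j -> i = j.

(** What raising needs to know of a coherent index set. The full index set over [κ] satisfies it as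
    well, so truth before reflection and truth after it are handled together. *)
Definition good (δ : V) (F : V -> Prop) : Prop :=
  F empty /\ (forall k, succ k ∈ ξ -> F k -> F (succ k)) /\ (forall k, F (succ k) -> F k) /\
  (forall k, k ∈ ξ -> (F k <-> ι k ∈ V_ δ)).

(** Raising may turn a formula of level [a] into one member of a connective, at index [a] or
    [a + 1]; the two stay equivalent only where [a] survives. *)
Definition equiv (a : V) (φ φ' : form) : Prop :=
  (forall n, free1 φ' n -> free1 φ n) /\ (forall n, free2 φ' n -> free2 φ n) /\
  forall δ F, good δ F -> (a ∈ ξ -> F a) ->
    forall s S, satF δ F φ' s S <-> satF δ F φ s S.

Definition TTb (c : bool) : fo := if c then TT else FNot TT.

Lemma satF_TTb δ F c k b d s S : F empty -> ordinal k ->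
  satF δ F (G (fun _ _ _ => TTb c) (fun _ => empty) k b d nil) s S <-> c = true.
Proof.
intros F0 Ok. apply satF_G_const; auto. intros S'. destruct c; simpl; [tauto|].
split; [|discriminate]. intros H. destruct H. tauto.
Qed.

Lemma isC_TTb c k b d : ordinal k ->
  let φ := G (fun _ _ _ => TTb c) (fun _ => empty) k b d nil in
  isC b κ k φ /\ sentence φ /\ (forall A, ~ par2 φ A).
Proof.
intros Ok. destruct (isC_const b κ (TTb c) k d) as [H1 [H2 H3]]; auto.
- destruct c; simpl; auto.
- destruct c; simpl; intros n [H [K|K]]; congruence.
- destruct c; simpl; tauto.
- split; auto. split; auto. intros A HA. apply H3 in HA. destruct c; simpl in HA; tauto.
Qed.

Definition touch (I : V) : fo := FEx 0 (FAnd (FIn (var 0) (var 1)) (FIn (var 0) (par I))).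

Lemma sat_touch δ I s S : fo_sat δ (fo_cut δ (touch I)) s S <->
  exists x, x ∈ V_ δ /\ x ∈ S 1 /\ x ∈ I.
Proof.
change (fo_cut δ (touch I)) with (touch (inter I (V_ δ))).
unfold touch. rewrite sat_ex. split; intros [x [Hx H]]; exists x; revert H; simpl;
  rewrite upd_eq, in_inter; tauto.
Qed.

(* The one step at which raising the level is not a matter of empty quantifier blocks:
   [⋀_k ψ_k] is equivalent to [∀ X, X ∩ I = ∅ ∨ ⋁_k (ι k ∈ X ∧ ψ_k)], with [I] the set of all
   [ι k]; the disjunct for [k] has index [k + 1]. *)
Lemma raise_limit c λ f : limit λ -> λ ⊆ ξ -> (forall k, k ∈ λ -> isC c κ k (f k)) ->
  nogap (Big c λ f) -> finitely_many (free2 (Big c λ f)) ->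
  finitely_many (par2 (Big c λ f)) ->
  exists φ', isC c κ (succ λ) φ' /\ equiv λ (Big c λ f) φ'.
Proof.
intros Lλ Sλ D N F2 P2. rewrite nogap_Big in N.
assert (Oλ := proj1 Lλ).
set (I := img λ ι).
set (q := if c then FNot (touch I) else touch I).
assert (HI : I ⊆ V_ κ).
{ intros x Hx. apply in_img in Hx. destruct Hx as [k [Hk ->]]. auto. }
(* The new connective has the opposite polarity. A formula of level k acquires that polarity at
   level k + 1, through an empty block, whence the shift. Index 0 is free for the first-order test
   [q], and the limit indices receive the neutral truth value. *)
assert (Hg : forall j, j ∈ λ -> exists χ,
  (j = empty -> χ = FO q) /\ (forall k, j = succ k -> χ = lift (negb c) (ι k) (f k)) /\
  (limit j -> χ = G (fun _ _ _ => TTb (negb c)) (fun _ => empty) j (negb c) 1 nil)).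
{ intros j Hj. destruct (ord_cases j (ord_mem _ _ Oλ Hj)) as [->|[[k [Ok ->]]|L]].
  - exists (FO q). split; auto. split.
    + intros k E. symmetry in E. destruct (succ_not_empty _ E).
    + intros [_ [K _]]. tauto.
  - eexists. split; [|split; [intros k' E; apply succ_inj in E; subst; reflexivity|]].
    + intros E. destruct (succ_not_empty _ E).
    + intros L. destruct (limit_not_succ _ L).
  - eexists. split; [|split; [|intros _; reflexivity]].
    + intros E. destruct L as [_ [K _]]. tauto.
    + intros k ->. destruct (limit_not_succ _ L). }
destruct (family_choice V form (FO TT) (fun j => j ∈ λ) _ Hg) as [χ Hχ]. clear Hg.
assert (Cases : forall j, j ∈ λ -> (j = empty /\ χ j = FO q) \/
  (exists k, j = succ k /\ k ∈ λ /\ χ j = lift (negb c) (ι k) (f k)) \/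
  (limit j /\ χ j = G (fun _ _ _ => TTb (negb c)) (fun _ => empty) j (negb c) 1 nil)).
{ intros j Hj. destruct (Hχ j Hj) as [H1 [H2 H3]].
  destruct (ord_cases j (ord_mem _ _ Oλ Hj)) as [E|[[k [Ok E]]|L]]; auto.
  right. left. exists k. split; auto. split; auto. apply (ord_trans λ j); auto.
  rewrite E. apply mem_succ. }
assert (Iχ : forall j, j ∈ λ -> isC (negb c) κ j (χ j)).
{ intros j Hj. destruct (Cases j Hj) as [[-> ->]|[[k [-> [Hk ->]]]|[L ->]]].
  - apply isC_zero. destruct c; simpl; auto.
  - assert (K := isC_succ (negb c) κ k nil (lift (negb c) (ι k) (f k))).
    rewrite Bool.negb_involutive in K.
    assert (K' : isC c κ k (lift (negb c) (ι k) (f k))) by (apply isC_lift; auto).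
    destruct c; apply (K K').
  - apply isC_TTb. apply L. }
assert (Fχ : forall n, free2 (Big (negb c) λ χ) n -> n = 1 \/ free2 (Big c λ f) n).
{ intros n Hn. apply free2_Big in Hn. destruct Hn as [j [Hj Hn]].
  destruct (Cases j Hj) as [[-> E]|[[k [-> [Hk E]]]|[L E]]]; rewrite E in Hn.
  - left. destruct c; simpl in Hn; intuition congruence.
  - apply free2_lift in Hn. destruct Hn as [Hn|Hn]; auto. right. apply free2_Big. eauto.
  - exfalso. revert Hn. apply isC_TTb. apply L. }
assert (Pχ : forall A, par2 (Big (negb c) λ χ) A -> A = I \/ par2 (Big c λ f) A).
{ intros n Hn. apply par2_Big in Hn. destruct Hn as [j [Hj Hn]].
  destruct (Cases j Hj) as [[-> E]|[[k [-> [Hk E]]]|[L E]]]; rewrite E in Hn.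
  - left. destruct c; simpl in Hn; intuition congruence.
  - apply par2_lift in Hn. right. apply par2_Big. eauto.
  - exfalso. revert Hn. apply isC_TTb. apply L. }
exists (Qs c (1 :: nil) (Big (negb c) λ χ)). split; [|split; [|split]].
- apply isC_succ. apply isC_limit; auto.
  + apply (finite_sub _ _ _ (finite_or _ _ _ (finite_list _ (1 :: nil)) F2)).
    intros n Hn. apply Fχ in Hn. simpl. intuition.
  + apply (finite_sub _ _ _ (finite_or _ _ _ (finite_list _ (I :: nil)) P2)).
    intros n Hn. apply Pχ in Hn. simpl. intuition.
- intros n. rewrite free1_Qs, !free1_Big. intros [j [Hj Hn]].
  destruct (Cases j Hj) as [[-> E]|[[k [-> [Hk E]]]|[L E]]]; rewrite E in Hn.
  + destruct c; simpl in Hn; intuition congruence.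
  + apply free1_lift in Hn. eauto.
  + exfalso. revert Hn. apply isC_TTb. apply L.
- intros n. rewrite free2_Qs. intros [H1 H2]. apply Fχ in H2. simpl in H1.
  intuition congruence.
- intros δ F [F0 [FS [FP Fι]]] _ s S.
  assert (Hup : forall X k, k ∈ λ -> satF δ F (f k) s (upd S 1 X) <-> satF δ F (f k) s S).
  { intros X k Hk. split; apply satF_nogap; auto; intros m Hm;
      now rewrite upd_neq. }
  assert (Hlift : forall X k, k ∈ λ -> satF δ F (lift (negb c) (ι k) (f k)) s (upd S 1 X)
    <-> gate (negb c) (ι k ∈ X) (satF δ F (f k) s S)).
  { intros X k Hk. rewrite (satF_lift δ F (negb c) (ι k) s F0 κ c k (f k)); auto.
    rewrite upd_eq. apply gate_iff. auto. }
  assert (Hsing : forall k, k ∈ λ -> F k -> upair (ι k) (ι k) ⊆ V_ δ).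
  { intros k Hk Fk x Hx. apply in_upair in Hx. apply Fι in Fk; auto.
    destruct Hx as [->| ->]; auto. }
  assert (Hsing' : forall k k', k ∈ λ -> k' ∈ λ -> ι k' ∈ upair (ι k) (ι k) -> k' = k).
  { intros k k' Hk Hk' H. apply in_upair in H. apply Inj; auto. tauto. }
  rewrite satF_Big. destruct c; simpl.
  + split.
    (* The singleton of ι k meets [I] and contains no other label, so only the disjunct belonging to
       k can hold. *)
    * intros H k [Hk Fk]. destruct (H _ (Hsing k Hk Fk)) as [j [Hj [Fj Sj]]].
      destruct (Cases j Hj) as [[-> E]|[[k' [-> [Hk' E]]]|[L E]]]; rewrite E in Sj.
      -- change (~ fo_sat δ (fo_cut δ (touch I)) s (upd S 1 (upair (ι k) (ι k)))) in Sj.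
         rewrite sat_touch, upd_eq in Sj. destruct Sj. exists (ι k).
         split; [apply Fι; auto|]. split; [apply in_upair; auto|]. apply in_img. eauto.
      -- apply Hlift in Sj; auto. simpl in Sj. destruct Sj as [S1 S2].
         apply Hsing' in S1; auto. now subst.
      -- apply satF_TTb in Sj; auto; [discriminate|apply L].
    * intros H X HX. destruct (classic (exists x, x ∈ V_ δ /\ x ∈ X /\ x ∈ I))
        as [[x [Vx [Hx Ix]]]|NI].
      -- apply in_img in Ix. destruct Ix as [k [Hk ->]].
         assert (Fk : F k) by (apply Fι; auto).
         assert (Sk : succ k ∈ λ) by now apply Lλ.
         exists (succ k). split; auto. split; [now apply FS; auto|].
         destruct (Hχ (succ k) Sk) as [_ [E _]]. rewrite (E k eq_refl).
         apply Hlift; auto. simpl. split; auto.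
      -- exists empty. assert (H0 := limit_empty λ Lλ). split; auto. split; auto.
         destruct (Hχ empty H0) as [E _]. rewrite (E eq_refl).
         change (~ fo_sat δ (fo_cut δ (touch I)) s (upd S 1 X)).
         rewrite sat_touch, upd_eq. auto.
  + split.
    * intros [X [HX H]]. assert (H0 := limit_empty λ Lλ).
      assert (T := H empty H0 F0). destruct (Hχ empty H0) as [E _].
      rewrite (E eq_refl) in T. simpl in T. apply sat_touch in T.
      rewrite upd_eq in T. destruct T as [x [Vx [Hx Ix]]].
      apply in_img in Ix. destruct Ix as [k [Hk ->]].
      assert (Fk : F k) by (apply Fι; auto).
      assert (Sk : succ k ∈ λ) by now apply Lλ.
      specialize (H (succ k) Sk (FS k (Sλ _ Sk) Fk)).
      destruct (Hχ (succ k) Sk) as [_ [E' _]]. rewrite (E' k eq_refl) in H.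
      apply Hlift in H; auto. exists k. split; auto.
    * intros [k [[Hk Fk] H]]. exists (upair (ι k) (ι k)). split; auto.
      intros j Hj Fj. destruct (Cases j Hj) as [[-> E]|[[k' [-> [Hk' E]]]|[L E]]]; rewrite E.
      -- apply sat_touch. rewrite upd_eq. exists (ι k).
         split; [apply Fι; auto|]. split; [apply in_upair; auto|]. apply in_img. eauto.
      -- apply Hlift; auto. simpl. intros Hi. apply Hsing' in Hi; auto. now subst.
      -- apply satF_TTb; auto. apply L.
Qed.

Lemma equiv_Qs c ks a a' ψ ψ' : (a' ∈ ξ -> a ∈ ξ -> forall δ F, good δ F -> F a' -> F a) ->
  a ∈ ξ -> a' ∈ ξ -> equiv a ψ ψ' -> equiv a' (Qs c ks ψ) (Qs c ks ψ').
Proof.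
intros H Ha Ha' [E1 [E2 E3]]. split; [|split].
- intros n. rewrite !free1_Qs. auto.
- intros n. rewrite !free2_Qs. intros [K1 K2]. auto.
- intros δ F Gd Fa s S. rewrite !satF_Qs. apply quant_iff. intros S' _. apply E3; auto.
  intros _. apply (H Ha' Ha δ F); auto.
Qed.

(** Blocks alternate, so an empty block in front would change the polarity. The gain of one level is
    made underneath the finite string of blocks instead, where it is an empty block at level 0 and
    [raise_limit] at a limit. *)
Lemma raise_succ c a φ : isC c κ a φ -> nogap φ -> a ∈ ξ ->
  exists φ', isC c κ (succ a) φ' /\ equiv a φ φ'.
Proof.
intros H. pattern c, a, φ. revert c a φ H. apply isC_ind_all.
- intros c p Hp N Ha. exists (Qs c nil (FO p)). split.
  + apply isC_succ, isC_zero, Hp.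
  + replace (Qs c nil (FO p)) with (FO p) by now destruct c.
    split; auto. split; auto. tauto.
- intros c a ks ψ _ IH N Ha. apply nogap_Qs in N. destruct N as [N1 N2].
  assert (Ha' : a ∈ ξ) by (apply (ord_trans ξ (succ a)); auto using mem_succ).
  destruct (IH N2 Ha') as [ψ' [I E]]. exists (Qs c ks ψ'). split.
  + now apply isC_succ.
  + apply (equiv_Qs c ks a); auto. intros _ _ δ F [_ [_ [FP _]]]. apply FP.
- intros c λ f L D _ F2 P2 N Ha. apply raise_limit; auto.
  intros x Hx. now apply (ord_trans ξ λ).
Qed.

Lemma isC_nil c a φ : isC c κ a φ -> isC (negb c) κ (succ a) φ.
Proof.
intros H. assert (K := isC_succ (negb c) κ a nil φ). rewrite Bool.negb_involutive in K.
specialize (K H). now destruct c.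
Qed.

(** The target polarity [c'] is arbitrary because the successor step alternates polarities. At a
    limit the formula becomes one member of a connective whose other members are neutral. *)
Lemma raise η : ordinal η -> η ∈ ξ \/ η = ξ ->
  forall a, a ∈ η -> forall c φ, isC c κ a φ -> nogap φ ->
  forall c', exists φ', isC c' κ η φ' /\ equiv a φ φ'.
Proof.
intros Oη. pattern η. apply ord_rect; auto; clear η Oη.
- intros _ a Ha. destruct (in_empty _ Ha).
- intros η Oη IH Hη a Ha c φ H N c'.
  assert (Hη' : η ∈ ξ).
  { destruct Hη as [Hη|<-]; [|apply mem_succ].
    apply (ord_trans ξ (succ η)); auto using mem_succ. }
  apply in_succ in Ha. destruct Ha as [Ha| ->].
  + destruct (IH (or_introl Hη') a Ha c φ H N (negb c')) as [φ' [I E]].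
    exists φ'. split; auto. apply isC_nil in I. now rewrite Bool.negb_involutive in I.
  + destruct (Bool.bool_dec c' c) as [->|Nc].
    * apply raise_succ; auto.
    * exists φ. split; [|split; [|split]]; auto; [|tauto].
      replace c' with (negb c) by (destruct c, c'; tauto). now apply isC_nil.
- intros η Lη _ Hη a Ha c φ H N c'.
  assert (Sη : η ⊆ ξ).
  { intros x Hx. destruct Hη as [Hη|<-]; auto. now apply (ord_trans ξ η). }
  (* Members share the polarity of their connective; a formula of the wrong polarity is moved up one
     index by an empty block. *)
  assert (Ht : exists t, t ∈ η /\ isC c' κ t φ /\
     (forall δ F, good δ F -> F a -> F t)).
  { destruct (Bool.bool_dec c' c) as [->|Nc].
    - exists a. auto.
    - exists (succ a). assert (Sa : succ a ∈ η) by now apply Lη.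
      split; auto. split.
      + replace c' with (negb c) by (destruct c, c'; tauto). now apply isC_nil.
      + intros δ F [_ [FS _]] Fa. apply FS; auto. }
  destruct Ht as [t [Ht [It Ft]]].
  set (f := fun j => if excluded_middle_informative (j = t) then φ
    else G (fun _ _ _ => TTb c') (fun _ => empty) j c' 1 nil).
  assert (Hf : forall j, j ∈ η -> (j = t /\ f j = φ) \/
    (j <> t /\ f j = G (fun _ _ _ => TTb c') (fun _ => empty) j c' 1 nil)).
  { intros j Hj. unfold f. destruct excluded_middle_informative; auto. }
  assert (Oj : forall j, j ∈ η -> ordinal j).
  { intros j Hj. apply (ord_mem η); auto. apply Lη. }
  assert (F2 : forall n, free2 (Big c' η f) n -> free2 φ n).
  { intros n Hn. apply free2_Big in Hn. destruct Hn as [j [Hj Hn]].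
    destruct (Hf j Hj) as [[_ E]|[_ E]]; rewrite E in Hn; auto.
    exfalso. revert Hn. apply isC_TTb. auto. }
  exists (Big c' η f). split; [|split; [|split]]; auto.
  + destruct (isC_finite _ _ _ _ H) as [Fin1 Fin2]. apply isC_limit; auto.
    * intros j Hj. destruct (Hf j Hj) as [[-> ->]|[_ ->]]; auto. apply isC_TTb. auto.
    * exact (finite_sub _ _ _ Fin1 F2).
    * apply (finite_sub _ _ _ Fin2). intros A HA. apply par2_Big in HA.
      destruct HA as [j [Hj HA]]. destruct (Hf j Hj) as [[_ E]|[_ E]]; rewrite E in HA; auto.
      exfalso. revert HA. apply isC_TTb. auto.
  + intros n Hn. apply free1_Big in Hn. destruct Hn as [j [Hj Hn]].
    destruct (Hf j Hj) as [[_ E]|[_ E]]; rewrite E in Hn; auto.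
    exfalso. revert Hn. apply isC_TTb. auto.
  + intros δ F Gd Fa s S. assert (F0 := proj1 Gd).
    assert (Fa' := Ft δ F Gd (Fa (Sη _ Ha))).
    rewrite satF_Big. assert (Et : f t = φ) by (destruct (Hf t Ht); tauto).
    destruct c'; simpl; split.
    * intros K. rewrite <- Et. apply K. auto.
    * intros K j [Hj Fj]. destruct (Hf j Hj) as [[_ ->]|[_ ->]]; auto.
      apply satF_TTb; auto.
    * intros [j [[Hj Fj] K]]. destruct (Hf j Hj) as [[_ E]|[_ E]]; rewrite E in K; auto.
      apply satF_TTb in K; auto. discriminate.
    * intros K. exists t. rewrite Et. auto.
Qed.

End Raise.

(** * Elementarity on a club *)

(** Assignments of finite support are coded by elements [enc l] of the level, so that a Skolem
    function is a function on that level. *)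
Definition of_list (l : list V) : nat -> V := fun n => nth n l empty.

Lemma of_list_upd l n x : exists l', of_list l' = upd (of_list l) n x /\
  forall y, In y l' -> In y l \/ y = x \/ y = empty.
Proof.
(* Long enough for [l] and for position [n]; a gap in between is filled with the default value
   [empty]. *)
set (m := Nat.max (length l) (S n)).
exists (map (upd (of_list l) n x) (seq 0 m)). split.
- apply functional_extensionality. intros k. unfold of_list at 1.
  destruct (Nat.lt_ge_cases k m) as [H|H].
  + rewrite (nth_indep _ empty (upd (of_list l) n x 0)) by now rewrite length_map, length_seq.
    rewrite map_nth, seq_nth by auto. reflexivity.
  + rewrite nth_overflow by now rewrite length_map, length_seq.
    rewrite upd_neq by lia. unfold of_list. rewrite nth_overflow; auto. lia.
- intros y Hy. apply in_map_iff in Hy. destruct Hy as [k [<- _]].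
  unfold upd. destruct Nat.eq_dec; auto. unfold of_list.
  destruct (Nat.lt_ge_cases k (length l)) as [H|H].
  + left. now apply nth_In.
  + right. right. now apply nth_overflow.
Qed.

Lemma of_list_V γ l n : limit γ -> Forall (fun x => x ∈ V_ γ) l -> of_list l n ∈ V_ γ.
Proof.
intros Lγ H. unfold of_list. destruct (Nat.lt_ge_cases n (length l)) as [K|K].
- rewrite Forall_forall in H. apply H. now apply nth_In.
- rewrite nth_overflow by auto. apply V_empty_mem; apply Lγ.
Qed.

(** The Tarski-Vaught argument for a single formula and fixed sets [S]: one Skolem function for each
    quantifier. *)
Lemma elementary_club δ S : limit δ -> (forall n, S n ⊆ V_ δ) -> forall p,
  club δ (fun γ => forall l, Forall (fun x => x ∈ V_ γ) l ->
    (fo_sat γ (fo_cut γ p) (of_list l) (fun n => inter (S n) (V_ γ)) <->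
     fo_sat δ (fo_cut δ p) (of_list l) S)).
Proof.
intros Lδ HS. assert (Oδ := proj1 Lδ).
induction p as [s t|s t|s X|p IH|p IHp q IHq|n p IH].
- apply club_all. simpl. tauto.
- apply club_all. simpl. tauto.
(* A parameter outside [V_ δ] makes both sides false, so only one inside has to be caught by the
   club. *)
- apply (club_mono δ (fun γ => forall a, s = par a -> a ∈ V_ δ -> a ∈ V_ γ)).
  + destruct s as [m|a].
    * apply club_all. discriminate.
    * destruct (classic (a ∈ V_ δ)) as [Ha|Ha].
      -- apply (club_mono δ (fun γ => a ∈ V_ γ)); [now apply club_const|].
         intros γ _ _ K a' E _. congruence.
      -- apply club_all. intros γ _ _ a' E Ha'. congruence.
  + intros γ Hγ Lγ K l Hl.
    assert (Sub := V_le δ γ Oδ Hγ).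
    assert (M : value (of_list l) s ∈ V_ δ -> value (of_list l) s ∈ V_ γ).
    { destruct s as [m|a]; simpl; eauto. intros _. now apply of_list_V. }
    simpl. destruct X as [k|A]; simpl; rewrite !in_inter.
    * split; [tauto|]. intros H. split; auto. apply M. apply (HS k); auto.
    * split; intros [H1 H2]; auto.
- apply (club_mono δ _ _ IH). intros γ _ _ K l Hl. simpl. rewrite K; tauto.
- apply (club_mono δ _ _ (club_and δ _ _ Lδ IHp IHq)). intros γ _ _ [K1 K2] l Hl. simpl.
  rewrite K1, K2; tauto.
(* [w] sends the code of an assignment to a counterexample to [p], if there is one. *)
- destruct (family_choice V V empty (fun z => z ∈ V_ δ) (fun z x => x ∈ V_ δ /\
    forall l, z = enc l -> (exists y, y ∈ V_ δ /\
      ~ fo_sat δ (fo_cut δ p) (upd (of_list l) n y) S) ->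
    ~ fo_sat δ (fo_cut δ p) (upd (of_list l) n x) S)) as [w Hw].
  { intros z Hz. destruct (classic (exists l y, z = enc l /\ y ∈ V_ δ /\
      ~ fo_sat δ (fo_cut δ p) (upd (of_list l) n y) S)) as [[l [y [E [Hy H]]]]|N].
    - exists y. split; auto. intros l' E' _. rewrite E in E'. apply enc_inj in E'.
      now subst l'.
    - exists empty. split; [apply V_empty_mem; apply Lδ|].
      intros l E [y [Hy H]]. destruct N. eauto. }
  assert (Cw : club δ (closed_at w)).
  { apply club_closed. intros z Hz. now apply Hw. }
  apply (club_mono δ _ _ (club_and δ _ _ Lδ Cw IH)).
  intros γ Hγ Lγ [[_ C] K] l Hl. simpl.
  assert (Sub := V_le δ γ Oδ Hγ).
  assert (U : forall x, x ∈ V_ γ ->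
    (fo_sat γ (fo_cut γ p) (upd (of_list l) n x) (fun n => inter (S n) (V_ γ)) <->
     fo_sat δ (fo_cut δ p) (upd (of_list l) n x) S)).
  { intros x Hx. destruct (of_list_upd l n x) as [l' [E Hl']]. rewrite <- E.
    apply K. apply Forall_forall. rewrite Forall_forall in Hl. intros y Hy.
    destruct (Hl' y Hy) as [H|[->| ->]]; auto. apply V_empty_mem; apply Lγ. }
  split.
  + intros H. apply NNPP. intros N.
    assert (Ex : exists y, y ∈ V_ δ /\ ~ fo_sat δ (fo_cut δ p) (upd (of_list l) n y) S).
    { apply NNPP. intros N'. apply N. intros x Hx. apply NNPP. eauto. }
    assert (Hz : enc l ∈ V_ γ) by (apply enc_V; auto).
    destruct (Hw (enc l)) as [_ W]; [apply Sub; auto|].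
    apply (W l eq_refl Ex). apply U; auto.
  + intros H x Hx. apply U; auto.
Qed.

Lemma club_nonempty δ P x : inacc δ -> club δ P -> x ∈ V_ δ ->
  exists γ, γ ∈ δ /\ limit γ /\ P γ /\ x ∈ V_ γ.
Proof.
intros I [h [Hh K]] Hx. destruct (closed_at_unbounded δ h x I Hh Hx) as [γ [Hγ [C Vx]]].
exists γ. split; auto. split; [apply C|]. auto.
Qed.

(** * The leaves of the universal formula *)

(* [t0] is the variable or parameter [X_0] that codes the formula. *)
Definition tm (t0 : term) (e : nat) : term := match e with 0 => t0 | S _ => var (nm e) end.

Definition unbF (P : V) (X : term) : fo :=
  FAll 1 (FEx 2 (FAnd (FIn (var 2) (par P)) (FAnd (FIn (var 2) X) (FMem (var 1) (var 2))))).

Definition limF (P : V) (X : term) : fo :=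
  FAll 1 (FImp (FMem (var 1) (var 0))
    (FEx 2 (FAnd (FMem (var 2) (var 0)) (FAnd (FIn (var 2) (par P))
      (FAnd (FIn (var 2) X) (FMem (var 1) (var 2))))))).

(** The conjunct on [c] rules out γ = 0. It also places the labels of the path in V_γ, as the
    diagonal intersection in [codes_sat] requires. *)
Definition guardF (P : V) (X : term) (c : V) : fo :=
  FAnd (FIn (var 0) (par P)) (FAnd (limF P X) (FMem (par c) (var 0))).

(* The club of [γ] that witnesses or tests the truth of the leaf consists of the limits of
   the stages belonging to the last set quantified; [X_0] tells in which [V_ γ] the leaf is
   true. *)
Definition leaf (P : V) (t0 : term) (b : bool) (d : nat) (c : list V) : fo :=
  let X := tm t0 (d - 1) in
  let Xs := map (tm t0) (seq 1 (d - 1)) in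
  if b then FAnd (unbF P X) (FAll 0 (FImp (guardF P X (enc c)) (tupF (enc c) t0 Xs)))
  else FImp (unbF P X) (FEx 0 (FAnd (guardF P X (enc c)) (tupF (enc c) t0 Xs))).

(** As a parameter, cut to [V_ δ], it becomes the set of stages below δ; so the hierarchy never has
    to be defined by a formula. *)
Definition stages (κ : V) : V := img κ V_.

Lemma in_stages κ x : x ∈ stages κ <-> exists γ, γ ∈ κ /\ x = V_ γ.
Proof. apply in_img. Qed.

Section Leaf.
Context (κ δ : V) (s S : nat -> V).
Hypothesis Oκ : ordinal κ.
Hypothesis Lδ : limit δ.
Hypothesis Hδ : δ ∈ κ \/ δ = κ.

Let P := inter (stages κ) (V_ δ).

Lemma in_cut_stages x : x ∈ P <-> exists γ, γ ∈ δ /\ x = V_ γ.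
Proof.
unfold P. rewrite in_inter, in_stages. split.
- intros [[γ [Hγ ->]] H]. exists γ. split; auto. apply V_mem_ord; auto; [apply Lδ|].
  now apply (ord_mem κ).
- intros [γ [Hγ ->]]. split.
  + exists γ. split; auto. destruct Hδ as [H|<-]; auto. now apply (ord_trans κ δ).
  + now apply V_in.
Qed.

Lemma sat_unbF X : fo_sat δ (unbF P X) s S <-> limpt (value S X) δ.
Proof.
unfold unbF. rewrite sat_all. split.
- intros H x Hx. specialize (H x Hx). apply sat_ex in H. destruct H as [v [Hv H]].
  simpl in H. unfold upd in H. simpl in H. rewrite in_cut_stages in H.
  destruct H as [[γ [Hγ ->]] [H1 H2]]. exists γ. auto.
- intros H x Hx. apply sat_ex. destruct (H x Hx) as [γ [Hγ [H1 H2]]].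
  exists (V_ γ). split; [now apply V_in|]. simpl. unfold upd. simpl.
  rewrite in_cut_stages. eauto.
Qed.

Lemma sat_limF X γ : γ ∈ δ -> fo_sat δ (limF P X) (upd s 0 (V_ γ)) S <-> limpt (value S X) γ.
Proof.
intros Hγ. assert (Oδ := proj1 Lδ). assert (Oγ := ord_mem _ _ Oδ Hγ).
unfold limF. rewrite sat_all.
assert (M : forall x, fo_sat δ (FMem (var 1) (var 0)) (upd (upd s 0 (V_ γ)) 1 x) S <->
  x ∈ V_ γ) by (intros x; simpl; unfold upd; simpl; tauto).
split.
- intros H x Hx. specialize (H x (V_le δ γ Oδ Hγ x Hx)). rewrite sat_imp, M in H.
  specialize (H Hx).
  apply sat_ex in H. destruct H as [v [Hv H]].
  simpl in H. unfold upd in H. simpl in H. rewrite in_cut_stages in H.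
  destruct H as [H0 [[β [Hβ ->]] [H1 H2]]]. exists β. split; auto.
  apply V_mem_ord; auto. now apply (ord_mem δ).
- intros H x Hx. rewrite sat_imp, M. intros Kx.
  apply sat_ex. destruct (H x Kx) as [β [Hβ [H1 H2]]].
  assert (Hβ' : β ∈ δ) by now apply (ord_trans δ γ).
  exists (V_ β). split; [now apply V_in|]. simpl. unfold upd. simpl.
  rewrite in_cut_stages. split; [now apply V_in|]. eauto.
Qed.

Lemma sat_guardF X c v : v ∈ V_ δ -> (fo_sat δ (guardF P X c) (upd s 0 v) S <->
  exists γ, γ ∈ δ /\ v = V_ γ /\ limpt (value S X) γ /\ c ∈ V_ γ).
Proof.
intros Hv. unfold guardF. rewrite !sat_and.
assert (M : fo_sat δ (FIn (var 0) (par P)) (upd s 0 v) S <-> v ∈ P)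
  by (simpl; rewrite upd_eq; tauto).
rewrite M, in_cut_stages. split.
- intros [[γ [Hγ ->]] [H1 H2]]. exists γ. rewrite sat_limF in H1 by auto.
  simpl in H2. rewrite upd_eq in H2. auto.
- intros [γ [Hγ [-> [H1 H2]]]]. split; [eauto|]. split; [now apply sat_limF|].
  simpl. now rewrite upd_eq.
Qed.

Definition truth (c X0 : V) (Xs : list V) (γ : V) : Prop :=
  enc (c :: V_ γ :: map (fun X => inter X (V_ γ)) Xs) ∈ X0.

(** If [b] is [true], the last set was quantified existentially, or is the code itself, and has to
    exhibit a club of stages where the leaf is true. If [b] is [false], it was quantified
    universally: whatever club it offers must contain a true stage. *)
Definition leaf_truth (b : bool) (c X0 Xl : V) (Xs : list V) : Prop :=
  if b then limpt Xl δ /\ forall γ, γ ∈ δ -> limpt Xl γ -> c ∈ V_ γ -> truth c X0 Xs γ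
  else limpt Xl δ -> exists γ, γ ∈ δ /\ limpt Xl γ /\ c ∈ V_ γ /\ truth c X0 Xs γ.

Lemma truth_V c Xs γ : γ ∈ δ -> c ∈ V_ γ ->
  enc (c :: V_ γ :: map (fun X => inter X (V_ γ)) Xs) ∈ V_ δ.
Proof.
intros Hγ Hc. apply enc_V; auto. constructor; [|constructor].
- apply (V_le δ γ); auto. apply Lδ.
- now apply V_in.
- apply Forall_forall. intros y Hy. apply in_map_iff in Hy. destruct Hy as [X [<- _]].
  apply (V_sub_mem δ γ); auto. apply inter_sub_r.
Qed.

Lemma sat_tupF_truth c T Xs γ : γ ∈ δ -> c ∈ V_ γ ->
  fo_sat δ (tupF c T Xs) (upd s 0 (V_ γ)) S <->
  truth c (value S T) (map (value S) Xs) γ.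
Proof.
intros Hγ Hc. unfold truth. rewrite map_map.
assert (E0 : upd s 0 (V_ γ) 0 = V_ γ) by apply upd_eq.
rewrite sat_tupF.
- rewrite E0. cbv zeta. split; [tauto|]. intros H. split; auto.
  rewrite <- (map_map (value S) (fun X => inter X (V_ γ))). now apply truth_V.
- apply Lδ.
- rewrite E0. now apply V_in.
- apply (V_le δ γ); auto. apply Lδ.
Qed.

Definition hist (t0 : term) (e : nat) : V := value S (cut_term δ (tm t0 e)).

Lemma sat_leaf t0 b d c :
  fo_sat δ (fo_cut δ (leaf (stages κ) t0 b d c)) s S <->
  leaf_truth b (enc c) (hist t0 0) (hist t0 (d - 1)) (map (hist t0) (seq 1 (d - 1))).
Proof.
assert (E : fo_cut δ (leaf (stages κ) t0 b d c) =
  let X := cut_term δ (tm t0 (d - 1)) in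
  let T := tupF (enc c) (cut_term δ t0) (map (fun e => cut_term δ (tm t0 e)) (seq 1 (d - 1))) in
  if b then FAnd (unbF P X) (FAll 0 (FImp (guardF P X (enc c)) T))
  else FImp (unbF P X) (FEx 0 (FAnd (guardF P X (enc c)) T))).
{ cbv zeta. rewrite <- (map_map (tm t0) (cut_term δ)), <- fo_cut_tupF. now destruct b. }
rewrite E. cbv zeta. clear E. set (T := tupF _ _ _).
assert (HT : forall γ, γ ∈ δ -> enc c ∈ V_ γ -> (fo_sat δ T (upd s 0 (V_ γ)) S <->
  truth (enc c) (hist t0 0) (map (hist t0) (seq 1 (d - 1))) γ)).
{ intros γ Hγ Hc. unfold T. rewrite sat_tupF_truth, map_map by auto. reflexivity. }
destruct b; simpl leaf_truth.
- rewrite sat_and, sat_unbF, sat_all. fold (hist t0 (d - 1)). split.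
  + intros [H1 H2]. split; auto. intros γ Hγ Lγ Hc.
    assert (Vγ := V_in δ γ Hγ). specialize (H2 _ Vγ). rewrite sat_imp, sat_guardF in H2 by auto.
    apply HT; auto. apply H2. exists γ. auto.
  + intros [H1 H2]. split; auto. intros v Vv. rewrite sat_imp, sat_guardF by auto.
    intros [γ [Hγ [-> [Lγ Hc]]]]. apply HT; auto.
- rewrite sat_imp, sat_unbF. fold (hist t0 (d - 1)). split.
  + intros H Lm. specialize (H Lm). apply sat_ex in H. destruct H as [v [Vv H]].
    rewrite sat_and, sat_guardF in H by auto. destruct H as [[γ [Hγ [-> [Lγ Hc]]]] H].
    exists γ. apply HT in H; auto.
  + intros H Lm. destruct (H Lm) as [γ [Hγ [Lγ [Hc Ht]]]]. apply sat_ex.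
    exists (V_ γ). assert (Vγ := V_in δ γ Hγ). split; auto.
    rewrite sat_and, sat_guardF by auto. split; [eauto|]. apply HT; auto.
Qed.

End Leaf.

Definition leaf_names (t0 : term) (d n : nat) : Prop :=
  (exists e, 1 <= e < d /\ n = nm e) \/ t0 = var n.

Lemma tm_var t0 e n : tm t0 e = var n -> (1 <= e /\ n = nm e) \/ t0 = var n.
Proof. destruct e; simpl; intros E; auto. left. split; [lia|]. congruence. Qed.

Lemma tm_par t0 e A : tm t0 e = par A -> t0 = par A.
Proof. destruct e; simpl; auto. discriminate. Qed.

Lemma free2_leaf P t0 b d c n : fo_free2 (leaf P t0 b d c) n -> leaf_names t0 d n.
Proof.
intros H.
assert (K : tm t0 (d - 1) = var n \/ fo_free2 (tupF (enc c) t0 (map (tm t0) (seq 1 (d - 1)))) n).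
{ destruct b; cbn -[tupF tm] in H; intuition congruence. }
destruct K as [K|K].
- apply tm_var in K. destruct K as [[K1 K2]|K]; [left|right; auto].
  exists (d - 1). split; auto. lia.
- apply free2_tupF in K. destruct K as [K|K]; [right; auto|].
  apply in_map_iff in K. destruct K as [e [E He]]. apply in_seq in He.
  apply tm_var in E. destruct E as [[K1 K2]|K]; [left|right; auto].
  exists e. split; auto. lia.
Qed.

Lemma par2_leaf P t0 b d c A : fo_par2 (leaf P t0 b d c) A -> A = P \/ t0 = par A.
Proof.
intros H.
assert (K : A = P \/ tm t0 (d - 1) = par A \/
  fo_par2 (tupF (enc c) t0 (map (tm t0) (seq 1 (d - 1)))) A).
{ destruct b; cbn -[tupF tm] in H; intuition congruence. }
destruct K as [K|[K|K]]; auto.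
- apply tm_par in K. auto.
- apply par2_tupF in K. destruct K as [K|K]; auto.
  apply in_map_iff in K. destruct K as [e [E He]]. apply tm_par in E. auto.
Qed.

Lemma free1_leaf P t0 b d c n : ~ fo_free1 (leaf P t0 b d c) n.
Proof.
assert (T : fo_free1 (tupF (enc c) t0 (map (tm t0) (seq 1 (d - 1)))) n -> n = 0).
{ apply free1_tupF. }
destruct b; cbn -[tupF tm]; intuition congruence.
Qed.

Lemma fo_over_leaf κ P t0 b d c : empty ∈ V_ κ -> limit κ -> Forall (fun x => x ∈ V_ κ) c ->
  P ⊆ V_ κ -> par2_over κ t0 -> fo_over κ (leaf P t0 b d c).
Proof.
intros H0 Lκ Hc HP Ht.
assert (Hc' : enc c ∈ V_ κ) by (apply enc_V; auto).
assert (Htm : forall e, par2_over κ (tm t0 e)) by (intros [|e]; simpl; auto).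
assert (T : fo_over κ (tupF (enc c) t0 (map (tm t0) (seq 1 (d - 1))))).
{ apply fo_over_tupF; auto. apply Forall_forall. intros X HX. apply in_map_iff in HX.
  destruct HX as [e [<- _]]. auto. }
destruct b; cbn -[tupF tm];
  repeat match goal with |- _ /\ _ => split end; auto; apply Htm.
Qed.

(** * Codes of formulas *)

(** A whole block of quantifiers is matched by one quantifier of the tree, whose set carries the
    sets of the block in its slots. *)
Definition slot (k : nat) (A : V) : V :=
  sep (bigcup (bigcup A)) (fun x => opair (num k) x ∈ A).

Lemma in_slot k A x : x ∈ slot k A <-> opair (num k) x ∈ A.
Proof.
unfold slot. rewrite in_sep. split; [tauto|]. intros H. split; auto.
apply in_bigcup. exists (upair (num k) x). split; [|apply in_upair; auto].
apply in_bigcup. exists (opair (num k) x). split; auto. apply in_upair. auto.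
Qed.

Lemma slot_cut k A γ : limit γ -> slot k (inter A (V_ γ)) = inter (slot k A) (V_ γ).
Proof.
intros Lγ. apply extensionality. intros x. rewrite in_slot, !in_inter, in_slot, opair_V by auto.
assert (H := num_V γ k Lγ). tauto.
Qed.

Lemma slot_V k A δ : limit δ -> A ⊆ V_ δ -> slot k A ⊆ V_ δ.
Proof.
intros Lδ H x Hx. rewrite in_slot in Hx. apply H, opair_V in Hx; tauto.
Qed.

(* [env k] is the depth at which the variable [k] was quantified, [0] if it was not. *)
Definition dec (env : nat -> nat) (S : nat -> V) : nat -> V :=
  fun k => match env k with 0 => empty | Datatypes.S e => slot k (S (nm (Datatypes.S e))) end.

Definition ext (env : nat -> nat) (d : nat) (ks : list nat) : nat -> nat :=
  fun k => if in_dec Nat.eq_dec k ks then d else env k.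

Lemma dec_cut env S γ : limit γ ->
  dec env (fun n => inter (S n) (V_ γ)) = fun n => inter (dec env S n) (V_ γ).
Proof.
intros Lγ. apply functional_extensionality. intros k. unfold dec.
destruct (env k); [|now apply slot_cut]. symmetry. apply inter_id.
intros x Hx. destruct (in_empty x Hx).
Qed.

Lemma dec_V env S δ : limit δ -> (forall n, S n ⊆ V_ δ) -> forall n, dec env S n ⊆ V_ δ.
Proof.
intros Lδ H n. unfold dec. destruct (env n); [|now apply slot_V].
intros x Hx. destruct (in_empty x Hx).
Qed.

Lemma dec_ext env d ks S X : 1 <= d -> (forall n, env n < d) ->
  dec (ext env d ks) (upd S (nm d) X) =
  fun k => if in_dec Nat.eq_dec k ks then slot k X else dec env S k.
Proof.
intros Hd He. apply functional_extensionality. intros k. unfold dec, ext.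
destruct (in_dec Nat.eq_dec k ks).
- destruct d; [lia|]. now rewrite upd_eq.
- specialize (He k). destruct (env k) as [|e]; auto. rewrite upd_neq; auto.
  intros E. apply nm_inj in E. lia.
Qed.

Lemma ext_lt env d ks n : (forall n, env n < d) -> ext env d ks n < S d.
Proof. intros H. unfold ext. specialize (H n). destruct in_dec; lia. Qed.

(** The slots consist of pairs and so leave room for stages: the stages closed under [h] are added
    to the code without disturbing it. *)
Lemma code_sets δ ks S h : inacc δ -> maps (V_ δ) (V_ δ) h -> (forall k, In k ks -> S k ⊆ V_ δ) ->
  exists X, X ⊆ V_ δ /\ (forall k, In k ks -> slot k X = S k) /\ limpt X δ /\
    forall γ, ordinal γ -> γ <> empty -> limpt X γ -> closed_at h γ.
Proof.
intros I Hh HS. assert (Lδ : limit δ) by apply I. assert (Oδ := proj1 Lδ).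
set (X := sep (V_ δ) (fun z => (exists k x, In k ks /\ x ∈ S k /\ z = opair (num k) x) \/
  (exists β, β ∈ δ /\ closed_at h β /\ z = V_ β))).
exists X. split; [|split; [|split]].
- intros z Hz. apply in_sep in Hz. tauto.
- intros k Hk. apply extensionality. intros x. rewrite in_slot. unfold X. rewrite in_sep.
  split.
  + intros [_ [[j [y [Hj [Hy E]]]]|[β [Hβ [_ E]]]]].
    * apply opair_inj in E. destruct E as [E ->]. apply num_inj in E. now subst.
    * apply opair_not_V in E; [tauto|]. now apply (ord_mem δ).
  + intros Hx. split; [|left; eauto]. apply opair_V; auto. split; [now apply num_V|].
    now apply (HS k).
- intros x Hx. destruct (closed_at_unbounded δ h x I Hh Hx) as [β [Hβ [C Vx]]].
  exists β. split; auto. split; auto. apply in_sep. split; [now apply V_in|]. eauto.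
- intros γ Oγ Nγ. apply closed_at_limpt; auto. intros β Oβ Hβ. apply in_sep in Hβ.
  destruct Hβ as [_ [[j [y [Hj [Hy E]]]]|[β' [Hβ' [C E]]]]].
  + symmetry in E. apply opair_not_V in E; tauto.
  + apply V_inj in E; auto; [now subst|]. now apply (ord_mem δ).
Qed.

Section Codes.
Context (α K : V) (F : V -> Prop) (π ι : V -> V).

Definition tuple (d : nat) (c : list V) (S : nat -> V) (γ : V) : V :=
  enc (enc c :: V_ γ :: map (fun e => inter (S (nm e)) (V_ γ)) (seq 1 (d - 1))).

(** The truth of [p] in [V_ γ] is recorded for all possible traces of the quantified sets at once;
    [K] is therefore fixed before any of them is chosen. *)
Definition leaf_code (d : nat) (env : nat -> nat) (c : list V) (p : fo) : Prop :=
  forall γ, γ ∈ α -> limit γ -> enc c ∈ V_ γ -> forall S,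
    (tuple d c S γ ∈ K <->
     fo_sat γ (fo_cut γ p) no_vars (dec env (fun n => inter (S n) (V_ γ)))).

(* [K] codes the formula, at the node [c] of the tree [G]; [π] gives the levels of
   the formula in terms of those of [G]. *)
Inductive Codes : bool -> V -> nat -> (nat -> nat) -> list V -> form -> Prop :=
| Codes_zero b d env c p : leaf_code d env c p -> Codes b empty d env c (FO p)
| Codes_succ b k d env c ks ψ : ordinal k ->
    Codes (negb b) k (S d) (ext env d ks) c ψ -> Codes b (succ k) d env c (Qs b ks ψ)
| Codes_limit b k d env c f : limit k ->
    (forall i, i ∈ k -> F i -> Codes b i d env (ι i :: c) (f (π i))) ->
    Codes b k d env c (Big b (π k) f).

(** [δ] is the level of evaluation, either [α] itself or a reflection point below it. [F'] and [G']
    are the indices that survive there in the tree and in the formula; [π] matches them. *)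
Context (κ δ : V) (F' G' : V -> Prop).
Hypothesis Oκ : ordinal κ.
Hypothesis Oα : ordinal α.
Hypothesis Iδ : inacc δ.
Hypothesis Hδ : δ ∈ κ.
Hypothesis Hδα : δ ∈ α \/ δ = α.
Hypothesis FF' : forall k, F' k -> F k.
Hypothesis FG' : forall k, F k -> (G' (π k) <-> F' k).
Hypothesis Inj : forall i j, F i -> F j -> ι i = ι j -> i = j.
Hypothesis Hι : forall k, F' k -> ι k ∈ V_ δ.
Hypothesis Hπ : forall k, limit k -> forall j, j ∈ π k <-> exists i, i ∈ k /\ F i /\ j = π i.

Definition U := G (leaf (stages κ) (var 0)) ι.

(** Agreement is required on nonempty sequences only, so the code may contain stages in addition. *)
Definition agree (S : nat -> V) : Prop :=
  (forall n, S n ⊆ V_ δ) /\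
  (forall x l, enc (x :: l) ∈ V_ δ -> (enc (x :: l) ∈ S 0 <-> enc (x :: l) ∈ K)).

Lemma agree_upd S d X : 1 <= d -> agree S -> X ⊆ V_ δ -> agree (upd S (nm d) X).
Proof.
intros Hd [H1 H2] HX. split.
- intros n. unfold upd. destruct Nat.eq_dec; auto.
- intros x l. rewrite upd_neq; auto. destruct d; [lia|]. discriminate.
Qed.

(* [A] is the value of the tree and [B] that of the formula; the converse implication
   needs the condition [C] that the last quantified set provides a small enough club. *)
Definition matches (b : bool) (A B C : Prop) : Prop :=
  if b then (A -> B) /\ (B -> C -> A) else (B -> A) /\ (A -> C -> B).

Lemma matches_iff b A A' B B' C : (A <-> A') -> (B <-> B') ->
  matches b A' B' C -> matches b A B C.
Proof. destruct b; simpl; tauto. Qed.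

(** [h] depends on the decoded sets [S0] and not on their code, so a code can afterwards be chosen
    to contain the stages closed under [h]. The unconditional implication needs no choice: two clubs
    always meet. *)
Lemma codes_sat b k d env c φ : Codes b k d env c φ -> 1 <= d -> (forall n, env n < d) ->
  enc c ∈ V_ δ -> forall S0, (forall n, S0 n ⊆ V_ δ) ->
  exists h, maps (V_ δ) (V_ δ) h /\ forall S, agree S -> S0 = dec env S ->
    matches b (satF δ F' (U k b d c) no_vars S) (satF δ G' φ no_vars S0)
      (limpt (S (nm (d - 1))) δ /\
       forall γ, γ ∈ δ -> enc c ∈ V_ γ -> limpt (S (nm (d - 1))) γ -> closed_at h γ).
Proof.
assert (Lδ : limit δ) by apply Iδ. assert (Oδ := proj1 Lδ).
assert (Hδκ : δ ∈ κ \/ δ = κ) by auto.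
assert (V0 : empty ∈ V_ δ) by (apply V_empty_mem; apply Lδ).
assert (Hn : forall n : nat, no_vars n ∈ V_ δ) by (intros n; exact V0).
intros D. induction D as [b d env c p D|b k d env c ks ψ Ok D IH|b k d env c f Lk D IH];
  intros Hd He Hc S0 HS0.
- destruct (elementary_club δ S0 Lδ HS0 p) as [h [Hh El]].
  exists h. split; auto. intros S [HS HK] ES. unfold U. rewrite G_empty. simpl satF.
  refine (matches_iff _ _ _ _ _ _
    (sat_leaf κ δ no_vars S Oκ Lδ Hδκ (var 0) b d c) (iff_refl _) _).
  set (Xl := hist δ S (var 0) (d - 1)).
  assert (EX : S (nm (d - 1)) = Xl) by now destruct (d - 1).
  rewrite EX.
  assert (T : forall γ, γ ∈ δ -> enc c ∈ V_ γ ->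
    truth (enc c) (hist δ S (var 0) 0) (map (hist δ S (var 0)) (seq 1 (d - 1))) γ <->
    tuple d c S γ ∈ K).
  { intros γ Hγ Hcγ. unfold truth. rewrite map_map.
    replace (map (fun x => inter (hist δ S (var 0) x) (V_ γ)) (seq 1 (d - 1)))
      with (map (fun e => inter (S (nm e)) (V_ γ)) (seq 1 (d - 1))).
    2:{ apply map_ext_in. intros e Hin. apply in_seq in Hin. destruct e; [lia|]. reflexivity. }
    apply HK. rewrite <- (map_map (fun e => S (nm e)) (fun X => inter X (V_ γ))).
    apply truth_V; auto. }
  (* At such γ the recorded bit is the truth of [p] in [V_ γ], which by elementarity is its truth in
     [V_ δ]. *)
  assert (Tp : forall γ, γ ∈ δ -> limit γ -> closed_at h γ -> enc c ∈ V_ γ ->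
    (truth (enc c) (hist δ S (var 0) 0) (map (hist δ S (var 0)) (seq 1 (d - 1))) γ <->
     fo_sat δ (fo_cut δ p) no_vars S0)).
  { intros γ Hγ Lγ Cγ Hcγ. rewrite T by auto.
    assert (Hγα : γ ∈ α).
    { destruct Hδα as [H| <-]; auto. now apply (ord_trans α δ). }
    rewrite (D γ Hγα Lγ Hcγ S), dec_cut, <- ES by auto.
    assert (E := El γ Hγ Cγ nil (Forall_nil _)).
    assert (Nil : of_list nil = no_vars).
    { apply functional_extensionality. intros [|n]; reflexivity. }
    rewrite Nil in E. exact E. }
  assert (Ex : limpt Xl δ -> exists γ, γ ∈ δ /\ limit γ /\ (closed_at h γ /\ limpt Xl γ) /\
    enc c ∈ V_ γ).
  { intros Hl. apply club_nonempty; auto. apply club_and; auto.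
    - now apply club_closed.
    - now apply club_limpt. }
  destruct b; simpl.
  + split.
    * intros [Hl H]. destruct (Ex Hl) as [γ [Hγ [Lγ [[Cγ Lmγ] Hcγ]]]].
      apply (Tp γ); auto.
    * intros H [Hl HC]. split; auto. intros γ Hγ Lmγ Hcγ.
      assert (Cγ := HC γ Hγ Hcγ Lmγ). apply Tp; auto. apply Cγ.
  + split.
    * intros H Hl. destruct (Ex Hl) as [γ [Hγ [Lγ [[Cγ Lmγ] Hcγ]]]].
      exists γ. split; auto. split; auto. split; auto. apply Tp; auto.
    * intros H [Hl HC]. destruct (H Hl) as [γ [Hγ [Lmγ [Hcγ Tγ]]]].
      assert (Cγ := HC γ Hγ Hcγ Lmγ). apply (Tp γ); auto. apply Cγ.
(* Behind a quantifier both implications are unconditional, so any function serves: [Co] picks a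
   code with a small club, and [De] decodes an arbitrary set, for which the unconditional
   implication of the inner node is enough. *)
- exists (fun x => x). split; [now intros x Hx|]. intros S Ag ES.
  unfold U. rewrite G_succ. fold U.
  refine (matches_iff _ _ _ _ _ _ (satF_Qs b δ F' _ _ no_vars S)
    (satF_Qs b δ G' ks ψ no_vars S0) _).
  assert (He' : forall n, ext env d ks n < Datatypes.S d) by (intros n; now apply ext_lt).
  assert (IH' := fun S0 HS0 => IH (le_S _ _ Hd) He' Hc S0 HS0).
  replace (Datatypes.S d - 1) with d in IH' by lia.
  assert (Co : forall S0', reassign δ ks S0 S0' -> exists X, X ⊆ V_ δ /\
    agree (upd S (nm d) X) /\
    matches (negb b) (satF δ F' (U k (negb b) (Datatypes.S d) c) no_vars (upd S (nm d) X))
      (satF δ G' ψ no_vars S0') True).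
  { intros S0' R.
    assert (HS0' : forall n, S0' n ⊆ V_ δ).
    { intros n. destruct (R n) as [R1 R2]. destruct (classic (In n ks)) as [Hk|Hk]; auto.
      rewrite R2; auto. }
    destruct (IH' S0' HS0') as [h [Hh M]].
    destruct (code_sets δ ks S0' h Iδ Hh) as [X [HX [Sl [Lm CX]]]].
    { intros k' _. auto. }
    exists X. split; auto. assert (Ag' := agree_upd S d X Hd Ag HX). split; auto.
    specialize (M (upd S (nm d) X) Ag'). rewrite upd_eq in M.
    assert (E : S0' = dec (ext env d ks) (upd S (nm d) X)).
    { rewrite dec_ext by auto. apply functional_extensionality. intros n.
      destruct (R n) as [R1 R2]. destruct in_dec; [now rewrite Sl|].
      rewrite R2 by auto. now rewrite ES. }
    specialize (M E).
    assert (HC : limpt X δ /\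
      forall γ, γ ∈ δ -> enc c ∈ V_ γ -> limpt X γ -> closed_at h γ).
    { split; auto. intros γ Hγ Hcγ. apply CX; [now apply (ord_mem δ)|].
      intros ->. apply in_V in Hcγ. destruct Hcγ as [? [Hx _]]. exact (in_empty _ Hx). }
    destruct b; simpl in *; tauto. }
  assert (De : forall X, X ⊆ V_ δ -> exists S0', reassign δ ks S0 S0' /\
    exists C, matches (negb b)
      (satF δ F' (U k (negb b) (Datatypes.S d) c) no_vars (upd S (nm d) X))
      (satF δ G' ψ no_vars S0') C).
  { intros X HX. assert (Ag' := agree_upd S d X Hd Ag HX).
    exists (dec (ext env d ks) (upd S (nm d) X)).
    assert (HV := dec_V (ext env d ks) (upd S (nm d) X) δ Lδ (proj1 Ag')). split.
    - intros n. split; [intros _; apply HV|]. intros Hk.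
      rewrite dec_ext by auto. destruct in_dec; [tauto|]. now rewrite ES.
    - destruct (IH' _ HV) as [h [Hh M]]. eexists. apply M; auto. }
  destruct b; simpl in *.
  + split.
    * intros H S0' R. destruct (Co S0' R) as [X [HX [_ [_ M]]]]. apply M; auto.
      apply H. apply reassign_cons. exists X. split; auto. now apply reassign_nil.
    * intros H _ S' R. apply reassign_cons in R. destruct R as [X [HX E]].
      apply reassign_nil in E. subst S'. destruct (De X HX) as [S0' [R [C [M _]]]]. auto.
  + split.
    * intros [S0' [R H]]. destruct (Co S0' R) as [X [HX [_ [_ M]]]].
      exists (upd S (nm d) X). split; auto.
      apply reassign_cons. exists X. split; auto. now apply reassign_nil.
    * intros [S' [R H]] _. apply reassign_cons in R. destruct R as [X [HX E]].
      apply reassign_nil in E. subst S'. destruct (De X HX) as [S0' [R [C [M _]]]]. eauto.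
- assert (Hci : forall i, F' i -> enc (ι i :: c) ∈ V_ δ).
  { intros i Fi. simpl. apply opair_V; auto. }
  destruct (family_choice V (V -> V) (fun x => x) (fun i => i ∈ k /\ F' i) _
    (fun i H => IH i (proj1 H) (FF' i (proj2 H)) Hd He (Hci i (proj2 H)) S0 HS0)) as [h Hh].
  (* No set is quantified at a connective, so one club must serve all members; a member matters only
     at those γ for which [V_ γ] contains its label. *)
  destruct (club_diag V δ (fun i => i ∈ k /\ F' i) ι (fun i => closed_at (h i)) Lδ)
    as [h0 [Hh0 Cl]].
  { intros i j [_ Fi] [_ Fj]. apply Inj; auto. }
  { intros i Hi. apply club_closed. now apply Hh. }
  exists h0. split; auto. intros S Ag ES.
  unfold U. destruct (G_limit (leaf (stages κ) (var 0)) ι k b d c Lk) as [g [-> Hg]].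
  fold U in Hg.
  refine (matches_iff _ _ _ _ _ _ (satF_Big b δ F' k g no_vars S)
    (satF_Big b δ G' (π k) f no_vars S0) _).
  assert (M : forall i, i ∈ k -> F' i ->
    (limpt (S (nm (d - 1))) δ /\
       forall γ, γ ∈ δ -> enc c ∈ V_ γ -> limpt (S (nm (d - 1))) γ -> closed_at h0 γ) ->
    matches b (satF δ F' (g i) no_vars S) (satF δ G' (f (π i)) no_vars S0) True).
  { intros i Hi Fi [Lm HC]. destruct (Hh i (conj Hi Fi)) as [_ M].
    specialize (M S Ag ES). rewrite Hg by auto.
    assert (Cond : limpt (S (nm (d - 1))) δ /\ forall γ, γ ∈ δ -> enc (ι i :: c) ∈ V_ γ ->
      limpt (S (nm (d - 1))) γ -> closed_at (h i) γ).
    { split; auto. intros γ Hγ Hcγ Lmγ.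
      assert (Oγ := ord_mem _ _ Oδ Hγ).
      assert (V2 : enc c ∈ V_ γ /\ ι i ∈ V_ γ).
      { simpl in Hcγ. assert (U2 : upair (ι i) (enc c) ∈ V_ γ).
        { apply (V_trans γ (opair (ι i) (enc c))); auto. apply in_upair. auto. }
        split; apply (V_trans γ (upair (ι i) (enc c))); auto; apply in_upair; auto. }
      apply (Cl γ Hγ (HC γ Hγ (proj1 V2) Lmγ) i (conj Hi Fi)). apply V2. }
    destruct b; simpl in *; tauto. }
  assert (M' : forall i, i ∈ k -> F' i ->
    exists C, matches b (satF δ F' (g i) no_vars S) (satF δ G' (f (π i)) no_vars S0) C).
  { intros i Hi Fi. destruct (Hh i (conj Hi Fi)) as [_ M1].
    specialize (M1 S Ag ES). rewrite Hg by auto. eauto. }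
  assert (Pk : forall j, j ∈ π k /\ G' j -> exists i, i ∈ k /\ F' i /\ j = π i).
  { intros j [Hj Gj]. apply Hπ in Hj; auto. destruct Hj as [i [Hi [Fi ->]]].
    exists i. split; auto. split; auto. now apply FG'. }
  assert (Pk' : forall i, i ∈ k /\ F' i -> π i ∈ π k /\ G' (π i)).
  { intros i [Hi Fi]. split; [apply Hπ; eauto|]. apply FG'; auto. }
  destruct b; simpl.
  + split.
    * intros H j Hj. destruct (Pk j Hj) as [i [Hi [Fi ->]]].
      destruct (M' i Hi Fi) as [C [M1 _]]. auto.
    * intros H HC i [Hi Fi]. destruct (M i Hi Fi HC) as [_ M1]. auto.
  + split.
    * intros [j [Hj H]]. destruct (Pk j Hj) as [i [Hi [Fi ->]]].
      destruct (M' i Hi Fi) as [C [M1 _]]. exists i. auto.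
    * intros [i [[Hi Fi] H]] HC. destruct (M i Hi Fi HC) as [_ M1]. exists (π i). auto.
Qed.

End Codes.

(** * Existence of codes *)

Lemma app_cons_inj (A : Type) (l l' c : list A) x y : l ++ x :: c = l' ++ y :: c -> x = y.
Proof.
intros E. assert (E' : (l ++ x :: nil) ++ c = (l' ++ y :: nil) ++ c).
{ rewrite <- !app_assoc. exact E. }
apply app_inv_tail in E'. now apply app_inj_tail in E'.
Qed.

(** Only tuples whose path ends in [c] concern the node [c]. Codes are therefore prescribed by
    predicates on paths, and a single [K] can be extracted at the root. Inverting the level of [φ],
    the collapse of k, shows that [φ] has the shape of the tree of height k. *)
Lemma codes_exist b κ ξ α F ι : ordinal ξ -> coherent b κ ξ α F -> limit α ->
  (forall i j, F i -> F j -> ι i = ι j -> i = j) ->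
  let π := collapse (trace ξ F) in
  forall k, ordinal k -> F k \/ k = ξ -> forall p φ, isC p α (π k) φ ->
  forall d env c, (forall n, env n < d) ->
  exists KP : list V -> V -> Prop, forall K,
    (forall l x r, let t := enc (enc (l ++ c) :: x :: r) in t ∈ V_ α ->
       (t ∈ K <-> KP (l ++ c) t)) ->
    Codes α K F π ι p k d env c φ.
Proof.
intros Oξ HF Lα Inj π k Ok. pattern k. apply ord_rect; auto; clear k Ok.
- intros _ p φ H d env c He. unfold π in H. rewrite collapse_empty in H.
  apply isC_inv in H. destruct H as [[_ [q [-> _]]]|[[j [ks [ψ [E _]]]]|[[_ [N _]] _]]];
    [|symmetry in E; destruct (succ_not_empty _ E)|tauto].
  (* The choice of [S] is harmless: names are decoded from sets quantified at depths below [d], and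
     the tuple lists the traces of all of these. *)
  exists (fun path t => exists γ S, γ ∈ α /\ limit γ /\ t = tuple d c S γ /\
    fo_sat γ (fo_cut γ q) no_vars (dec env (fun n => inter (S n) (V_ γ)))).
  intros K HK. apply Codes_zero. intros γ Hγ Lγ Hc S.
  assert (Vt : tuple d c S γ ∈ V_ α).
  { unfold tuple. rewrite <- (map_map (fun e => S (nm e)) (fun X => inter X (V_ γ))).
    apply truth_V; auto. }
  specialize (HK nil (V_ γ) _ Vt). unfold tuple at 1. rewrite HK. clear HK.
  split; [|intros H; exists γ, S; auto].
  intros [γ' [S' [Hγ' [Lγ' [E H]]]]]. apply enc_inj in E. injection E as E1 E2.
  apply V_inj in E1; [|apply Lγ|apply Lγ']. subst γ'.
  replace (dec env (fun n => inter (S n) (V_ γ))) with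
    (dec env (fun n => inter (S' n) (V_ γ))); auto.
  apply functional_extensionality. intros n. unfold dec. specialize (He n).
  destruct (env n) as [|e]; auto. f_equal. symmetry.
  apply (ext_in_map E2). apply in_seq. lia.
- intros k Ok IH Hk p φ H d env c He.
  assert (Fk : F k) by now apply HF.
  unfold π in H. rewrite collapse_succ in H; [|now apply (in_trace b κ ξ α F HF)|auto].
  apply isC_inv in H. destruct H as [[E _]|[[j [ks [ψ [E [-> H]]]]]|[L _]]];
    [destruct (succ_not_empty _ E)| |destruct (limit_not_succ _ L)].
  apply succ_inj in E. subst j.
  destruct (IH (or_introl Fk) (negb p) ψ H (S d) (ext env d ks) c) as [KP HKP].
  { intros n. now apply ext_lt. }
  exists KP. intros K HK. apply Codes_succ; auto.
- intros k Lk IH Hk p φ H d env c He.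
  assert (Lπ := coherent_limit b κ ξ α F Oξ HF k Hk Lk).
  apply isC_inv in H. destruct H as [[E _]|[[j [ks [ψ [E _]]]]|[_ [f [-> [H _]]]]]].
  { destruct Lπ as [_ [N _]]. tauto. }
  { unfold π in E. rewrite E in Lπ. destruct (limit_not_succ _ Lπ). }
  assert (Hi : forall i, i ∈ k /\ F i -> exists KP : list V -> V -> Prop, forall K,
    (forall l x r, let t := enc (enc (l ++ ι i :: c) :: x :: r) in t ∈ V_ α ->
       (t ∈ K <-> KP (l ++ ι i :: c) t)) ->
    Codes α K F π ι p i d env (ι i :: c) (f (π i))).
  { intros i [Hi Fi]. apply IH; auto. apply H. apply collapse_mem; auto.
    now apply (in_trace b κ ξ α F HF). }
  destruct (family_choice V (list V -> V -> Prop) (fun _ _ => False) _ _ Hi) as [KP HKP].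
  (* The label just in front of [c] identifies the member, so the prescriptions for different
     members do not collide. *)
  exists (fun path t => exists i l, i ∈ k /\ F i /\ path = l ++ ι i :: c /\ KP i path t).
  intros K HK. apply Codes_limit; auto. intros i Ki Fi. apply HKP; auto.
  intros l x r. cbv zeta. intros Vt. specialize (HK (l ++ ι i :: nil) x r). cbv zeta in HK.
  rewrite <- app_assoc in HK. simpl app in HK. rewrite HK by auto. split.
  + intros [i' [l' [Ki' [Fi' [E M]]]]]. apply app_cons_inj in E. apply Inj in E; auto.
    now subst i'.
  + intros M. exists i, l. auto.
Qed.

(** * Inaccessible levels *)

(* Arbitrary once [x] is exhausted. *)
Definition enumerate (x : V) : V -> V :=
  Fix mem_wf (fun _ => V)
    (fun δ rec => pick (fun y => y ∈ x /\ forall i (h : i ∈ δ), y <> rec i h)).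

Lemma enumerate_eq x δ :
  enumerate x δ = pick (fun y => y ∈ x /\ forall i, i ∈ δ -> y <> enumerate x i).
Proof.
unfold enumerate at 1. rewrite Fix_eq; [reflexivity|].
intros y f g H. f_equal. apply functional_extensionality. intros z.
assert (f = g) as ->; auto.
apply functional_extensionality_dep. intros i.
apply functional_extensionality_dep. apply H.
Qed.

Lemma enumerate_new x δ : ~ x ⊆ img δ (enumerate x) ->
  enumerate x δ ∈ x /\ forall i, i ∈ δ -> enumerate x δ <> enumerate x i.
Proof.
intros H.
assert (K := pick_spec (fun y => y ∈ x /\ forall i, i ∈ δ -> y <> enumerate x i)).
rewrite <- enumerate_eq in K. apply K. apply NNPP. intros N. apply H.
intros y Hy. apply NNPP. intros Ny. apply N. exists y. split; auto.
intros i Hi E. apply Ny. apply in_img. eauto.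
Qed.

Lemma enumerate_inj x i j : ordinal i -> ordinal j ->
  ~ x ⊆ img i (enumerate x) -> ~ x ⊆ img j (enumerate x) ->
  enumerate x i = enumerate x j -> i = j.
Proof.
intros Oi Oj Hi Hj E. destruct (ord_tri i Oi j Oj) as [H|[H|H]]; auto; exfalso.
- exact (proj2 (enumerate_new x j Hj) i H (eq_sym E)).
- exact (proj2 (enumerate_new x i Hi) j H E).
Qed.

(** Otherwise all ordinals would inject into [x] and, by replacement, form a set. *)
Lemma enumerate_all x : exists δ, ordinal δ /\ x ⊆ img δ (enumerate x).
Proof.
apply NNPP. intros N.
assert (H : forall δ, ordinal δ -> ~ x ⊆ img δ (enumerate x)) by eauto.
set (inv := fun y => pick (fun δ => ordinal δ /\ enumerate x δ = y)).
assert (Hinv : forall δ, ordinal δ -> inv (enumerate x δ) = δ).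
{ intros δ Oδ. destruct (pick_spec (fun δ' => ordinal δ' /\ enumerate x δ' = enumerate x δ))
    as [O E]; [eauto|]. apply (enumerate_inj x); auto. }
set (A := sep (img x inv) ordinal).
assert (HA : forall δ, ordinal δ -> δ ∈ A).
{ intros δ Oδ. apply in_sep. split; auto. apply in_img. exists (enumerate x δ).
  split; [now apply enumerate_new, H|]. symmetry. auto. }
assert (OA : ordinal (bigcup A)).
{ apply ord_bigcup. intros y Hy. now apply in_sep in Hy. }
apply (mem_irrefl (bigcup A)). apply in_bigcup. exists (succ (bigcup A)).
split; [|apply mem_succ]. apply HA. now apply ord_succ.
Qed.

(** If the enumeration of [x] lasted through [κ], its inverse would be an unbounded map from [x] to
    [κ]. *)
Lemma enumerate_small κ x : inacc κ -> x ∈ V_ κ ->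
  exists δ, δ ∈ κ /\ x ⊆ img δ (enumerate x).
Proof.
intros [Lκ [_ B]] Hx. assert (Oκ := proj1 Lκ).
destruct (enumerate_all x) as [δ1 [O1 H1]].
destruct (ord_ind_least (fun δ => x ⊆ img δ (enumerate x)) δ1 O1 H1) as [δ [Oδ [Hδ Least]]].
exists δ. split; auto. apply NNPP. intros N.
assert (Sub := ord_notin _ _ Oδ Oκ N).
assert (New : forall i, i ∈ κ -> ~ x ⊆ img i (enumerate x)) by (intros i Hi; apply Least; auto).
destruct (family_choice V V empty (fun y => True)
  (fun y i => i ∈ κ /\ forall j, j ∈ κ -> enumerate x j = y -> i = j)) as [f Hf].
{ intros y _. destruct (classic (exists j, j ∈ κ /\ enumerate x j = y)) as [[j [Hj <-]]|M].
  - exists j. split; auto. intros i Hi E. symmetry in E.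
    apply (enumerate_inj x); auto; apply (ord_mem κ); auto.
  - exists empty. split; [now apply limit_empty|]. intros j Hj E. destruct M. eauto. }
destruct (B x f Hx) as [γ [Hγ K]].
{ intros y _. now apply Hf. }
destruct (enumerate_new x γ (New γ Hγ)) as [K1 _]. specialize (K _ K1).
destruct (Hf (enumerate x γ) I) as [_ E]. rewrite (E γ Hγ eq_refl) in K.
exact (mem_irrefl _ K).
Qed.

(** Reflection yields regular points only. If [V_ α] is closed under the length of the enumeration,
    a map on a set in [V_ α] becomes a map on an ordinal below α, to which regularity applies. *)
Lemma inacc_club κ : inacc κ -> club κ (fun α => regular α -> inacc α).
Proof.
intros Iκ. assert (Lκ : limit κ) by apply Iκ. assert (Oκ := proj1 Lκ).
assert (Vκ : forall i, i ∈ κ -> i ∈ V_ κ).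
{ intros i Hi. apply ord_in_V; auto. now apply (ord_mem κ). }
destruct (family_choice V V empty (fun x => x ∈ V_ κ)
  (fun x δ => δ ∈ κ /\ x ⊆ img δ (enumerate x))) as [h Hh].
{ intros x Hx. now apply enumerate_small. }
assert (C1 : club κ (closed_at h)).
{ apply club_closed. intros x Hx. apply Vκ. now apply Hh. }
assert (C2 : club κ (fun α => omega ∈ V_ α)).
{ apply club_const; auto. apply Vκ, Iκ. }
apply (club_mono κ _ _ (club_and κ _ _ Lκ C1 C2)).
intros α Hα Lα [[_ C] W] [_ [_ R]]. assert (Oα := proj1 Lα).
split; auto. split; [now apply (ord_in_V α Oα omega ord_omega)|].
intros x f Hx Hf.
destruct (Hh x) as [H1 H2]; [apply (V_le κ α); auto|].
assert (H3 : h x ∈ α).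
{ apply (ord_in_V α Oα); auto. now apply (ord_mem κ). }
destruct (R (h x) (fun i => if excluded_middle_informative (enumerate x i ∈ x)
  then f (enumerate x i) else empty) H3) as [γ [Hγ K]].
- intros i Hi. destruct excluded_middle_informative; auto. now apply limit_empty.
- exists γ. split; auto. intros y Hy. assert (Iy := H2 y Hy). apply in_img in Iy.
  destruct Iy as [i [Hi ->]]. specialize (K i Hi). cbv beta in K.
  destruct excluded_middle_informative; tauto.
Qed.

Lemma inacc_regular κ : cardinal κ -> inacc κ -> regular κ.
Proof.
intros Cκ [Lκ [_ B]]. split; auto. split; auto. intros β f Hβ. apply B.
apply ord_in_V; auto; [apply Cκ|]. apply (ord_mem κ); auto. apply Cκ.
Qed.

(** * Indescribability is expressible *)

Lemma coherent_below b κ ξ α F ζ : ordinal ξ -> coherent b κ ξ α F -> F ζ ->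
  coherent b κ ζ α (fun k => k ∈ ζ /\ F k).
Proof.
intros Oξ [H1 [H2 [H3 [H4 H5]]]] Fζ. assert (Hζ := H1 ζ Fζ).
assert (Sub : forall k, k ∈ ζ -> k ∈ ξ) by (intros k Hk; now apply (ord_trans ξ ζ)).
split; [tauto|]. split; [auto|]. split.
- intros k Hk [_ Fk]. auto.
- split.
  + intros k [[Hk Fk]|<-].
    * split; auto. apply (ord_trans ζ (succ k)); auto using mem_succ. now apply (ord_mem ξ).
    * split; [apply mem_succ|auto].
  + intros η [[Hη Fη]| ->] k.
    * rewrite H5 by auto. split; [|tauto]. intros [K1 K2]. split; auto. split; auto.
      apply (ord_trans ζ η); auto. now apply (ord_mem ξ).
    * rewrite H5 by auto. tauto.
Qed.

Lemma satF_index b κ k φ δ F F' s : ordinal k -> isC b κ k φ ->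
  (forall i, i ∈ k -> (F i <-> F' i)) ->
  forall S, satF δ F φ s S <-> satF δ F' φ s S.
Proof.
intros Ok H. revert Ok. pattern b, k, φ. revert b k φ H. apply isC_ind_all.
- simpl. tauto.
- intros b k ks ψ _ IH Ok H S. rewrite !satF_Qs. apply quant_iff. intros S' _.
  apply IH.
  + apply (ord_mem (succ k)); auto using mem_succ.
  + intros i Hi. apply H, in_succ. auto.
- intros b k f L _ IH _ _ Ok H S. rewrite !satF_Big.
  assert (E : (fun i => i ∈ k /\ F i) = (fun i => i ∈ k /\ F' i)).
  { apply functional_extensionality. intros i. apply propositional_extensionality.
    split; intros [K1 K2]; split; auto; now apply H. }
  rewrite E. apply quant_iff. intros i [Hi _]. apply IH; auto.
  + now apply (ord_mem k).
  + intros j Hj. apply H. now apply (ord_trans k i).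
Qed.

Lemma nogap_G L ι : (forall b d c, ~ fo_free2 (L b d c) 1) ->
  forall k, ordinal k -> forall b d c, nogap (G L ι k b d c).
Proof.
intros H k Ok. pattern k. apply ord_rect; auto; clear k Ok.
- intros b d c. rewrite G_empty. apply H.
- intros k Ok IH b d c. rewrite G_succ, nogap_Qs. split; auto.
  intros [E|[]]. destruct d; discriminate.
- intros k Lk IH b d c. destruct (G_limit L ι k b d c Lk) as [f [-> Hf]].
  rewrite nogap_Big. intros i Hi. rewrite Hf; auto.
Qed.

Lemma leaf_names_succ t0 d n : leaf_names t0 (S d) n -> n = nm d \/ leaf_names t0 d n.
Proof.
intros [[e [He ->]]|H]; [|right; right; auto].
destruct (Nat.eq_dec e d) as [->|N]; auto. right. left. exists e. split; auto. lia.
Qed.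

Lemma leaf_names_finite t0 d : finitely_many (leaf_names t0 d).
Proof.
apply (finite_sub _ _ _ (finite_or _ _ _ (finite_list _ (map nm (seq 1 d)))
  (finite_list _ (match t0 with var n => n :: nil | par _ => nil end)))).
intros n [[e [He ->]]|E].
- left. apply in_map. apply in_seq. lia.
- right. subst t0. simpl. auto.
Qed.

(** This disjunct speaks about X_0 alone. It can therefore sit at every leaf of the negated tree and
    be drawn out by [satF_G_neg], which keeps the level down. *)
Definition catchF (P R : V) : fo :=
  FEx 0 (FAnd (guardF P (var 0) empty) (tupF empty (par R) (var 0 :: nil))).

Definition leaf_neg (P R : V) (b : bool) (d : nat) (c : list V) : fo :=
  FOr (FOr (FNot (unbF P (var 0))) (catchF P R)) (FNot (leaf P (var 0) (negb b) d c)).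

Definition caught (R δ X : V) : Prop :=
  ~ limpt X δ \/ exists γ, γ ∈ δ /\ limpt X γ /\ empty ∈ V_ γ /\
    enc (empty :: V_ γ :: inter X (V_ γ) :: nil) ∈ R.

Lemma sat_leaf_neg κ δ R b d c S : ordinal κ -> limit δ -> δ ∈ κ \/ δ = κ ->
  (fo_sat δ (fo_cut δ (leaf_neg (stages κ) R b d c)) no_vars S <->
   caught R δ (S 0) \/
   ~ fo_sat δ (fo_cut δ (leaf (stages κ) (var 0) (negb b) d c)) no_vars S).
Proof.
intros Oκ Lδ Hδ. set (P := inter (stages κ) (V_ δ)).
set (T := tupF empty (par (inter R (V_ δ))) (var 0 :: nil)).
assert (E : fo_cut δ (leaf_neg (stages κ) R b d c) =
  FOr (FOr (FNot (unbF P (var 0))) (FEx 0 (FAnd (guardF P (var 0) empty) T)))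
   (FNot (fo_cut δ (leaf (stages κ) (var 0) (negb b) d c)))) by reflexivity.
rewrite E, !sat_or, !sat_not. unfold caught.
assert (HT : forall γ, γ ∈ δ -> empty ∈ V_ γ -> (fo_sat δ T (upd no_vars 0 (V_ γ)) S <->
  enc (empty :: V_ γ :: inter (S 0) (V_ γ) :: nil) ∈ R)).
{ intros γ Hγ H0. unfold T. rewrite (sat_tupF_truth κ δ no_vars S Lδ Hδ) by auto.
  unfold truth. simpl map. simpl value. rewrite in_inter. split; [tauto|]. intros H.
  split; auto. apply (truth_V δ Lδ empty (S 0 :: nil) γ); auto. }
assert (M : fo_sat δ (FEx 0 (FAnd (guardF P (var 0) empty) T)) no_vars S <->
  exists γ, γ ∈ δ /\ limpt (S 0) γ /\ empty ∈ V_ γ /\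
    enc (empty :: V_ γ :: inter (S 0) (V_ γ) :: nil) ∈ R).
{ rewrite sat_ex. split.
  - intros [v [Vv H]]. rewrite sat_and in H. unfold P in H.
    rewrite (sat_guardF κ δ no_vars S Oκ Lδ Hδ) in H by auto.
    destruct H as [[γ [Hγ [-> [Lγ H0]]]] H]. exists γ. apply HT in H; auto.
  - intros [γ [Hγ [Lγ [H0 H]]]]. exists (V_ γ). assert (Vγ := V_in δ γ Hγ). split; auto.
    rewrite sat_and. unfold P. rewrite (sat_guardF κ δ no_vars S Oκ Lδ Hδ) by auto.
    split; [eauto|]. apply HT; auto. }
rewrite M. unfold P. rewrite (sat_unbF κ δ no_vars S Oκ Lδ Hδ). reflexivity.
Qed.

Lemma satF_leaf_neg κ δ F R ι k S : ordinal κ -> limit δ -> δ ∈ κ \/ δ = κ -> F empty ->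
  ordinal k ->
  (satF δ F (G (leaf_neg (stages κ) R) ι k false 1 nil) no_vars S <->
   caught R δ (S 0) \/ ~ satF δ F (U ι κ k true 1 nil) no_vars S).
Proof.
intros Oκ Lδ Hδ F0 Ok.
apply (satF_G_neg δ F no_vars ι F0 _ _ (fun S => caught R δ (S 0))); auto.
- intros d S' X Hd. rewrite upd_neq; [tauto|]. destruct d; [lia|discriminate].
- intros b d c S'. now apply sat_leaf_neg.
Qed.

(** Reflecting U at a fixed [A] requires a sentence, so X_0 becomes a parameter; restriction then
    cuts it to A ∩ V_δ by itself. *)
Lemma satF_param κ δ F ι k A : ordinal κ -> limit δ -> δ ∈ κ \/ δ = κ -> ordinal k ->
  (satF δ F (G (leaf (stages κ) (par A)) ι k true 1 nil) no_vars no_vars <->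
   satF δ F (U ι κ k true 1 nil) no_vars (upd no_vars 0 (inter A (V_ δ)))).
Proof.
intros Oκ Lδ Hδ Ok.
apply (satF_G_rel δ F no_vars ι _ _ (fun d S S' => 1 <= d /\ S' 0 = inter A (V_ δ) /\
  forall e, 1 <= e -> S (nm e) = S' (nm e))); auto.
- intros b d c S S' [Hd [H0 H]]. rewrite !(sat_leaf κ δ no_vars _ Oκ Lδ Hδ).
  assert (E : forall e, hist δ S (par A) e = hist δ S' (var 0) e).
  { intros [|e]; unfold hist; simpl; [auto|]. apply (H (Datatypes.S e)). lia. }
  rewrite !E. replace (map (hist δ S (par A)) (seq 1 (d - 1)))
    with (map (hist δ S' (var 0)) (seq 1 (d - 1))); [tauto|].
  apply map_ext. intros e. symmetry. apply E.
- intros d S S' X _ [Hd [H0 H]]. split; [lia|]. split.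
  + rewrite upd_neq; auto. destruct d; [lia|discriminate].
  + intros e He. unfold upd. destruct Nat.eq_dec; auto.
- split; auto. split; [apply upd_eq|]. intros e He. rewrite upd_neq; auto.
  destruct e; [lia|discriminate].
Qed.

Lemma stages_sub κ : ordinal κ -> stages κ ⊆ V_ κ.
Proof. intros Oκ x Hx. apply in_stages in Hx. destruct Hx as [γ [Hγ ->]]. now apply V_in. Qed.

Lemma isC_leaf κ t0 ι k b d : limit κ -> par2_over κ t0 -> ordinal k ->
  (forall i, i ∈ k -> ι i ∈ V_ κ) -> isC b κ k (G (leaf (stages κ) t0) ι k b d nil).
Proof.
intros Lκ Ht Ok Hι. assert (Oκ := proj1 Lκ).
assert (V0 : empty ∈ V_ κ) by (apply V_empty_mem; apply Lκ).
apply isC_G with (W := fun x => x ∈ V_ κ) (N := leaf_names t0)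
  (A := fun B => B = stages κ \/ t0 = par B); auto.
- intros. apply fo_over_leaf; auto. now apply stages_sub.
- intros b' d' c n. apply free2_leaf.
- intros b' d' c B. apply par2_leaf.
- apply leaf_names_succ.
- apply leaf_names_finite.
- apply finite_or; [exists (stages κ :: nil); simpl; auto|].
  exists (match t0 with par B => B :: nil | _ => nil end). intros B ->. simpl. auto.
Qed.

(** * The universal formula, the sentence [Φ], and their reflection *)

Section Universal.
Context (b : V -> V -> V -> V) (κ ξ ζ S R : V) (ι : V -> V).
Hypothesis Oξ : ordinal ξ.
Hypothesis Hζ : ζ ∈ ξ.
Hypothesis Iκ : inacc κ.
Hypothesis Hι : maps ξ κ ι.
Hypothesis Inj : forall i j, i ∈ ξ -> j ∈ ξ -> ι i = ι j -> i = j.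

Let Lκ : limit κ := proj1 Iκ.
Let Oκ : ordinal κ := proj1 Lκ.
Let Oζ : ordinal ζ := ord_mem _ _ Oξ Hζ.

Definition Fset (η α k : V) : Prop := k ∈ η /\ ι k ∈ α.

Definition nice (α : V) : Prop :=
  coherent b κ ξ α (Fset ξ α) /\ (regular α -> inacc α) /\ ι ζ ∈ α.

Lemma label_V k : k ∈ ξ -> ι k ∈ V_ κ.
Proof. intros Hk. apply ord_in_V; auto. apply (ord_mem κ); auto. Qed.

Lemma label_V_iff α k : ordinal α -> k ∈ ξ -> (ι k ∈ V_ α <-> ι k ∈ α).
Proof. intros Oα Hk. apply ord_in_V; auto. apply (ord_mem κ); auto. Qed.

Lemma nice_F0 α : nice α -> Fset ξ α empty.
Proof.
intros [[_ [H _]] _]. apply H. apply empty_mem; auto. intros E. subst. exact (in_empty _ Hζ).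
Qed.

Lemma nice_good α : ordinal α -> nice α -> good ξ ι α (Fset ξ α).
Proof.
intros Oα N. split; [now apply nice_F0|]. destruct N as [[H1 [H2 [H3 [H4 _]]]] _].
split; auto. split; auto. intros k Hk. unfold Fset. rewrite label_V_iff; tauto.
Qed.

Lemma full_good : good ξ ι κ (fun _ => True).
Proof.
split; auto. split; auto. split; auto. intros k Hk. split; auto using label_V.
Qed.

Lemma nice_ζ α : nice α -> Fset ξ α ζ.
Proof. intros [_ [_ H]]. split; auto. Qed.

Lemma satF_below α c φ s S' : isC c κ ζ φ ->
  (satF α (Fset ξ α) φ s S' <-> satF α (Fset ζ α) φ s S').
Proof.
intros H. apply (satF_index c κ ζ); auto. intros i Hi. unfold Fset.
split; intros [K1 K2]; split; auto. now apply (ord_trans ξ ζ).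
Qed.

Definition Uζ (δ : V) (F : V -> Prop) (X : V) : Prop :=
  satF δ F (U ι κ ζ true 1 nil) no_vars (upd no_vars 0 X).

Lemma isC_U : isC true κ ζ (U ι κ ζ true 1 nil).
Proof.
apply isC_leaf; simpl; auto. intros i Hi. apply label_V. now apply (ord_trans ξ ζ).
Qed.

(** The limit points of [A] form a club, so the reflection point can be taken among them, as
    [caught] demands. *)
Lemma reflect_U A : indescribable b ξ κ S -> club κ nice -> A ⊆ V_ κ -> limpt A κ ->
  Uζ κ (fun _ => True) A ->
  exists β, β ∈ S /\ regular β /\ nice β /\ limpt A β /\
    Uζ β (Fset ζ β) (inter A (V_ β)).
Proof.
intros HS HN HA Lm HU.
assert (Vι : forall i, i ∈ ζ -> ι i ∈ V_ κ).
{ intros i Hi. apply label_V. now apply (ord_trans ξ ζ). }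
set (φ := G (leaf (stages κ) (par A)) ι ζ true 1 nil).
assert (Iφ : isC true κ ζ φ) by (apply isC_leaf; auto).
assert (Nφ : nogap φ).
{ apply nogap_G; auto. intros b' d c H. apply free2_leaf in H.
  destruct H as [[e [He E]]|E]; [destruct e; simpl in E; lia|discriminate]. }
destruct (raise κ ξ ι Oξ label_V Inj ξ Oξ (or_intror eq_refl) ζ Hζ true φ Iφ Nφ true)
  as [φ' [Iφ' [E1 [E2 E3]]]].
destruct (club_and κ _ _ Lκ HN (club_limpt κ A Lκ Lm)) as [h [Hh C]].
destruct (indescribable_closed b ξ κ S h φ' HS Oξ Hh Iφ') as [β [Hβ [Rβ [Cβ Mβ]]]].
- split.
  + intros n Hn. apply E1 in Hn. revert Hn. apply free1_G; auto.
    intros. apply free1_leaf.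
  + intros n Hn. apply E2 in Hn.
    apply (free2_G _ _ (leaf_names (par A))) in Hn; auto.
    * destruct Hn as [[e [He _]]|E]; [lia|discriminate].
    * intros b' d c m. apply free2_leaf.
    * apply leaf_names_succ.
- apply (sat_satF κ true ξ φ' Iφ'). apply E3; auto using full_good.
  apply satF_param; auto. rewrite inter_id by auto. exact HU.
- assert (Sκ : S ⊆ κ) by apply HS. assert (Kβ := Sκ β Hβ).
  destruct (C β Kβ Cβ) as [Nβ Lmβ].
  exists β. split; auto. split; auto. split; auto. split; auto.
  assert (Oβ := ord_mem _ _ Oκ Kβ). assert (Lβ : limit β) by apply Rβ.
  apply (sat_restr b κ ξ β (Fset ξ β) Oκ Oξ (proj1 Nβ) true ξ φ' Iφ' (or_intror eq_refl)) in Mβ.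
  apply E3 in Mβ; auto using nice_good, nice_ζ.
  apply satF_param in Mβ; auto. apply (satF_below β true) in Mβ; auto using isC_U.
Qed.

(* For [R] as below, this expresses that [S] is [Π^1_ζ]-indescribable. *)
Definition Φ : form := SAll 0 (G (leaf_neg (stages κ) R) ι ζ false 1 nil).

Lemma isC_Φ : R ⊆ V_ κ -> isC true κ (succ ζ) Φ /\ nogap Φ /\ sentence Φ.
Proof.
intros HR.
assert (V0 : empty ∈ V_ κ) by (apply V_empty_mem; apply Lκ).
assert (F2 : forall b' d c n, fo_free2 (leaf_neg (stages κ) R b' d c) n ->
  leaf_names (var 0) d n).
{ intros b' d c n H. cbn -[leaf tupF] in H.
  assert (K : n = 0 \/ fo_free2 (tupF empty (par R) (var 0 :: nil)) n \/
    fo_free2 (leaf (stages κ) (var 0) (negb b') d c) n) by intuition congruence.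
  destruct K as [->|[K|K]]; [right; auto| |now apply free2_leaf in K].
  apply free2_tupF in K. right. simpl in K. intuition congruence. }
assert (P2 : forall b' d c B, fo_par2 (leaf_neg (stages κ) R b' d c) B ->
  B = R \/ B = stages κ).
{ intros b' d c B H. cbn -[leaf tupF] in H.
  assert (K : B = stages κ \/ fo_par2 (tupF empty (par R) (var 0 :: nil)) B \/
    fo_par2 (leaf (stages κ) (var 0) (negb b') d c) B) by intuition congruence.
  destruct K as [->|[K|K]]; auto.
  - apply par2_tupF in K. simpl in K. intuition congruence.
  - apply par2_leaf in K. intuition congruence. }
assert (F1 : forall b' d c n, ~ fo_free1 (leaf_neg (stages κ) R b' d c) n).
{ intros b' d c n H. cbn -[leaf tupF] in H.
  assert (K1 := free1_leaf (stages κ) (var 0) (negb b') d c n).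
  assert (K2 := free1_tupF empty (par R) (var 0 :: nil) n).
  intuition congruence. }
split; [|split; [|split]].
- apply (isC_succ true κ ζ (0 :: nil)).
  apply isC_G with (W := fun x => x ∈ V_ κ) (N := leaf_names (var 0))
    (A := fun B => B = R \/ B = stages κ); auto.
  + intros b' d c Hc.
    assert (K1 : fo_over κ (leaf (stages κ) (var 0) (negb b') d c)).
    { apply fo_over_leaf; simpl; auto. now apply stages_sub. }
    assert (K2 : fo_over κ (tupF empty (par R) (var 0 :: nil))).
    { apply fo_over_tupF; auto. constructor; simpl; auto. }
    assert (K3 : par2_over κ (par (stages κ))) by now apply stages_sub.
    cbn -[leaf tupF].
    repeat match goal with |- _ /\ _ => split end; auto.
  + apply leaf_names_succ.
  + apply leaf_names_finite.
  + exists (R :: stages κ :: nil). simpl. intuition.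
  + intros i Hi. apply label_V. now apply (ord_trans ξ ζ).
- split; [discriminate|]. apply nogap_G; auto. intros b' d c H. apply F2 in H.
  destruct H as [[e [He E]]|E]; [destruct e; simpl in E; lia|discriminate].
- intros n. simpl. apply free1_G; auto.
- intros n. simpl. intros [H1 H2].
  apply (free2_G _ _ (leaf_names (var 0)) F2 (leaf_names_succ _) ζ Oζ) in H2.
  destruct H2 as [[e [He _]]|E]; [lia|congruence].
Qed.

Lemma satF_Φ δ F : limit δ -> δ ∈ κ \/ δ = κ -> F empty ->
  satF δ F Φ no_vars no_vars <->
  forall X, X ⊆ V_ δ -> caught R δ X \/ ~ Uζ δ F X.
Proof.
intros Lδ Hδ F0. simpl. split; intros H X HX; specialize (H X HX).
- apply satF_leaf_neg in H; auto.
- apply satF_leaf_neg; auto.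
Qed.

(* With this parameter, [Φ] and its restrictions need no internal satisfaction relation for
   the [V_ β]. *)
Hypothesis HR : forall t, t ∈ R <-> exists β y, β ∈ κ /\ β ∈ S /\ regular β /\ nice β /\
  y ⊆ V_ β /\ Uζ β (Fset ζ β) y /\ t = enc (empty :: V_ β :: y :: nil).

Lemma R_sub : R ⊆ V_ κ.
Proof.
intros t Ht. apply HR in Ht. destruct Ht as [β [y [Hβ [_ [Rβ [_ [Hy [_ ->]]]]]]]].
apply enc_V; auto. constructor; [apply V_empty_mem; apply Lκ|].
constructor; [now apply V_in|]. constructor; auto. now apply (V_sub_mem κ β).
Qed.

Lemma Φ_true : indescribable b ξ κ S -> club κ nice ->
  satF κ (fun _ => True) Φ no_vars no_vars.
Proof.
intros HS HN. apply satF_Φ; auto. intros X HX.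
destruct (classic (limpt X κ)) as [Lm|Lm]; [|left; left; auto].
destruct (classic (Uζ κ (fun _ => True) X)) as [HU|]; auto.
left. right. destruct (reflect_U X HS HN HX Lm HU) as [β [Hβ [Rβ [Nβ [Lmβ Uβ]]]]].
assert (Sκ : S ⊆ κ) by apply HS. assert (Kβ := Sκ β Hβ).
assert (Lβ : limit β) by apply Rβ.
exists β. split; auto. split; auto. split; [apply V_empty_mem; apply Lβ|].
apply HR. exists β, (inter X (V_ β)). auto 8 using inter_sub_r.
Qed.

Lemma reflect_Φ T : indescribable b ξ κ S -> indescribable b ξ κ T -> club κ nice ->
  exists α, α ∈ T /\ regular α /\ nice α /\
    forall X, X ⊆ V_ α -> caught R α X \/ ~ Uζ α (Fset ζ α) X.
Proof.
intros HS HT HN. destruct (isC_Φ R_sub) as [IΦ [NΦ [S1 S2]]].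
(* The level ζ + 1 may already be ξ, and then nothing has to be raised. *)
assert (Lift : exists φ, isC true κ ξ φ /\ equiv ξ ι (succ ζ) Φ φ).
{ destruct (ord_in_succ ξ ζ Oξ Hζ) as [_ Hs]. apply in_succ in Hs.
  destruct Hs as [Hs|Hs].
  - apply (raise κ ξ ι Oξ label_V Inj ξ Oξ (or_intror eq_refl) (succ ζ) Hs true); auto.
  - exists Φ. rewrite <- Hs at 2. split; [now rewrite <- Hs|].
    split; auto. split; auto. tauto. }
destruct Lift as [φ [Iφ [E1 [E2 E3]]]].
destruct HN as [h [Hh C]].
assert (HN : club κ nice) by (exists h; auto).
destruct (indescribable_closed b ξ κ T h φ HT Oξ Hh Iφ) as [α [Hα [Rα [Cα Mα]]]].
- split; [intros n Hn; exact (S1 n (E1 n Hn)) | intros n Hn; exact (S2 n (E2 n Hn))].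
- apply (sat_satF κ true ξ φ Iφ). apply E3; auto using full_good. now apply Φ_true.
- assert (Tκ : T ⊆ κ) by apply HT. assert (Kα := Tκ α Hα).
  assert (Nα := C α Kα Cα). assert (Lα : limit α) by apply Rα.
  exists α. split; auto. split; auto. split; auto.
  apply (sat_restr b κ ξ α (Fset ξ α) Oκ Oξ (proj1 Nα) true ξ φ Iφ (or_intror eq_refl)) in Mα.
  apply E3 in Mα.
  + rewrite (satF_Φ α (Fset ξ α) Lα (or_introl Kα) (nice_F0 α Nα)) in Mα. intros X HX.
    destruct (Mα X HX) as [K|K]; auto. right. intros K'. apply K.
    apply (satF_below α true); auto using isC_U.
  + apply nice_good; auto. apply Lα.
  + intros Hs. destruct (nice_good α (proj1 Lα) Nα) as [_ [G1 _]].
    apply G1; auto using nice_ζ.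
Qed.

(** At β < α the tree loses the indices whose [ι]-label is at least β, while ψ, restricted from α,
    loses those whose [ι']-label is. The collapse π relates the two index sets, and on a club of α
    both labellings cut at corresponding places. *)
Lemma indescribable_below α : canonical_bijections b -> cardinal κ -> α ∈ κ -> regular α ->
  nice α -> (forall X, X ⊆ V_ α -> caught R α X \/ ~ Uζ α (Fset ζ α) X) ->
  indescribable b (canf b κ ζ α) α (inter S α).
Proof.
intros hb Cκ Kα Rα Nα HX.
assert (Lα : limit α) by apply Rα. assert (Oα := proj1 Lα).
assert (Iα : inacc α) by (apply Nα; auto).
assert (HF : coherent b κ ζ α (Fset ζ α)).
{ assert (H := coherent_below b κ ξ α _ ζ Oξ (proj1 Nα) (nice_ζ α Nα)).
  assert (E : Fset ζ α = fun k => k ∈ ζ /\ Fset ξ α k); [|now rewrite E].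
  apply functional_extensionality. intros k. apply propositional_extensionality.
  unfold Fset. split; [|tauto]. intros [K1 K2]. split; auto. split; auto.
  now apply (ord_trans ξ ζ). }
set (π := collapse (trace ζ (Fset ζ α))).
assert (Ej : canf b κ ζ α = π ζ).
{ apply (canf_collapse b κ ζ α (Fset ζ α)); auto. }
rewrite Ej. set (j0 := π ζ) in *.
assert (Oj : ordinal j0) by (apply collapse_ord; auto).
assert (Hπ : forall k j, j ∈ π k <-> exists i, i ∈ k /\ Fset ζ α i /\ j = π i).
{ intros k j. unfold π. rewrite in_collapse. split; intros [i [H1 [H2 H3]]]; exists i;
    split; auto; split; auto; now apply (in_trace b κ ζ α (Fset ζ α) HF). }
assert (Inj' : forall i j, Fset ζ α i -> Fset ζ α j -> ι i = ι j -> i = j).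
{ intros i j [Hi _] [Hj _]. apply Inj; now apply (ord_trans ξ ζ). }
assert (Sζ : forall i, i ∈ ζ -> i ∈ ξ) by (intros i Hi; now apply (ord_trans ξ ζ)).
assert (πj : forall k, Fset ζ α k -> π k ∈ j0).
{ intros k Hk. apply Hπ. exists k. split; auto. apply Hk. }
assert (πInj : forall i j, Fset ζ α i -> Fset ζ α j -> π i = π j -> i = j).
{ intros i j Hi Hj. apply collapse_inj.
  - apply (ord_mem ζ); auto. apply Hi.
  - apply (ord_mem ζ); auto. apply Hj.
  - now apply (in_trace b κ ζ α (Fset ζ α) HF).
  - now apply (in_trace b κ ζ α (Fset ζ α) HF). }
assert (Hj0 : lt_card_succ j0 α).
(* The labels [ι], transported along the inverse of π, inject f^κ_ζ(α) into α. *)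
{ destruct (family_choice V V empty (fun j => j ∈ j0)
    (fun j k => Fset ζ α k /\ j = π k)) as [f Hf].
  { intros j Hj. apply Hπ in Hj. destruct Hj as [k [_ [Fk E]]]. eauto. }
  apply (lt_card_succ_inj α κ j0 (fun j => ι (f j))); auto.
  - intros j Hj. apply (Hf j Hj).
  - intros i j Hi Hj E. destruct (Hf i Hi) as [Fi Ei]. destruct (Hf j Hj) as [Fj Ej'].
    rewrite Ei, Ej'. f_equal. auto. }
split; [apply Rα|]. split; auto. split; [apply inter_sub_r|].
intros ψ Hψ Sψ Mψ.
destruct (coherent_club b α j0 hb Rα Iα Hj0) as [ι' [Hι' [Injι' Cc]]].
assert (Cd := restr_defined_club b α j0 ι' Rα Oj Hι' Injι' true j0 ψ Hψ (or_intror eq_refl)).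
assert (Vα : forall i, i ∈ α -> i ∈ V_ α).
{ intros i Hi. apply ord_in_V; auto. now apply (ord_mem α). }
assert (Cl : club α (fun β => forall k, Fset ζ α k -> (ι k ∈ β <-> ι' (π k) ∈ β))).
{ assert (C1 : club α (fun β => forall k, Fset ζ α k -> ι k ∈ V_ β -> ι' (π k) ∈ V_ β)).
  { apply (club_diag V α (Fset ζ α) ι (fun k β => ι' (π k) ∈ V_ β)); auto.
    intros k Fk. apply club_const; auto. }
  assert (C2 : club α (fun β => forall k, Fset ζ α k -> ι' (π k) ∈ V_ β -> ι k ∈ V_ β)).
  { apply (club_diag V α (Fset ζ α) (fun k => ι' (π k)) (fun k β => ι k ∈ V_ β)); auto.
    intros k Fk. apply club_const; auto. apply Vα, Fk. }
  apply (club_mono α _ _ (club_and α _ _ Lα C1 C2)).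
  intros β Hβ Lβ [K1 K2] k Fk. specialize (K1 k Fk). specialize (K2 k Fk).
  assert (Oβ := proj1 Lβ).
  assert (O1 : ordinal (ι k)) by (apply (ord_mem κ); auto; apply Hι, Sζ, Fk).
  assert (O2 : ordinal (ι' (π k))) by (apply (ord_mem α); auto).
  rewrite !ord_in_V in K1, K2 by auto. tauto. }
destruct (codes_exist b κ ζ α (Fset ζ α) ι Oζ HF Lα Inj' ζ Oζ (or_intror eq_refl) true ψ Hψ
  1 (fun _ => 0) nil (fun _ => Nat.lt_0_1)) as [KP HKP].
set (K := sep (V_ α) (fun t => exists l x r, t = enc (enc l :: x :: r) /\ KP l t)).
assert (HK : Codes α K (Fset ζ α) π ι true ζ 1 (fun _ => 0) nil ψ).
{ apply HKP. intros l x r. cbv zeta. intros Vt. unfold K. rewrite in_sep. split.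
  - intros [_ [l' [x' [r' [E M]]]]]. apply enc_inj in E. injection E as E1 _ _.
    apply enc_inj in E1. now rewrite <- E1 in M.
  - intros M. split; auto. exists (l ++ nil), x, r. auto. }
assert (S00 : forall δ, forall n : nat, no_vars n ⊆ V_ δ).
{ intros δ n x Hx. destruct (in_empty x Hx). }
(* Used twice: at α, where ψ keeps all indices, and at the reflection point β, where both index sets
   are cut. *)
assert (Main : forall δ F' G', inacc δ -> δ ∈ α \/ δ = α -> (forall k, F' k -> Fset ζ α k) ->
  (forall k, Fset ζ α k -> (G' (π k) <-> F' k)) -> (forall k, F' k -> ι k ∈ V_ δ) ->
  exists h, maps (V_ δ) (V_ δ) h /\ forall X, X ⊆ V_ δ ->
    (forall x l, enc (x :: l) ∈ V_ δ -> (enc (x :: l) ∈ X <-> enc (x :: l) ∈ K)) ->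
    (Uζ δ F' X -> satF δ G' ψ no_vars no_vars) /\
    (satF δ G' ψ no_vars no_vars -> limpt X δ ->
      (forall γ, γ ∈ δ -> empty ∈ V_ γ -> limpt X γ -> closed_at h γ) -> Uζ δ F' X)).
{ intros δ F' G' Iδ Hδ FF FG Fι.
  assert (Hδκ : δ ∈ κ) by (destruct Hδ as [Hδ|Hδ]; [now apply (ord_trans κ α)|now subst]).
  assert (Vd : enc nil ∈ V_ δ) by (apply V_empty_mem; apply Iδ).
  destruct (codes_sat α K (Fset ζ α) π ι κ δ F' G' Oκ Oα Iδ Hδκ Hδ FF FG Inj' Fι
    (fun k _ => Hπ k) true ζ 1 (fun _ => 0) nil ψ HK (le_n 1) (fun _ => Nat.lt_0_1) Vd
    no_vars (S00 δ)) as [h [Hh M]].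
  exists h. split; auto. intros X HX' Ag.
  destruct (M (upd no_vars 0 X)) as [M1 M2].
  - split.
    + intros n. unfold upd. destruct Nat.eq_dec; auto.
    + rewrite upd_eq. auto.
  - reflexivity.
  - simpl in M1, M2. rewrite upd_eq in M2. split; auto. intros B1 B2 B3. exact (M2 B1 (conj B2 B3)). }
destruct (Main α (Fset ζ α) (fun _ => True) Iα (or_intror eq_refl)) as [hα [Hhα Mα]]; auto.
{ tauto. }
{ intros k Fk. apply Vα, Fk. }
assert (Call := club_and α _ _ Lα (club_closed α hα Hhα)
  (club_and α _ _ Lα Cc (club_and α _ _ Lα Cd Cl))).
destruct Call as [h [Hh Ch]].
(* The code of ψ together with the stages closed under [h]. Its limit points are closed under [h],
   which combines the club needed for U to be true at α with those that make β suitable for ψ. *)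
set (X0 := sep (V_ α) (fun t => t ∈ K \/ exists β, β ∈ α /\ closed_at h β /\ t = V_ β)).
assert (X0α : X0 ⊆ V_ α).
{ intros x Hx. apply in_sep in Hx. tauto. }
assert (X0K : forall x l, enc (x :: l) ∈ V_ α -> (enc (x :: l) ∈ X0 <-> enc (x :: l) ∈ K)).
{ intros x l Vx. unfold X0. rewrite in_sep. split; [|tauto].
  intros [_ [H|[β [Hβ [_ E]]]]]; auto. apply opair_not_V in E; [tauto|].
  now apply (ord_mem α). }
assert (X0h : forall β, ordinal β -> V_ β ∈ X0 -> closed_at h β).
{ intros β Oβ H. apply in_sep in H. destruct H as [_ [H|[β' [Hβ' [H E]]]]].
  - apply in_sep in H. destruct H as [_ [l [x [r [E _]]]]]. symmetry in E.
    apply opair_not_V in E; tauto.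
  - apply V_inj in E; auto; [now subst|]. now apply (ord_mem α). }
assert (X0l : limpt X0 α).
{ intros x Hx. destruct (closed_at_unbounded α h x Iα Hh Hx) as [β [Hβ [C Vx]]].
  exists β. split; auto. split; auto. apply in_sep. split; [now apply V_in|]. eauto. }
assert (X0c : forall γ, γ ∈ α -> empty ∈ V_ γ -> limpt X0 γ -> closed_at h γ).
{ intros γ Hγ V0 Lm. apply (closed_at_limpt h X0); auto; [now apply (ord_mem α)|].
  intros ->. apply in_V in V0. destruct V0 as [? [V0 _]]. exact (in_empty _ V0). }
assert (UX0 : Uζ α (Fset ζ α) X0).
{ apply (Mα X0 X0α X0K); auto.
  - apply (sat_satF α true j0 ψ Hψ). exact Mψ.
  - intros γ Hγ V0 Lm. now apply (Ch γ Hγ (X0c γ Hγ V0 Lm)). }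
(* [X0] is unbounded and U holds of it, so it must be caught. The tuple found in [R] determines its
   stage and its set, which are therefore β and X0 ∩ V_β. *)
destruct (HX X0 X0α) as [[N|[β [Hβ [Lm [V0 Hin]]]]]|N]; [tauto| |tauto].
apply HR in Hin. destruct Hin as [β' [y [Hβ' [Sβ [Rβ [Nβ [Hy [Uβ E]]]]]]]].
apply enc_inj in E. injection E as E1 E2.
assert (Oβ := ord_mem _ _ Oα Hβ).
apply V_inj in E1; auto; [|now apply (ord_mem κ)]. subst β' y.
assert (Cβ := X0c β Hβ V0 Lm).
destruct (Ch β Hβ Cβ) as [_ [HFβ [Dβ Lβ]]]. clear Ch.
assert (Iβ : inacc β) by (apply Nβ; auto).
assert (Lmβ : limit β) by apply Rβ.
destruct (Dβ HFβ (or_intror eq_refl)) as [D1 [D2 _]].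
exists β. split; [apply in_inter; auto|]. split; auto. split; auto.
split; [eexists; left; exact D2|].
apply (sat_restr b α j0 β _ Oα Oj HFβ true j0 ψ Hψ (or_intror eq_refl)).
assert (Vβ := V_le α β Oα Hβ).
(* From the truth of U in [V_ β] to that of ψ no condition on the code is needed. *)
destruct (Main β (Fset ζ β) (fun k => k ∈ j0 /\ ι' k ∈ β) Iβ (or_introl Hβ)) as [hβ [_ Mβ]].
- intros k [K1 K2]. split; auto. now apply (ord_trans α β).
- intros k Fk. rewrite <- (Lβ k Fk). unfold Fset. destruct Fk as [Fk1 Fk2].
  assert (Hk : π k ∈ j0) by (apply πj; split; auto). tauto.
- intros k [K1 K2]. apply label_V_iff; auto.
- apply (Mβ (inter X0 (V_ β))); auto using inter_sub_r.
  intros x l Vx. rewrite in_inter. rewrite X0K by auto. tauto.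
Qed.

End Universal.

Theorem corollary5p10 (b : V -> V -> V -> V) (hb : canonical_bijections b)
    (κ ξ ζ S : V) (hκ : cardinal κ) (hξ : lt_card_succ ξ κ) (hS : S ⊆ κ)
    (hSξ : indescribable b ξ κ S) (hζ : ζ ∈ ξ) :
  sep κ (fun α => indescribable b (canf b κ ζ α) α (inter S α)) ∈ Pi_filter b ξ κ.
Proof.
set (C := sep κ (fun α => indescribable b (canf b κ ζ α) α (inter S α))).
assert (SC : C ⊆ κ) by (intros x Hx; apply in_sep in Hx; tauto).
apply in_sep. split; [now apply in_power|]. apply in_sep. split.
{ apply in_power. intros x Hx. apply in_sep in Hx. tauto. }
intros HT. assert (Oξ := lt_card_succ_ord _ _ hξ).
assert (Iκ := indescribable_inacc b ξ κ S hSξ Oξ). assert (Lκ : limit κ) by apply Iκ.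
assert (Oκ := proj1 Lκ).
assert (Rκ := inacc_regular κ hκ Iκ).
destruct (coherent_club b κ ξ hb Rκ Iκ hξ) as [ι [Hι [Inj Cc]]].
assert (Cn : club κ (nice b κ ξ ζ ι)).
{ apply (club_and κ _ _ Lκ Cc). apply (club_and κ _ _ Lκ (inacc_club κ Iκ)).
  assert (Oι : ordinal (ι ζ)) by (apply (ord_mem κ); auto).
  apply (club_mono κ (fun α => ι ζ ∈ V_ α)).
  - apply club_const; auto. apply ord_in_V; auto.
  - intros α _ Lα. rewrite ord_in_V; auto. apply Lα. }
set (R := sep (V_ κ) (fun t => exists β y, β ∈ κ /\ β ∈ S /\ regular β /\
  nice b κ ξ ζ ι β /\ y ⊆ V_ β /\ Uζ κ ζ ι β (Fset ι ζ β) y /\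
  t = enc (empty :: V_ β :: y :: nil))).
assert (HR : forall t, t ∈ R <-> exists β y, β ∈ κ /\ β ∈ S /\ regular β /\
  nice b κ ξ ζ ι β /\ y ⊆ V_ β /\ Uζ κ ζ ι β (Fset ι ζ β) y /\
  t = enc (empty :: V_ β :: y :: nil)).
{ intros t. unfold R. rewrite in_sep. split; [tauto|]. intros H. split; auto.
  destruct H as [β [y [Hβ [_ [Rβ [_ [Hy [_ ->]]]]]]]].
  apply enc_V; auto. constructor; [apply V_empty_mem; apply Lκ|].
  constructor; [now apply V_in|]. constructor; auto. now apply (V_sub_mem κ β). }
destruct (reflect_Φ b κ ξ ζ S R ι Oξ hζ Iκ Hι Inj HR (setminus κ C) hSξ HT Cn)
  as [α [Hα [Rα [Nα HX]]]].
apply in_sep in Hα. destruct Hα as [Kα Nα']. apply Nα'. apply in_sep. split; auto.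
apply (indescribable_below b κ ξ ζ S R ι); auto.
Qed.
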